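(* Let $q\in\mathbb C^*$. There is an open torus inside $\check{\mathbb X}^\circ$, given by an open embedding $\iota:\mathcal T=(\mathbb C^* )^{k(n-k)}\hookrightarrow\check{\mathbb X}^\circ$ independent of $q$, such that the restriction of the superpotential $W_q$ to it is the Eguchi–Hori–Xiong Laurent polynomial: $\iota^*W_q=L_q$. Moreover the holomorphic volume form $\omega$ (suitably normalised) restricted to this torus agrees with the standard torus-invariant volume form: $\iota^*\omega=\omega_{\mathcal T}$.
   Context: Fix $1\le k\le n-1$, $N=k(n-k)$. Laurent polynomial. Let $\mathcal V=\{(i,j):1\le i\le n-k,\ 1\le j\le k\}\sqcup\{(0,1),(n-k,k+1)\}$, and consider the quiver with vertex set $\mathcal V$ and arrows $(i,j)\to(i,j+1)$ and $(i,j)\to(i+1,j)$ whenever both endpoints lie in $\mathcal V$. Let $z_{ij}$ ($1\le i\le n-k$, $1\le j\le k$) be the coordinates on $\mathcal T=(\mathbb C^* )^{k(n-k)}$ and set $z_{0,1}=1$, $z_{n-k,k+1}=q$. Then $L_q=\sum_a z_{h(a)}/z_{t(a)}$, the sum over all arrows $a$ with head $h(a)$ and tail $t(a)$. $\omega_{\mathcal T}=\bigwedge_{i,j}\frac{dz_{ij}}{z_{ij}}$ (lexicographic order). Mirror. $\mathcal P_{k,n}$ is the set of Young diagrams $\lambda$ in a rectangle with $n-k$ rows and $k$ columns. Place $\lambda$ in the top-left corner; its boundary is a lattice path from the top right to the bottom left corner of the rectangle with $k$ horizontal and $n-k$ vertical steps; $J_\lambda\subset\{1,\dots,n\}$ is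 the set of positions of the horizontal steps, numbered from the top right. $\check{\mathbb X}=Gr_k((\mathbb C^n)^* )$: points are row spans of $k\times n$ matrices, $p_\lambda$ is the minor with column set $J_\lambda$. Indices modulo $n$; $\mu_i,\widehat\mu_i$ ($1\le i\le n$) are the partitions with $J_{\mu_i}=\{i+1,\dots,i+k\}$ and $J_{\widehat\mu_i}=\{i+1,\dots,i+k-1\}\cup\{i+k+1\}$. $D=\bigcup_i\{p_{\mu_i}=0\}$, $\check{\mathbb X}^\circ=\check{\mathbb X}\setminus D$, $p_\emptyset=1$ on $\check{\mathbb X}^\circ$, $W_q=\sum_{i=1}^n\frac{p_{\widehat\mu_i}}{p_{\mu_i}}q^{\delta_{i,n-k}}$. $\omega$ is a non-vanishing holomorphic volume form on $\check{\mathbb X}^\circ$ with simple poles along $D$; it is unique up to a nonzero scalar. *)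

(* Defs.v *)
From HB Require Import structures.
From mathcomp Require Import all_boot all_order all_algebra.
From mathcomp Require Import complex.
From mathcomp Require Import boolp classical_sets reals topology normedtype derive.
(* not imported: its notations clash with those of mathcomp-analysis *)
From mathcomp Require mpoly.
Set Implicit Arguments.
Unset Strict Implicit.
Unset Printing Implicit Defensive.
Import Order.TTheory GRing.Theory Num.Theory numFieldNormedType.Exports.
Local Open Scope classical_set_scope.
Local Open Scope ring_scope.

(* The topology and the norm of [R[i]] are found only through the
   [numFieldType] structure. [differentiable] over [Cx R] is thus complex
   differentiability. *)
Definition Cx (R : realType) : numFieldType := (R[i] : numFieldType).

Section QuasiAffine.
(* A set [U] of points, located by the affine coordinates [x]. *)
Variables (K : fieldType) (X : Type) (m : nat) (x : X -> 'I_m -> K) (U : set X).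

Definition regular_fun (f : X -> K) : Prop :=
  forall a, U a -> exists P Q : mpoly.mpoly m K,
    mpoly.meval (x a) Q != 0 /\
    forall b, U b -> mpoly.meval (x b) Q != 0 ->
      f b = mpoly.meval (x b) P / mpoly.meval (x b) Q.

Definition zariski_open (V : set X) : Prop :=
  exists S : set (mpoly.mpoly m K),
    V = [set a | U a /\ exists2 P, S P & mpoly.meval (x a) P != 0].

End QuasiAffine.

Section Laurent.
Variables (R : realType) (n k : nat).
Local Notation C := (Cx R).

Definition torus : set 'M[C]_(n - k, k) := [set z | forall i j, z i j != 0].

(* [inr false] is the vertex (0,1) and [inr true] is the vertex (n-k,k+1). *)
Definition vertex : finType := ('I_(n - k) * 'I_k + bool)%type.

Definition vpos (v : vertex) : nat * nat :=
  match v with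
  | inl (i, j) => (i.+1, j.+1)
  | inr false => (0, 1)%N
  | inr true => (n - k, k.+1)%N
  end.

Definition arrow (v w : vertex) : bool :=
  (vpos w == ((vpos v).1, (vpos v).2.+1)) ||
  (vpos w == ((vpos v).1.+1, (vpos v).2)).

Definition zval (q : C) (z : 'M[C]_(n - k, k)) (v : vertex) : C :=
  match v with
  | inl (i, j) => z i j
  | inr false => 1
  | inr true => q
  end.

Definition laurent (q : C) (z : 'M[C]_(n - k, k)) : C :=
  \sum_(a : vertex * vertex | arrow a.1 a.2) zval q z a.2 / zval q z a.1.

(* Coefficient of the standard form with respect to the wedge of the dz_ij,
   which are taken in the lexicographic order. *)
Definition torus_form (z : 'M[C]_(n - k, k)) : C := \prod_i \prod_j (z i j)^-1.

End Laurent.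

Section Mirror.
Variables (R : realType) (n k : nat).
Local Notation C := (Cx R).

(* A point of Gr_k((C^n)^* ) is the row span of a matrix A of rank k; two
   matrices are the same point when [(A == B)%MS]. As lambda |-> J_lambda is a
   bijection from the diagrams in the (n-k) x k rectangle to the k-subsets of
   {1, ..., n}, Pluecker coordinates are indexed by J_lambda; the position
   j + 1 is represented by j : 'I_n. *)

(* the first m columns with index in J, in increasing order *)
Definition cols (m : nat) (J : {set 'I_n}) (A : 'M[C]_(k, n)) : 'M[C]_(k, m) :=
  \matrix_(i, j) nth 0 [seq A i c | c <- enum J] j.

Definition minor (J : {set 'I_n}) (A : 'M[C]_(k, n)) : C := \det (cols k J A).

(* The boundary path of the empty diagram starts with its k horizontal steps. *)
Definition Jempty : {set 'I_n} := [set j : 'I_n | (j < k)%N].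

Definition mu (i : nat) : {set 'I_n} :=
  [set j : 'I_n | [exists t : 'I_k, (j.+1 == i + t.+1 %[mod n])%N]].

Definition muhat (i : nat) : {set 'I_n} :=
  [set j : 'I_n | [exists t : 'I_k.-1, (j.+1 == i + t.+1 %[mod n])%N]
                  || ((j.+1 == i + k.+1 %[mod n])%N)].

Definition mirror : set 'M[C]_(k, n) :=
  [set A | \rank A = k /\
           forall i, (1 <= i <= n)%N -> minor (mu i) A != 0].

(* Both terms of each ratio scale alike, so the normalisation p_empty = 1 is
   not needed here. *)
Definition superpotential (q : C) (A : 'M[C]_(k, n)) : C :=
  \sum_(1 <= i < n.+1)
    minor (muhat i) A / minor (mu i) A * q ^+ (i == n - k)%N.

(* The affine coordinates p_lambda on the mirror, with p_empty = 1. *)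
Definition plcoord (A : 'M[C]_(k, n))
    (l : 'I_#|[set J : {set 'I_n} | #|J| == k]%SET|) : C :=
  minor (enum_val l) A / minor Jempty A.

Definition torus_coord (z : 'M[C]_(n - k, k)) (l : 'I_((n - k) * k)) : C :=
  mxvec z 0 l.

Definition image_pts (iota : 'M[C]_(n - k, k) -> 'M[C]_(k, n)) :
    set 'M[C]_(k, n) :=
  [set A | mirror A /\ exists2 z, torus z & (A == iota z)%MS].

(* iota is an isomorphism of varieties from the torus onto a Zariski open
   subset of the mirror; it is given by representatives of the row spans. *)
Definition open_embedding (iota : 'M[C]_(n - k, k) -> 'M[C]_(k, n)) : Prop :=
  [/\ forall z, torus z -> mirror (iota z),
      forall l, regular_fun torus_coord (@torus R n k)
                  (fun z => plcoord (iota z) l),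
      zariski_open plcoord mirror (image_pts iota)
    & exists kappa : 'M[C]_(k, n) -> 'M[C]_(n - k, k),
        (forall A z, torus z -> (A == iota z)%MS -> kappa A = z) /\
        (forall l, regular_fun plcoord (image_pts iota)
                     (fun A => torus_coord (kappa A) l)) ].

(* The chart p_J <> 0 of the Grassmannian: B is sent to the row span of the
   matrix with identity in the columns J and B^T in the other columns. B is
   transposed so that charts and torus have coordinates of the same shape. *)
Definition chart (J : {set 'I_n}) (B : 'M[C]_(n - k, k)) : 'M[C]_(k, n) :=
  \matrix_(i, c)
    if c \in J then (index c (enum J) == i)%:R
    else nth 0 [seq B r i | r <- enum 'I_(n - k)] (index c (enum (~: J))).

Definition chart_coord (J : {set 'I_n}) (A : 'M[C]_(k, n)) :
    'M[C]_(n - k, k) :=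
  (invmx (cols k J A) *m cols (n - k) (~: J) A)^T.

Definition jac (f : 'M[C]_(n - k, k) -> 'M[C]_(n - k, k))
    (B : 'M[C]_(n - k, k)) : C :=
  \det (lin_mx ('d f B)).

(* A form of top degree, by its coefficients with respect to the wedge (in
   lexicographic order) of the dB_ij in the charts J, #|J| = k. *)
Definition top_form := {set 'I_n} -> 'M[C]_(n - k, k) -> C.

Definition nonvanishing_holomorphic_form (omega : top_form) : Prop :=
  [/\ forall (J : {set 'I_n}) B,
        #|J| = k -> mirror (chart J B) -> differentiable (omega J) B,
      forall (J : {set 'I_n}) B,
        #|J| = k -> mirror (chart J B) -> omega J B != 0
    & forall (J J' : {set 'I_n}) B, #|J| = k -> #|J'| = k ->
        mirror (chart J B) -> minor J' (chart J B) != 0 ->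
        let tau := fun B => chart_coord J' (chart J B) in
        omega J B = omega J' (tau B) * jac tau B ].

(* In the chart J, p_J = 1 and p_(mu_i) is the reduced equation of the
   irreducible divisor D_i = {p_(mu_i) = 0}. The pole of omega has order one
   along each D_i: its coefficient times the equation of D extends
   holomorphically across D, and the extension does not vanish identically on
   any D_i that meets the chart. *)
Definition simple_poles (omega : top_form) : Prop :=
  forall J : {set 'I_n}, #|J| = k -> exists g : 'M[C]_(n - k, k) -> C,
    [/\ forall B, differentiable g B,
        forall B, mirror (chart J B) ->
          g B = omega J B * \prod_(1 <= i < n.+1) minor (mu i) (chart J B)
      & forall i, (1 <= i <= n)%N ->
          (exists B, minor (mu i) (chart J B) = 0) ->
          exists2 B, minor (mu i) (chart J B) = 0 & g B != 0 ].

(* Coefficient at z of the pullback of omega, computed in the chart J. *)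
Definition pullback (iota : 'M[C]_(n - k, k) -> 'M[C]_(k, n))
    (omega : top_form) (J : {set 'I_n}) (z : 'M[C]_(n - k, k)) : C :=
  let phi := fun z => chart_coord J (iota z) in
  omega J (phi z) * jac phi z.

Definition scale_form (c : C) (omega : top_form) : top_form :=
  fun J B => c * omega J B.

End Mirror.

(* Main.v *)
(** The torus is parametrised by [z_ij = p_(i x j) / p_((i-1) x (j-1))], where
    [p_(i x j)] is the Pluecker coordinate of the rectangle with i rows and j
    columns: these ratios determine, recursively in k, a k x n matrix whose
    columns satisfy a two-term recursion. In that recursion the ratios
    [p_(muhat_i) / p_(mu_i)] telescope to the sums of [z_h / z_t] over a row or
    a column of the quiver.

    In the chart [p_empty <> 0] this parametrisation is unitriangular up to signs
    and a permutation, so its Jacobian is constant, while the product of the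
    [p_(mu_i)] is the product of the [z_ij]. It remains to see that the
    coefficient of omega in this chart is a constant multiple of
    [1 / prod_i p_(mu_i)]. The quotient g of the two is entire, and on the line
    where a single entry of the chart varies it converges at infinity to a value
    read off in a neighbouring chart. By Liouville's theorem g does not depend on
    that entry, hence it is constant. *)

Require Import Defs.
From HB Require Import structures.
From mathcomp Require Import all_boot all_order all_algebra all_fingroup.
From mathcomp Require Import complex.
From mathcomp Require Import boolp classical_sets reals topology normedtype derive.
From mathcomp Require Import functions constructive_ereal landau.
From mathcomp Require Import measure lebesgue_measure lebesgue_integral ftc.
From mathcomp Require mpoly.
Import (canonicals) mpoly.
From mathcomp Require Import zify ring lra.

Set Implicit Arguments.
Unset Strict Implicit.
Unset Printing Implicit Defensive.
Import Order.TTheory GRing.Theory Num.Theory numFieldNormedType.Exports.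
Local Open Scope classical_set_scope.
Local Open Scope ring_scope.

(** * Goursat's theorem for closed real 1-forms *)

(** The neighbouring chart is usable because two powers cancel. A change of charts has as Jacobian a
    constant times the [-n]-th power of the minor that defines the new chart, while the product of
    the n coordinates [p_(mu_i)] scales with the [n]-th power of that minor. So the functions g of
    two charts differ by a constant factor where both charts apply, and continuity of the second g
    supplies the limit at infinity. Lines inside the divisor say nothing about omega; they are
    reached by continuity from lines through the mirror.

    Liouville's theorem is applied to an entire f with a limit L at infinity. If [f 0] were not L,
    then [(f z - f 0) / (z (L - f 0))] would be continuous, holomorphic off 0 and close to [1/z] far
    out. Its integral around a large square vanishes by Goursat's theorem, whereas the imaginary
    part of the form is positive along every side. Since only a sign is used, real 1-forms on
    squares and primitives along the sides suffice: no path integral and no residue is computed. *)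

Lemma continuous_primitive (R : realType) (f : R -> R) (rho : R) :
  continuous f ->
  exists F : R -> R, forall x, `|x| <= rho -> is_derive x (1 : R) F (f x).
Proof.
(* The margin 1 puts the points with [|x| <= rho] in the interior of the interval of integration. *)
move=> cf; pose a := - rho - 1; pose u := rho + 1.
exists (fun x => (\int[@lebesgue_measure R]_(t in [set` `[a, x]]) (f t))%R).
move=> x; rewrite ler_norml => /andP[x1 x2].
have xu : x < u by rewrite /u; lra.
have ax : a < x by rewrite /a; lra.
have intf : (@lebesgue_measure R).-integrable `[a, u] (EFin \o f).
  apply: continuous_compact_integrable; first exact: segment_compact.
  exact: continuous_subspaceT.
have [d1 d2] := continuous_FTC1_closed xu intf ax (cf x).
by apply: DeriveDef; [exact: d1 | rewrite -derive1E; exact: d2].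
Qed.

(* The form [P dx + Q dy]; [IP] is a primitive of [P] in [x], and [IQ] is a
   primitive of [Q] in [y]. *)
Section Goursat.
Variables (R : realType) (P Q IP IQ : R -> R -> R) (rho : R).

(* Differentiability of [P] and [Q] at [(x, y)] with [dP/dy = dQ/dx]. *)
Definition closed_at (x y : R) : Prop :=
  exists al be ga : R, forall e, 0 < e -> exists2 d, 0 < d &
    forall r x' y', r <= d -> `|x' - x| <= r -> `|y' - y| <= r ->
      `|P x' y' - P x y - (al * (x' - x) + be * (y' - y))| <= e * r /\
      `|Q x' y' - Q x y - (be * (x' - x) + ga * (y' - y))| <= e * r.

(* The integral over the boundary of the square [a, a+s] x [b, b+s]. *)
Definition circulation (a b s : R) : R :=
  (IP (a + s) b - IP a b) - (IP (a + s) (b + s) - IP a (b + s))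
  + (IQ (a + s) (b + s) - IQ (a + s) b) - (IQ a (b + s) - IQ a b).

Definition in_range (a b s : R) : Prop :=
  [/\ - rho <= a, a + s <= rho, - rho <= b & b + s <= rho].

Hypothesis IPd : forall x y, `|x| <= rho -> `|y| <= rho ->
  is_derive x (1 : R) (fun t => IP t y) (P x y).
Hypothesis IQd : forall x y, `|x| <= rho -> `|y| <= rho ->
  is_derive y (1 : R) (IQ x) (Q x y).

Lemma mvt_cc (F dF : R -> R) (a s : R) : 0 <= s ->
  (forall x, a <= x <= a + s -> is_derive x (1 : R) F (dF x)) ->
  exists2 c, a <= c <= a + s & F (a + s) - F a = dF c * s.
Proof.
move=> s0 dF_.
have [|||c cI E] := @MVT_segment R F dF a (a + s).
- by rewrite lerDl.
- by move=> x; rewrite in_itv /= => /andP[/ltW h1 /ltW h2]; apply: dF_; rewrite h1 h2.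
- apply: derivable_within_continuous => x; rewrite in_itv /= => h.
  by have := dF_ _ h.
- by exists c; [move: cI; rewrite in_itv | rewrite E; congr (_ * _); ring].
Qed.

(** Opposite sides are paired before the mean value theorem is applied, so a single intermediate
    point serves both sides of a pair. *)
Lemma circulation_mvt (a b s : R) : 0 <= s -> in_range a b s ->
  exists x y, [/\ a <= x <= a + s, b <= y <= b + s &
    circulation a b s = (P x b - P x (b + s) + Q (a + s) y - Q a y) * s].
Proof.
move=> s0 [ha1 ha2 hb1 hb2].
have hb : `|b| <= rho by rewrite ler_norml; apply/andP; split; lra.
have hbs : `|b + s| <= rho by rewrite ler_norml; apply/andP; split; lra.
have ha : `|a| <= rho by rewrite ler_norml; apply/andP; split; lra.
have has : `|a + s| <= rho by rewrite ler_norml; apply/andP; split; lra.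
have [|x xI Ex] := @mvt_cc (fun t => IP t b - IP t (b + s))
   (fun t => P t b - P t (b + s)) a s s0.
  move=> t tI; have hx : `|t| <= rho by rewrite ler_norml; apply/andP; split; lra.
  apply: is_deriveB; exact: IPd.
have [|y yI Ey] := @mvt_cc (fun t => IQ (a + s) t - IQ a t)
   (fun t => Q (a + s) t - Q a t) b s s0.
  move=> t tI; have hx : `|t| <= rho by rewrite ler_norml; apply/andP; split; lra.
  apply: is_deriveB; exact: IQd.
exists x, y; split=> //; rewrite /circulation.
transitivity ((P x b - P x (b + s)) * s + (Q (a + s) y - Q a y) * s); last by ring.
by rewrite -Ex -Ey; ring.
Qed.

(** In the linear approximation the two pairs of sides contribute [- be * s] and [be * s], which
    cancel because dP/dy = dQ/dx. Each of the four remaining errors is at most [e * s]. *)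
Lemma circulation_small (x y e : R) : closed_at x y -> 0 < e ->
  exists2 d, 0 < d & forall a b s, 0 <= s <= d -> in_range a b s ->
    a <= x <= a + s -> b <= y <= b + s -> `|circulation a b s| <= 4 * e * s ^+ 2.
Proof.
move=> [al [be [ga h]]] e0; have [d d0 hd] := h e e0; exists d => // a b s /andP[s0 sd].
move=> rg /andP[ax xa] /andP[by_ yb].
have [x' [y' [/andP[x1 x2] /andP[y1 y2] ->]]] := circulation_mvt s0 rg.
rewrite normrM (ger0_norm s0) expr2 mulrA ler_wpM2r //.
rewrite ler_norml.
have [] := hd s x' b sd; rewrite ?ler_norml; [lra|lra|move=> /andP[A1 A2] _].
have [] := hd s x' (b + s) sd; rewrite ?ler_norml; [lra|lra|move=> /andP[B1 B2] _].
have [] := hd s (a + s) y' sd; rewrite ?ler_norml; [lra|lra|move=> _ /andP[C1 C2]].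
have [] := hd s a y' sd; rewrite ?ler_norml; [lra|lra|move=> _ /andP[D1 D2]].
apply/andP; split; lra.
Qed.

Lemma circulation_quarters (a b s : R) :
  circulation a b s =
    circulation a b (s / 2) + circulation (a + s / 2) b (s / 2)
    + circulation a (b + s / 2) (s / 2) + circulation (a + s / 2) (b + s / 2) (s / 2).
Proof.
have E c : c + s / 2 + s / 2 = c + s by field.
by rewrite /circulation !E; ring.
Qed.

Lemma in_range_quarter (a b s : R) (i j : bool) : 0 <= s -> in_range a b s ->
  in_range (a + i%:R * (s / 2)) (b + j%:R * (s / 2)) (s / 2).
Proof. by move=> s0 []; case: i j => [] []; rewrite /in_range /=; split; lra. Qed.

Lemma quarter_large (a b s e : R) : 0 <= s -> e * s ^+ 2 <= `|circulation a b s| ->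
  exists ij : bool * bool,
  e * (s / 2) ^+ 2 <=
    `|circulation (a + ij.1%:R * (s / 2)) (b + ij.2%:R * (s / 2)) (s / 2)|.
Proof.
move=> s0; rewrite circulation_quarters => h.
apply: contrapT => /forallNP H.
have := H (false, false); have := H (true, false); have := H (false, true).
have := H (true, true) => /=; rewrite !mul0r !mul1r !addr0.
move=> /negP; rewrite -ltNge => h1 /negP; rewrite -ltNge => h2.
move=> /negP; rewrite -ltNge => h3 /negP; rewrite -ltNge => h4.
suff : e * s ^+ 2 < e * s ^+ 2 by rewrite ltxx.
apply: (le_lt_trans h); apply: (le_lt_trans (ler_normD _ _)).
have -> : e * s ^+ 2 = e * (s / 2) ^+ 2 + e * (s / 2) ^+ 2 + e * (s / 2) ^+ 2 + e * (s / 2) ^+ 2.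
  by field.
apply: ltrD => //; apply: (le_lt_trans (ler_normD _ _)); apply: ltrD => //.
by apply: (le_lt_trans (ler_normD _ _)); apply: ltrD.
Qed.

Lemma nested_point (a : nat -> R) (s : R) : 0 <= s ->
  (forall n, a n <= a n.+1 /\ a n.+1 + s / 2 ^+ n.+1 <= a n + s / 2 ^+ n) ->
  exists x, forall n, a n <= x <= a n + s / 2 ^+ n.
Proof.
move=> s0 h.
have mon m n : (m <= n)%N -> a m <= a n.
  elim: n => [|n IH]; first by rewrite leqn0 => /eqP->.
  rewrite leq_eqVlt => /orP[/eqP->//|]; rewrite ltnS => /IH /le_trans; apply.
  by case: (h n).
have mon' m n : (m <= n)%N -> a n + s / 2 ^+ n <= a m + s / 2 ^+ m.
  elim: n => [|n IH]; first by rewrite leqn0 => /eqP->.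
  rewrite leq_eqVlt => /orP[/eqP->//|]; rewrite ltnS => /IH; apply: le_trans.
  by case: (h n).
have pos n : 0 <= s / 2 ^+ n by rewrite divr_ge0 // exprn_ge0.
have ub n : ubound (range a) (a n + s / 2 ^+ n).
  move=> _ [m _ <-]; case: (leqP m n) => mn.
    by apply: (le_trans (mon _ _ mn)); rewrite lerDl.
  by apply: le_trans (mon' _ _ (ltnW mn)); rewrite lerDl.
exists (sup (range a)) => n; apply/andP; split.
  by apply: ub_le_sup; [exists (a 0 + s / 2 ^+ 0); exact: ub | exists n].
by apply: ge_sup; [exists (a 0%N); exists 0%N | exact: ub].
Qed.

Lemma half_pow_small (s d : R) : 0 <= s -> 0 < d -> exists n, s / 2 ^+ n <= d.
Proof.
move=> s0 d0; exists (Num.bound (s / d)); set n := Num.bound _.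
rewrite ler_pdivrMr ?exprn_gt0 // mulrC -ler_pdivrMr //.
have := archi_boundP (divr_ge0 s0 (ltW d0)); rewrite -/n => /ltW /le_trans; apply.
rewrite -natrX ler_nat; apply: ltnW; exact: ltn_expl.
Qed.

(** Goursat's bisection: some quarter always keeps a ratio of circulation to area of at least [e],
    and the nested squares shrink to a point where closedness forces a smaller ratio. *)
Theorem goursat_square (a b s : R) : 0 <= s -> in_range a b s ->
  (forall x y, a <= x <= a + s -> b <= y <= b + s -> closed_at x y) ->
  circulation a b s = 0.
Proof.
move=> s0 rg cl; apply/eqP; apply: contrapT => /negP nz.
have sp : 0 < s.
  rewrite lt_neqAle s0 andbT; apply/negP => /eqP E; case/negP: nz.
  by rewrite -E /circulation !addr0; apply/eqP; ring.
pose e := `|circulation a b s| / s ^+ 2.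
have e0 : 0 < e by rewrite divr_gt0 ?normr_gt0 // exprn_gt0.
pose T := (R * R)%type.
pose ok n (p : T) := [/\ in_range p.1 p.2 (s / 2 ^+ n),
   a <= p.1, p.1 + s / 2 ^+ n <= a + s, b <= p.2 & p.2 + s / 2 ^+ n <= b + s]
   /\ e * (s / 2 ^+ n) ^+ 2 <= `|circulation p.1 p.2 (s / 2 ^+ n)|.
have pos n : 0 <= s / 2 ^+ n by rewrite divr_ge0 // exprn_ge0.
have hs n : s / 2 ^+ n.+1 = s / 2 ^+ n / 2.
  by rewrite exprSr invfM mulrA.
(* The hypothesis [ok n p] stands under the existential quantifier so that [choice] yields a total
   successor function. *)
have step n (p : T) : exists q : T, ok n p -> ok n.+1 q /\
   [/\ p.1 <= q.1, q.1 + s / 2 ^+ n.+1 <= p.1 + s / 2 ^+ n,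
       p.2 <= q.2 & q.2 + s / 2 ^+ n.+1 <= p.2 + s / 2 ^+ n].
  have [okp|nok] := pselect (ok n p); last by exists p.
  have [[rp p1 p2 p3 p4] lp] := okp.
  have [[i j] /= hij] := quarter_large (pos n) lp.
  exists (p.1 + i%:R * (s / 2 ^+ n / 2), p.2 + j%:R * (s / 2 ^+ n / 2)) => _.
  have := in_range_quarter i j (pos n) rp; rewrite /ok hs /=.
  have := pos n; set r := s / 2 ^+ n in p2 p4 *.
  move=> r0 [q1 q2 q3 q4]; clear -r0 q1 q2 q3 q4 hij p1 p2 p3 p4.
  by repeat split=> //; clear q1 q2 q3 q4 hij; case: i j => [] []; rewrite /=; lra.
have [g gP] := choice (fun np : nat * T => step np.1 np.2).
pose fix w n : T := if n is n'.+1 then g (n', w n') else (a, b).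
have wok n : ok n (w n).
  elim: n => [|n IH]; last by have [] := gP (n, w n) IH.
  rewrite /ok /= !expr0 divr1; split; first by split.
  by rewrite /e divfK // expf_neq0 // gt_eqF.
have [x xP] : exists x, forall n, (w n).1 <= x <= (w n).1 + s / 2 ^+ n.
  by apply: nested_point => // n; have [_ []] := gP (n, w n) (wok n).
have [y yP] : exists y, forall n, (w n).2 <= y <= (w n).2 + s / 2 ^+ n.
  by apply: nested_point => // n; have [_ []] := gP (n, w n) (wok n).
(* The factor 4 of [circulation_small] turns [e / 8] into [e / 2], strictly below [e]. *)
have e8 : 0 < e / 8 by lra.
have cxy : closed_at x y.
  by apply: cl; [have := xP 0%N | have := yP 0%N]; rewrite /= expr0 divr1.
have [d d0 hd] := circulation_small cxy e8.
have [n sn] := half_pow_small s0 d0.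
have [[rgn _ _ _ _] big] := wok n.
have := hd _ _ (s / 2 ^+ n) _ rgn (xP n) (yP n); rewrite pos sn => /(_ isT) small.
have := le_trans big small.
have -> : 4 * (e / 8) = e / 2 by field.
have q0 : 0 < (s / 2 ^+ n) ^+ 2 by rewrite exprn_gt0 // divr_gt0 // exprn_gt0.
by rewrite (ler_pM2r q0); lra.
Qed.

(* Of the four quarters of a square with a corner at the origin, only the one at
   the origin contributes; so its circulation is that of arbitrarily small
   squares, where [P] and [Q] are bounded. *)
Theorem goursat_puncture (M r1 : R) :
  0 < r1 <= rho ->
  (forall x y, (x != 0) || (y != 0) -> closed_at x y) ->
  (forall x y, `|x| <= r1 -> `|y| <= r1 -> `|P x y| <= M /\ `|Q x y| <= M) ->
  circulation (- rho) (- rho) (2 * rho) = 0.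
Proof.
move=> /andP[r10 r1r] cl bd; have r0 : 0 < rho by exact: lt_le_trans r1r.
have M0 : 0 <= M by have [] := bd 0 0; rewrite ?normr0 ?(ltW r10) // => /(le_trans (normr_ge0 _)).
(* The booleans select one of the four squares with a corner at the origin: [i] places it to the
   left, [j] below. *)
have half (i j : bool) s : 0 < s -> s <= rho ->
  circulation (- (i%:R * s)) (- (j%:R * s)) s =
  circulation (- (i%:R * (s / 2))) (- (j%:R * (s / 2))) (s / 2).
  move=> s0 sr.
  have away a b : in_range a b (s / 2) ->
      (0 < a \/ a + s / 2 < 0) \/ (0 < b \/ b + s / 2 < 0) -> circulation a b (s / 2) = 0.
    move=> rg ne; apply: goursat_square => //; first by lra.
    move=> x y /andP[x1 x2] /andP[y1 y2]; apply: cl; rewrite -negb_and.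
    apply/negP => /andP[/eqP xE /eqP yE]; move: x1 x2 y1 y2; rewrite xE yE => x1 x2 y1 y2.
    by clear -ne x1 x2 y1 y2; case: ne => -[]; lra.
  have E : - s + s / 2 = - (s / 2) by field.
  have L : s / 2 <= rho by lra.
  have L0 : 0 < s / 2 by lra.
  have L1 : - s + s / 2 < 0 by lra.
  rewrite circulation_quarters; case: i j => [] []; rewrite /= ?mul1r ?mul0r ?oppr0 ?add0r ?E.
  - rewrite (away (- s) (- s)) ?(away (- (s / 2)) (- s)) ?(away (- s) (- (s / 2)));
      rewrite ?add0r //; try (by rewrite /in_range; clear -s0 sr L L0; split; lra); try (by left; right);
      by right; right.
  - rewrite (away (- s) 0) ?(away (- s) (s / 2)) ?(away (- (s / 2)) (s / 2));
      rewrite ?add0r ?addr0 //; try (by rewrite /in_range; clear -s0 sr L L0; split; lra);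
      try (by left; right); by right; left.
  - rewrite (away 0 (- s)) ?(away (s / 2) (- s)) ?(away (s / 2) (- (s / 2)));
      rewrite ?add0r ?addr0 //; try (by rewrite /in_range; clear -s0 sr L L0; split; lra);
      try (by left; left); by right; right.
  - rewrite (away (s / 2) 0) ?(away 0 (s / 2)) ?(away (s / 2) (s / 2));
      rewrite ?add0r ?addr0 //; try (by rewrite /in_range; clear -s0 sr L L0; split; lra);
      try (by left; left); by right; left.
have zero (i j : bool) : circulation (- (i%:R * rho)) (- (j%:R * rho)) rho = 0.
  pose c s := circulation (- (i%:R * s)) (- (j%:R * s)) s.
  have cn n : c rho = c (rho / 2 ^+ n).
    elim: n => [|n ->]; first by rewrite expr0 divr1.
    rewrite exprSr invfM mulrA; apply: half; first by rewrite divr_gt0 // exprn_gt0.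
    by rewrite ler_pdivrMr ?exprn_gt0 // ler_peMr ?(ltW r0) // exprn_ege1 // ler1n.
  have cb s : 0 < s -> s <= r1 -> `|c s| <= 4 * M * s.
    move=> s0 sr; have sr' := le_trans sr r1r.
    have [x [y [/andP[x1 x2] /andP[y1 y2] E]]] : exists x y,
      [/\ (- (i%:R * s)) <= x <= (- (i%:R * s)) + s, (- (j%:R * s)) <= y <= (- (j%:R * s)) + s &
       c s = (P x (- (j%:R * s)) - P x ((- (j%:R * s)) + s) + Q ((- (i%:R * s)) + s) y
              - Q (- (i%:R * s)) y) * s].
      apply: circulation_mvt; first exact: ltW.
      by case: (i) (j) => [] []; split; rewrite /=; lra.
    rewrite E normrM (gtr0_norm s0) ler_pM2r //.
    clear sr'.
    have xr : `|x| <= r1 by rewrite ler_norml; move: x1 x2; case: (i) => /=; lra.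
    have yr : `|y| <= r1 by rewrite ler_norml; move: y1 y2; case: (j) => /=; lra.
    have ar : `|- (i%:R * s)| <= r1 by rewrite ler_norml; case: (i) => /=; lra.
    have br : `|- (j%:R * s)| <= r1 by rewrite ler_norml; case: (j) => /=; lra.
    have ar' : `|- (i%:R * s) + s| <= r1 by rewrite ler_norml; case: (i) => /=; lra.
    have br' : `|- (j%:R * s) + s| <= r1 by rewrite ler_norml; case: (j) => /=; lra.
    have [+ _] := bd _ _ xr br; have [+ _] := bd _ _ xr br'.
    have [_ +] := bd _ _ ar yr; have [_ +] := bd _ _ ar' yr.
    by rewrite !ler_norml; lra.
  rewrite -/(c rho); apply/eqP; rewrite -normr_eq0; apply/eqP/le_anti.
  rewrite normr_ge0 andbT; apply/ler_addgt0Pr => e e0; rewrite add0r.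
  have M1 : 0 < 4 * M + 1 by lra.
  have dp : 0 < Num.min r1 (e / (4 * M + 1)) by rewrite lt_min r10 divr_gt0.
  have [n] := half_pow_small (ltW r0) dp; rewrite le_min => /andP[n1 n2].
  have sn : 0 < rho / 2 ^+ n by rewrite divr_gt0 // exprn_gt0.
  rewrite (cn n); apply: (le_trans (cb _ sn n1)).
  by move: n2; rewrite ler_pdivlMr //; lra.
rewrite circulation_quarters.
have -> : 2 * rho / 2 = rho by field.
have := zero true true; have := zero true false; have := zero false true; have := zero false false.
by rewrite /= !mul1r !mul0r !oppr0 addNr => -> -> -> ->; rewrite !addr0.
Qed.

End Goursat.

(** * Liouville's theorem *)

Section ComplexModulus.
Variable R : realType.
Local Notation C := (Cx R).
Implicit Types z w : C.

Definition cRe z : R := complex.Re z.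
Definition cIm z : R := complex.Im z.
(** The norm of a complex number is itself a complex number; estimates are made with this real value
    of it. *)
Definition cmod z : R := complex.Re (`|z| : C).

Lemma cReB z w : cRe (z - w) = cRe z - cRe w.
Proof. by case: z w => [a b] [c d]. Qed.

Lemma cImB z w : cIm (z - w) = cIm z - cIm w.
Proof. by case: z w => [a b] [c d]. Qed.

Lemma normE z : `|z| = (cmod z)%:C%C :> C.
Proof. by rewrite /cmod; case: z => a b; rewrite normc_def. Qed.

Lemma cmodE z : cmod z = Num.sqrt (cRe z ^+ 2 + cIm z ^+ 2).
Proof. by rewrite /cmod; case: z => a b; rewrite normc_def. Qed.

Lemma cmod_ge0 z : 0 <= cmod z. Proof. by rewrite cmodE sqrtr_ge0. Qed.

Lemma cmodM z w : cmod (z * w) = cmod z * cmod w.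
Proof. by have := normrM z w; rewrite !normE -rmorphM => /complexI. Qed.

Lemma cmodD z w : cmod (z + w) <= cmod z + cmod w.
Proof. by have := ler_normD z w; rewrite !normE -rmorphD lecR. Qed.

Lemma cmodN z : cmod (- z) = cmod z.
Proof. by rewrite /cmod normrN. Qed.

Lemma cmod0 : cmod 0 = 0. Proof. by rewrite /cmod normr0. Qed.

Lemma cmod_eq0 z : (cmod z == 0) = (z == 0).
Proof.
rewrite -[in RHS](@normr_eq0 _ C) normE.
by apply/eqP/eqP => [->//|/complexI].
Qed.

Lemma cmod_gt0 z : (0 < cmod z) = (z != 0).
Proof. by rewrite lt_neqAle cmod_ge0 andbT eq_sym cmod_eq0. Qed.

Lemma cmodV z : cmod z^-1 = (cmod z)^-1.
Proof.
by have := normfV z; rewrite !normE -(fmorphV (real_complex R)) => /complexI.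
Qed.

Lemma Re_le_cmod z : `|cRe z| <= cmod z.
Proof. by rewrite cmodE -sqrtr_sqr ler_wsqrtr // lerDl sqr_ge0. Qed.

Lemma Im_le_cmod z : `|cIm z| <= cmod z.
Proof. by rewrite cmodE -sqrtr_sqr ler_wsqrtr // lerDr sqr_ge0. Qed.

Lemma cmod_le z : cmod z <= `|cRe z| + `|cIm z|.
Proof.
rewrite cmodE; set a := cRe z; set b := cIm z.
have -> : `|a| + `|b| = Num.sqrt ((`|a| + `|b|) ^+ 2).
  by rewrite sqrtr_sqr [RHS]ger0_norm // addr_ge0.
apply: ler_wsqrtr; rewrite sqrrD !real_normK ?num_real // lerD2r lerDl.
by rewrite mulrn_wge0 // mulr_ge0.
Qed.

End ComplexModulus.

Section Liouville.
Variable R : realType.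
Local Notation C := (Cx R).
Local Notation pt x y := ((x +i* y)%C : C).

Lemma ltcR (a b : R) : (a%:C%C < b%:C%C :> R[i]) = (a < b).
Proof. by rewrite ltcE /= eqxx. Qed.

Lemma differentiable_cmod (f : C -> C) (z : C) : differentiable f z ->
  exists d : C, forall e : R, 0 < e -> exists2 dl : R, 0 < dl &
    forall h : C, cmod h <= dl -> cmod (f (z + h) - f z - d * h) <= e * cmod h.
Proof.
move=> df; exists ('d f z (1 : C)) => e e0.
have /eqaddoP H0 := diff_locally df; move: (H0 (e%:C)%C); clear H0.
rewrite ltcR => /(_ e0) /nbhs_ballP [dl /= dl0].
have [d0 dE] : 0 < complex.Re dl /\ dl = (complex.Re dl)%:C%C.
  by split; [move: dl0; rewrite ltcE => /andP[] | rewrite RRe_real // gtr0_real].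
move=> H; exists (complex.Re dl / 2); first by rewrite divr_gt0.
move=> h hd; have {}H : `|f (z + h) - (f z + 'd f z h)| <= e%:C%C * `|h|.
  rewrite (addrC z) -[f (h + z)]/((f \o shift z) h).
  apply: (H h); rewrite -ball_normE /= sub0r normrN normE dE ltcR.
  by apply: (le_lt_trans hd); rewrite ltr_pdivrMr // ltr_pMr // ltr1n.
move: H; rewrite !normE -rmorphM lecR.
have -> : 'd f z h = 'd f z 1 * h.
  have : 'd f z (h *: (1 : C)) = h *: 'd f z (1 : C) by rewrite linearZ.
  by rewrite -[h *: (1 : C)]/(h * 1) mulr1 => ->; rewrite mulrC.
by rewrite opprD addrA.
Qed.

(* The imaginary part of [G dz] is the real form [Im G dx + Re G dy]. *)
Section Contour.
Variable G : C -> C.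
Let P (x y : R) : R := cIm (G (pt x y)).
Let Q (x y : R) : R := cRe (G (pt x y)).

Lemma pt_shift (x y x' y' : R) : pt x' y' = pt x y + pt (x' - x) (y' - y).
Proof. by rewrite -[RHS]/(pt (x + (x' - x)) (y + (y' - y))) !(addrC _ (_ - _)) !subrK. Qed.

(** Cauchy-Riemann: [d (dx + i dy)] has imaginary part [Im d dx + Re d dy] and real part
    [Re d dx - Im d dy]. The shared coefficient [Re d] expresses closedness. *)
Lemma closed_at_cmod (x y : R) (d : C) :
  (forall e : R, 0 < e -> exists2 dl : R, 0 < dl &
    forall h : C, cmod h <= dl ->
      cmod (G (pt x y + h) - G (pt x y) - d * h) <= e * cmod h) ->
  closed_at P Q x y.
Proof.
move=> H; exists (cIm d), (cRe d), (- cIm d) => e e0.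
have e2 : 0 < e / 2 by rewrite divr_gt0.
have [dl dl0 hd] := H _ e2; exists (dl / 2); first by rewrite divr_gt0.
move=> r x' y' rd xr yr.
have hr : cmod (pt (x' - x) (y' - y)) <= 2 * r.
  by apply: (le_trans (cmod_le _)); rewrite /cRe /cIm /=; lra.
have := hd (pt (x' - x) (y' - y)) ltac:(lra).
rewrite -pt_shift; set z := (X in cmod X) => hz.
have {}hz : cmod z <= e * r.
  by apply: (le_trans hz); rewrite -mulrA ler_pM2l //; lra.
have := le_trans (Im_le_cmod z) hz; have := le_trans (Re_le_cmod z) hz.
rewrite /P /Q /z; case: (d) (G _) (G _) => [p q] [a b] [a' b'].
rewrite /cIm /cRe /= => h1 h2; split.
  by move: h2; congr (`|_| <= _); ring.
by move: h1; congr (`|_| <= _); ring.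
Qed.

Lemma continuous_lines :
  (forall z (e : R), 0 < e -> exists2 dl : R, 0 < dl &
     forall h, cmod h <= dl -> cmod (G (z + h) - G z) <= e) ->
  (forall y, continuous (fun x => P x y)) /\ (forall x, continuous (Q x)).
Proof.
move=> H; split=> [y x|x y]; apply/cvgrPdist_le => e e0;
  have [dl dl0 hd] := H (pt x y) e e0; apply/nbhs_ballP; exists dl => //= t;
  rewrite /ball /= => ht.
  rewrite distrC -cImB; apply: (le_trans (Im_le_cmod _)).
  rewrite (pt_shift x y t y) subrr; apply: hd; apply: (le_trans (cmod_le _)).
  by rewrite /cRe /cIm /= normr0 addr0 distrC ltW.
rewrite distrC -cReB; apply: (le_trans (Re_le_cmod _)).
rewrite (pt_shift x y x t) subrr; apply: hd; apply: (le_trans (cmod_le _)).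
by rewrite /cRe /cIm /= normr0 add0r distrC ltW.
Qed.

(* For [G] close to [1/z] on the boundary of a large square, the form is
   positive along that boundary, so its integral there cannot vanish. *)
Lemma no_simple_pole_at_infinity :
  (forall z, z != 0 -> exists d : C, forall e : R, 0 < e -> exists2 dl : R, 0 < dl &
     forall h : C, cmod h <= dl -> cmod (G (z + h) - G z - d * h) <= e * cmod h) ->
  (forall z (e : R), 0 < e -> exists2 dl : R, 0 < dl &
     forall h, cmod h <= dl -> cmod (G (z + h) - G z) <= e) ->
  ~ (exists M : R, forall z, M <= cmod z -> cmod (z * G z - 1) < 4^-1).
Proof.
move=> Gd Gc [M hM].
have [cP cQ] := continuous_lines Gc.
pose rho := `|M| + 1.
have r0 : 0 < rho by rewrite ltr_wpDl.
have [IP IPP] := choice (fun y => continuous_primitive rho (cP y)).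
have [IQ IQP] := choice (fun x => continuous_primitive rho (cQ x)).
have hP x y : `|x| <= rho -> `|y| <= rho ->
    is_derive x (1 : R) (fun t => (fun x y => IP y x) t y) (P x y).
  by move=> hx hy; exact: IPP.
have hQ x y : `|x| <= rho -> `|y| <= rho -> is_derive y (1 : R) (IQ x) (Q x y).
  by move=> hx hy; exact: IQP.
have [d0 d00 hd0] := Gc 0 1 ltr01.
pose r1 := Num.min rho (d0 / 2).
have r10 : 0 < r1 <= rho by rewrite lt_min r0 divr_gt0 //= ge_min lexx.
have C0 : circulation (fun x y => IP y x) IQ (- rho) (- rho) (2 * rho) = 0.
  apply: (@goursat_puncture R P Q _ _ rho hP hQ (cmod (G 0) + 1) r1 r10).
    move=> x y xy0; have z0 : pt x y != 0.
      by apply: contraTneq xy0 => -[-> ->]; rewrite eqxx.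
    by have [d hd] := Gd _ z0; exact: (closed_at_cmod hd).
  move=> x y; rewrite !le_min => /andP[_ hx] /andP[_ hy].
  have hz : cmod (pt x y) <= d0.
    by apply: (le_trans (cmod_le _)); rewrite /cRe /cIm /=; lra.
  have hG : cmod (G (pt x y)) <= cmod (G 0) + 1.
    have := hd0 _ hz; rewrite add0r => h.
    rewrite -[G (pt x y)](subrK (G 0)); apply: (le_trans (cmodD _ _)).
    by rewrite addrC lerD2l.
  by split; apply: le_trans hG; [exact: Im_le_cmod | exact: Re_le_cmod].
have rg : in_range rho (- rho) (- rho) (2 * rho) by split; lra.
have rr0 : 0 <= 2 * rho by lra.
have [x [y [/andP[x1 x2] /andP[y1 y2] E]]] := circulation_mvt hP hQ rr0 rg.
(* With [w = z G(z)], within 1/4 of 1 at these points, [G] is [w] times the conjugate of [z] divided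
   by [|z|^2]. On each side of the square the coordinate of absolute value [rho] dominates and fixes
   the sign of the relevant component. *)
have key (s t : R) : rho <= `|s| \/ rho <= `|t| -> exists wr wi : R,
    [/\ `|wr - 1| < 4^-1, `|wi| < 4^-1, s * wr + t * wi = Q s t * (s ^+ 2 + t ^+ 2),
       s * wi - t * wr = P s t * (s ^+ 2 + t ^+ 2) & 0 < s ^+ 2 + t ^+ 2].
  move=> st; exists (cRe (pt s t * G (pt s t))), (cIm (pt s t * G (pt s t))).
  have hz : rho <= cmod (pt s t).
    by case: st => h; apply: (le_trans h); [exact: (Re_le_cmod (pt s t)) | exact: (Im_le_cmod (pt s t))].
  have hw : cmod (pt s t * G (pt s t) - 1) < 4^-1.
    by apply: hM; apply: le_trans hz; rewrite /rho (le_trans (ler_norm M)) // lerDl.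
  split.
  - apply: le_lt_trans hw; apply: le_trans (Re_le_cmod _).
    by rewrite cReB.
  - apply: le_lt_trans hw; apply: le_trans (Im_le_cmod _).
    by rewrite cImB subr0.
  - by rewrite /Q; case: (G _) => a b; rewrite /cRe /cIm /=; ring.
  - by rewrite /P; case: (G _) => a b; rewrite /cRe /cIm /=; ring.
  - rewrite lt_neqAle addr_ge0 ?sqr_ge0 // andbT eq_sym paddr_eq0 ?sqr_ge0 // !sqrf_eq0.
    apply/negP => /andP[/eqP s0 /eqP t0]; move: st; rewrite s0 t0 normr0.
    by case; lra.
have small (s wi : R) : `|s| <= rho -> `|wi| < 4^-1 -> `|s * wi| <= rho / 4.
  by move=> hs hw; rewrite normrM; apply: ler_pM => //; exact: ltW.
have bx : `|x| <= rho by rewrite ler_norml; lra.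
have by_ : `|y| <= rho by rewrite ler_norml; lra.
have E2 : - rho + 2 * rho = rho by ring.
have nr : `|rho| = rho by rewrite ger0_norm // ltW.
have nr' : `|- rho| = rho by rewrite normrN.
have A1 : 0 < P x (- rho).
  have [|wr [wi [w1 w2 _ EP p]]] := key x (- rho); first by right; rewrite nr'.
  rewrite -(pmulr_lgt0 _ p) -EP.
  by have := small _ _ bx w2; move: w1; rewrite !ler_norml ltr_norml; nra.
have A2 : P x rho < 0.
  have [|wr [wi [w1 w2 _ EP p]]] := key x rho; first by right; rewrite nr.
  rewrite -(pmulr_llt0 _ p) -EP.
  by have := small _ _ bx w2; move: w1; rewrite !ler_norml ltr_norml; nra.
have A3 : 0 < Q rho y.
  have [|wr [wi [w1 w2 EQ _ p]]] := key rho y; first by left; rewrite nr.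
  rewrite -(pmulr_lgt0 _ p) -EQ.
  by have := small _ _ by_ w2; move: w1; rewrite !ler_norml ltr_norml; nra.
have A4 : Q (- rho) y < 0.
  have [|wr [wi [w1 w2 EQ _ p]]] := key (- rho) y; first by left; rewrite nr'.
  rewrite -(pmulr_llt0 _ p) -EQ.
  by have := small _ _ by_ w2; move: w1; rewrite !ler_norml ltr_norml; nra.
move: E; rewrite C0 !E2 => /esym/eqP; rewrite mulf_eq0 => /orP[] /eqP; lra.
Qed.
End Contour.

Lemma liouville_origin (f : C -> C) (L : C) :
  (forall z, differentiable f z) ->
  (forall e : R, 0 < e -> exists M : R, forall z, M <= cmod z -> cmod (f z - L) < e) ->
  f 0 = L.
Proof.
move=> df fL; apply/eqP; apply: contrapT => /negP fne.
pose w := L - f 0.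
have w0 : w != 0 by rewrite subr_eq0 eq_sym.
have cw : 0 < cmod w by rewrite cmod_gt0.
have [d0 hd0] := differentiable_cmod (df 0).
pose g (z : C) : C := (f z - f 0) * z^-1 * w^-1.
(* The value at 0 is the derivative of the numerator there divided by [w], which makes [G]
   continuous; differentiability is claimed only off 0. *)
pose G (z : C) : C := if z == 0 then d0 / w else g z.
have Gd z : z != 0 -> exists d : C, forall e : R, 0 < e -> exists2 dl : R, 0 < dl &
     forall h : C, cmod h <= dl -> cmod (G (z + h) - G z - d * h) <= e * cmod h.
  move=> z0; have dg : differentiable g z.
    apply: differentiableM; last exact: differentiable_cst.
    apply: differentiableM; last exact: differentiable_Rinv.
    by apply: differentiableB; [exact: df | exact: differentiable_cst].
  have [d hd] := differentiable_cmod dg; exists d => e e0.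
  have [dl dl0 hdl] := hd e e0.
  have cz : 0 < cmod z / 2 by rewrite divr_gt0 // cmod_gt0.
  exists (Num.min dl (cmod z / 2)); first by rewrite lt_min dl0.
  move=> h; rewrite le_min => /andP[h1 h2]; rewrite /G (negPf z0).
  rewrite ifN; first exact: hdl.
  apply/negP => /eqP zh; move: h2; rewrite (_ : h = - z) ?cmodN; last first.
    by apply/eqP; rewrite -addr_eq0 addrC zh.
  by move: cz; clear; lra.
apply: (@no_simple_pole_at_infinity G) => //.
- move=> z e e0; have [->|z0] := eqVneq z 0.
    have [dl dl0 hdl] := hd0 (e * cmod w) (mulr_gt0 e0 cw).
    exists dl => // h hh; rewrite add0r /G eqxx.
    have [_|h0] := eqVneq h 0; first by rewrite subrr cmod0 ltW.
    have := hdl _ hh; rewrite add0r => H.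
    have -> : g h - d0 / w = (f h - f 0 - d0 * h) / (h * w).
      by rewrite /g; field; rewrite h0 w0.
    by rewrite cmodM cmodV cmodM ler_pdivrMr ?mulr_gt0 ?cmod_gt0 //; move: H; lra.
  have [d hd] := Gd z z0; have [dl dl0 hdl] := hd 1 ltr01.
  have d1 : 0 < cmod d + 1 by rewrite ltr_wpDl ?cmod_ge0.
  exists (Num.min dl (e / (cmod d + 1))); first by rewrite lt_min dl0 divr_gt0.
  move=> h; rewrite le_min => /andP[h1 h2].
  rewrite -[G _ - _](subrK (d * h)); apply: (le_trans (cmodD _ _)).
  have := hdl _ h1; rewrite cmodM; move: h2; rewrite ler_pdivlMr //; lra.
- have [M hM] := fL (4^-1 * cmod w) ltac:(by rewrite mulr_gt0 // invr_gt0).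
  exists (Num.max M 1) => z; rewrite ge_max => /andP[Mz z1].
  have z0 : z != 0 by rewrite -cmod_gt0; apply: lt_le_trans z1.
  have -> : z * G z - 1 = (f z - L) / w.
    by rewrite /G (negPf z0) /g /w; field; rewrite z0 -/w w0.
  by rewrite cmodM cmodV ltr_pdivrMr //; exact: hM.
Qed.

Theorem liouville_at_infinity (f : C -> C) (L : C) :
  (forall z, differentiable f z) ->
  (forall e : R, 0 < e -> exists M : R, forall z, M <= cmod z -> cmod (f z - L) < e) ->
  forall z, f z = L.
Proof.
move=> df fL z0; pose f' (z : C) := f (z + z0).
suff : f' 0 = L by rewrite /f' add0r.
apply: liouville_origin => [z|e e0].
  apply: (@differentiable_comp _ _ _ _ (fun z => z + z0) f); last exact: df.
  by apply: differentiableD; [exact: ex_diff | exact: differentiable_cst].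
have [M hM] := fL e e0; exists (M + cmod z0) => z hz; apply: hM.
have := cmodD (z + z0) (- z0); rewrite addrK cmodN => h.
by rewrite -(lerD2r (cmod z0)) (le_trans hz).
Qed.
End Liouville.

(** * Determinants of endomorphisms of matrix spaces *)

Section RankTriangular.
Variable K : comNzRingType.

(* A permutation that contributes to the determinant cannot decrease ranks, and
   the sum of the ranks is invariant, so it is the identity. *)
Lemma det_rank_triangular n (M : 'M[K]_n) (rk : 'I_n -> nat) :
  (forall x y, M x y != 0 -> x = y \/ (rk x < rk y)%N) ->
  \det M = \prod_x M x x.
Proof.
move=> Mtri; rewrite /determinant (bigD1 1%g) //= odd_perm1 expr0 mul1r.
rewrite [X in _ + X]big1 ?addr0 => [|s s1].
  by apply: eq_bigr => i _; rewrite perm1.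
have [i Mi0|nz] := pickP (fun i => M i (s i) == 0).
  by rewrite (bigD1 i) //= (eqP Mi0) mul0r mulr0.
case/negP: s1; apply/eqP/permP => i; rewrite perm1; apply/eqP.
apply: contraT => si; have : (\sum_j rk j < \sum_j rk (s j))%N.
  have le j : (rk j <= rk (s j))%N.
    by have [<-//|/ltnW] := Mtri j (s j) (negbT (nz j)).
  rewrite (bigD1 i) //= [ltnRHS](bigD1 i) //= -addSn leq_add //.
    by have [E|//] := Mtri i (s i) (negbT (nz i)); rewrite -E eqxx in si.
  by apply: leq_sum => j _.
by rewrite (reindex_inj (@perm_inj _ s)) ltnn.
Qed.

Lemma row_permVK n m (s : 'S_n) (M : 'M[K]_(n, m)) : row_perm s^-1%g (row_perm s M) = M.
Proof. by rewrite -row_permM mulVg row_perm1. Qed.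

Lemma det_rank_triangular_perm n (M : 'M[K]_n) (rk : 'I_n -> nat) (s : 'S_n) :
  (forall x y, M x y != 0 -> x = s y \/ (rk x < rk (s y))%N) ->
  \det M = (-1) ^+ s * \prod_y M (s y) y.
Proof.
move=> Mtri; rewrite -[in LHS](row_permVK s M) row_permE det_mulmx det_perm odd_permV.
congr (_ * _); rewrite (@det_rank_triangular _ _ (rk \o s)).
  by apply: eq_bigr => y _; rewrite mxE.
move=> x y; rewrite mxE => /Mtri [/perm_inj|]; [by left | by right].
Qed.

Lemma lin_mxE m1 n1 m2 n2 (f : {linear 'M[K]_(m1, n1) -> 'M[K]_(m2, n2)}) i j i' j' :
  lin_mx f (mxvec_index i j) (mxvec_index i' j') = f (delta_mx i j) i' j'.
Proof. by rewrite mxE /= vec_mx_delta mxvecE. Qed.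

(** The sign comes from numbering the matrix entries and is never computed. It is quantified before
    [f], hence common to all maps with the same pivots: it can be found from one example or absorbed
    in a constant. *)
Lemma det_lin_mx_triangular m n (s : {perm 'I_m * 'I_n}) :
  exists eps : bool, forall (f : {linear 'M[K]_(m, n) -> 'M[K]_(m, n)})
    (rk : 'I_m * 'I_n -> nat),
  (forall p q, f (delta_mx p.1 p.2) q.1 q.2 != 0 -> p = s q \/ (rk p < rk (s q))%N) ->
  \det (lin_mx f) = (-1) ^+ eps * \prod_q f (delta_mx (s q).1 (s q).2) q.1 q.2.
Proof.
pose ix (p : 'I_m * 'I_n) := mxvec_index p.1 p.2.
have [xi ixK xiK] : exists2 xi, cancel ix xi & cancel xi ix.
  have [xi xiK ixK] := curry_mxvec_bij m n.
  exists xi => [[i j]|k]; first by rewrite -[RHS](xiK (i, j)) ?inE.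
  by rewrite -[RHS]ixK ?inE //; case: (xi k).
have t_inj : injective (fun x => ix (s (xi x))).
  by move=> x y /(can_inj ixK) /perm_inj /(can_inj xiK).
exists (perm t_inj) => f rk tri.
rewrite (@det_rank_triangular_perm _ _ (rk \o xi) (perm t_inj)).
  congr (_ * _); rewrite (reindex ix) /=; last by exists xi => ? _.
  by apply: eq_bigr => q _; rewrite permE ixK lin_mxE.
move=> x y; rewrite permE -(xiK x) -(xiK y) !ixK lin_mxE => /tri[<-|]; first by left.
by rewrite /= !ixK; right.
Qed.

Lemma det_lin_mx_comp m n (f g h : {linear 'M[K]_(m, n) -> 'M[K]_(m, n)}) :
  (forall E, h E = g (f E)) -> \det (lin_mx h) = \det (lin_mx g) * \det (lin_mx f).
Proof.
move=> hE; rewrite mulrC -det_mulmx; congr (\det _); apply/row_matrixP => i.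
by rewrite !rowE mulmxA !mul_rV_lin mxvecK hE.
Qed.

End RankTriangular.

(** * The determinant of two-sided multiplication of matrices *)

Section Kronecker.
Variable K : numClosedFieldType.

Lemma det_lin_mx_conj m n (a f g h : {linear 'M[K]_(m, n) -> 'M[K]_(m, n)}) :
  (forall E, h (g E) = E) -> (forall E, a E = h (f (g E))) ->
  \det (lin_mx a) = \det (lin_mx f).
Proof.
move=> ghK aE.
have comp : lin_mx a = lin_mx g *m lin_mx f *m lin_mx h.
  apply/row_matrixP => i; rewrite !rowE !mulmxA.
  by rewrite !mul_rV_lin !mxvecK aE.
have gh : lin_mx g *m lin_mx h = 1%:M.
  apply/row_matrixP => i; rewrite !rowE mulmx1 !mulmxA.
  by rewrite !mul_rV_lin mxvecK ghK vec_mxK.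
rewrite comp !det_mulmx mulrAC -det_mulmx gh det1 mul1r //.
Qed.

Lemma similar_trig_ex n (A : 'M[K]_n) : exists P : 'M[K]_n,
  P \in unitmx /\ is_trig_mx (P *m A *m invmx P).
Proof.
case: n A => [|n] A; first by exists 1%:M; rewrite unitmx1; split=> //; apply/is_trig_mxP => -[].
have [P Pu] := Schur A (ltn0Sn n); exists P; split; first exact: unitarymx_unit.
by rewrite -conjumx ?unitarymx_unit.
Qed.

(** Schur triangulation of [L] and [T] conjugates the operator on matrices. For triangular factors
    the operator is triangular too, with diagonal entries [L_ii T_jj]. *)
Lemma det_lin_mx_mul m n (L : 'M[K]_m) (T : 'M[K]_n) :
  \det (lin_mx (fun E : 'M[K]_(m, n) => L *m E *m T)) = \det L ^+ n * \det T ^+ m.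
Proof.
have lin (A : 'M[K]_m) (B : 'M[K]_n) : linear (fun E : 'M[K]_(m, n) => A *m E *m B).
  by move=> a u v; rewrite mulmxDr mulmxDl -scalemxAr -scalemxAl.
pose f A B : {linear 'M[K]_(m, n) -> 'M[K]_(m, n)} :=
  HB.pack (fun E : 'M[K]_(m, n) => A *m E *m B) (GRing.isLinear.Build _ _ _ _ _ (lin A B)).
have [P [Pu Pt]] := similar_trig_ex L; have [Q [Qu Qt]] := similar_trig_ex T.
set L' := P *m L *m _ in Pt; set T' := Q *m T *m _ in Qt.
have LE : L = invmx P *m L' *m P by rewrite /L' !mulmxA mulVmx // mul1mx mulmxKV.
have TE : T = invmx Q *m T' *m Q by rewrite /T' !mulmxA mulVmx // mul1mx mulmxKV.
have dL : \det L = \det L'.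
  by rewrite /L' !det_mulmx mulrAC -det_mulmx mulmxV // det1 mul1r.
have dT : \det T = \det T'.
  by rewrite /T' !det_mulmx mulrAC -det_mulmx mulmxV // det1 mul1r.
rewrite dL dT; transitivity (\det (lin_mx (f L' T'))).
  apply: (@det_lin_mx_conj _ _ (f L T) (f L' T') (f P (invmx Q)) (f (invmx P) Q)) => E /=.
    by rewrite !mulmxA mulVmx // mul1mx mulmxKV.
  by rewrite [in LHS]LE [in LHS]TE !mulmxA.
have [eps H] := det_lin_mx_triangular K (1%g : {perm 'I_m * 'I_n}).
have entry A B p q : f A B (delta_mx p.1 p.2) q.1 q.2 = A q.1 p.1 * B p.2 q.2.
  rewrite /= -(mul_delta_mx (0 : 'I_1)) !mulmxA -colE -mulmxA -rowE.
  by rewrite mxE big_ord1 !mxE.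
have dets A B : is_trig_mx A -> is_trig_mx B ->
    \det (lin_mx (f A B)) = (-1) ^+ eps * (\det A ^+ n * \det B ^+ m).
  move=> /is_trig_mxP At /is_trig_mxP Bt.
  (* For lower triangular factors a nonzero coefficient from [p] to [q] forces [p.1 <= q.1] and
     [q.2 <= p.2], so this rank increases. *)
  rewrite (H _ (fun p => p.1 + (n - p.2))%N) => [|p q].
    congr (_ * _); under eq_bigr do rewrite entry perm1.
    rewrite big_split /= -(pair_bigA _ (fun i j => A i i)) -(pair_bigA _ (fun i j => B j j)) /=.
    rewrite exchange_big /= !prodr_const !card_ord.
    by rewrite !det_trig //; [apply/is_trig_mxP | apply/is_trig_mxP].
  rewrite entry perm1 mulf_eq0 negb_or => /andP[A0 B0].
  have le1 : (p.1 <= q.1)%N by rewrite leqNgt; apply: contra A0 => /At ->.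
  have le2 : (q.2 <= p.2)%N by rewrite leqNgt; apply: contra B0 => /Bt ->.
  case: p q le1 le2 {A0 B0} => [i j] [i' j'] /=.
  rewrite leq_eqVlt => /predU1P[/val_inj ->|lt1 le2]; last first.
    by right; rewrite -addSn leq_add // leq_sub2l.
  rewrite leq_eqVlt => /predU1P[/val_inj ->|lt2]; first by left.
  by right; rewrite ltn_add2l ltn_sub2l // (ltn_trans lt2).
rewrite dets //; suff -> : (-1) ^+ eps = 1 :> K by rewrite mul1r.
(* The identity map determines the common sign. *)
have /esym := dets 1%:M 1%:M (scalar_mx_is_trig _ _) (scalar_mx_is_trig _ _).
rewrite !det1 !expr1n !mulr1 => ->.
suff -> : lin_mx (f 1%:M 1%:M) = 1%:M by rewrite det1.
apply/row_matrixP => i; rewrite !rowE mulmx1.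
by rewrite mul_rV_lin /= mul1mx mulmx1 vec_mxK.
Qed.

End Kronecker.

(** * Charts of the Grassmannian *)

Section EnumSet.
Variables (n p : nat) (J : {set 'I_n}).
Hypothesis cJ : #|J| = p.

Definition eset (i : 'I_p) : 'I_n := enum_val (cast_ord (esym cJ) i).

Lemma eset_in i : eset i \in J. Proof. exact: enum_valP. Qed.

Lemma eset_inj : injective eset.
Proof. by move=> i j /enum_val_inj /cast_ord_inj. Qed.

Lemma esetP c : c \in J -> exists i, c = eset i.
Proof.
move=> cin; exists (cast_ord cJ (enum_rank_in cin c)).
by rewrite /eset cast_ordK enum_rankK_in.
Qed.

Lemma nth_enum_eset x0 (i : 'I_p) : nth x0 (enum J) i = eset i.
Proof. by rewrite /eset (enum_val_nth x0). Qed.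

Lemma index_eset i : index (eset i) (enum J) = i.
Proof.
by rewrite -(nth_enum_eset (eset i)) index_uniq ?enum_uniq // -cardE cJ.
Qed.

End EnumSet.

Section Charts.
Variables (R : realType) (n k : nat).
Local Notation C := (Cx R).
Local Notation m := (n - k)%N.

Lemma colsE p (J : {set 'I_n}) (cJ : #|J| = p) (A : 'M[C]_(k, n)) :
  cols p J A = colsub (eset cJ) A.
Proof.
apply/matrixP => i j; rewrite !mxE (nth_map (eset cJ j)) ?nth_enum_eset //.
by rewrite -cardE cJ.
Qed.

Lemma cols_mulmx p (J : {set 'I_n}) (M : 'M[C]_k) (A : 'M[C]_(k, n)) :
  cols p J (M *m A) = M *m cols p J A.
Proof.
apply/matrixP => i j; rewrite !mxE.
have [jJ|Jj] := ltnP j (size (enum J)).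
  have c0 : 'I_n by case: (enum J) jJ => [//|c ? _]; exact: c.
  rewrite (nth_map c0) // mxE; apply: eq_bigr => l _.
  by rewrite !mxE (nth_map c0).
rewrite nth_default ?size_map // big1 // => l _.
by rewrite !mxE nth_default ?size_map // mulr0.
Qed.

Lemma minor_mulmx (J : {set 'I_n}) (M : 'M[C]_k) (A : 'M[C]_(k, n)) :
  minor J (M *m A) = \det M * minor J A.
Proof. by rewrite /minor cols_mulmx det_mulmx. Qed.

Section Chart.
Variables (J : {set 'I_n}) (cJ : #|J| = k).

Lemma card_compl : #|~: J| = m.
Proof. by rewrite cardsCs finset.setCK cJ card_ord. Qed.

Let e := eset cJ.
Let e' := eset card_compl.

Variant eset_spec : 'I_n -> Prop :=
| ESetIn i : eset_spec (e i)
| ESetOut r : eset_spec (e' r).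

Lemma eset_case c : eset_spec c.
Proof.
have [cin|cout] := boolP (c \in J).
  by have [i ->] := esetP cJ cin; exact: ESetIn.
have [|r ->] := esetP card_compl (c := c); first by rewrite inE.
exact: ESetOut.
Qed.

Lemma eset_compl_notin r : (e' r \in J) = false.
Proof. by have := eset_in card_compl r; rewrite inE => /negPf. Qed.

Lemma eset_compl_neq i r : (e i == e' r) = false.
Proof. by apply/negP => /eqP E; have := eset_compl_notin r; rewrite -E eset_in. Qed.

Lemma chartE_in (B : 'M[C]_(m, k)) i j : chart J B i (e j) = (i == j)%:R.
Proof. by rewrite mxE eset_in index_eset eq_sym. Qed.

Lemma chartE_out (B : 'M[C]_(m, k)) i r : chart J B i (e' r) = B r i.
Proof.
rewrite mxE eset_compl_notin (index_eset card_compl) (nth_map r) ?size_enum_ord //.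
by rewrite nth_ord_enum.
Qed.

(** With selection matrices a chart is the affine map [B |-> selJ + B^T selJC], and extracting
    columns is right multiplication by a transpose; changes of charts become block matrix
    algebra. *)
Definition selJ : 'M[C]_(k, n) := \matrix_(i, c) (c == e i)%:R.
Definition selJC : 'M[C]_(m, n) := \matrix_(r, c) (c == e' r)%:R.

Lemma chart_sel B : chart J B = selJ + B^T *m selJC.
Proof.
apply/matrixP => i c; case: (eset_case c) => [j|r].
  rewrite chartE_in !mxE big1 ?addr0 => [|r _]; first by rewrite (inj_eq (@eset_inj _ _ _ cJ)) eq_sym.
  by rewrite !mxE eset_compl_neq mulr0.
rewrite chartE_out !mxE eq_sym eset_compl_neq add0r (bigD1 r) //= big1 ?addr0 => [|r' r'r].
  by rewrite !mxE eqxx mulr1.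
by rewrite !mxE (inj_eq (@eset_inj _ _ _ card_compl)) eq_sym (negPf r'r) mulr0.
Qed.

Lemma colsub_sel p (f : 'I_p -> 'I_n) (A : 'M[C]_(k, n)) :
  colsub f A = A *m (\matrix_(i < p, c < n) (c == f i)%:R : 'M[C]_(p, n))^T.
Proof.
apply/matrixP => i j; rewrite !mxE (bigD1 (f j)) //= big1 => [|c cj].
  by rewrite !mxE eqxx mulr1 addr0.
by rewrite !mxE (negPf cj) mulr0.
Qed.

Lemma cols_sel (A : 'M[C]_(k, n)) : cols k J A = A *m selJ^T.
Proof. by rewrite (colsE cJ) colsub_sel. Qed.

Lemma cols_selC (A : 'M[C]_(k, n)) : cols m (~: J) A = A *m selJC^T.
Proof. by rewrite (colsE card_compl) colsub_sel. Qed.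

Lemma cols_chart (B : 'M[C]_(m, k)) : cols k J (chart J B) = 1%:M.
Proof. by apply/matrixP => i j; rewrite (colsE cJ) mxE chartE_in mxE. Qed.

Lemma colsC_chart (B : 'M[C]_(m, k)) : cols m (~: J) (chart J B) = B^T.
Proof. by apply/matrixP => i j; rewrite (colsE card_compl) mxE chartE_out mxE. Qed.

Lemma minor_chart (B : 'M[C]_(m, k)) : minor J (chart J B) = 1.
Proof. by rewrite /minor cols_chart det1. Qed.

Lemma minor_unit (A : 'M[C]_(k, n)) : (minor J A != 0) = (cols k J A \in unitmx).
Proof. by rewrite unitmxE unitfE. Qed.

Lemma chart_coordK (A : 'M[C]_(k, n)) : minor J A != 0 ->
  A = cols k J A *m chart J (chart_coord J A).
Proof.
rewrite minor_unit => Mu; apply/matrixP => i c; case: (eset_case c) => [j|r].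
  transitivity ((cols k J A *m cols k J (chart J (chart_coord J A))) i j).
    by rewrite cols_chart mulmx1 (colsE cJ) mxE.
  by rewrite -cols_mulmx [in LHS](colsE cJ) mxE.
transitivity ((cols k J A *m cols m (~: J) (chart J (chart_coord J A))) i r).
  by rewrite colsC_chart /chart_coord trmxK mulKVmx // (colsE card_compl) mxE.
by rewrite -cols_mulmx [in LHS](colsE card_compl) mxE.
Qed.

Lemma chart_coord_mulmx (M : 'M[C]_k) (A : 'M[C]_(k, n)) : M \in unitmx -> minor J A != 0 ->
  chart_coord J (M *m A) = chart_coord J A.
Proof.
move=> Mu; rewrite minor_unit => Au.
rewrite /chart_coord !cols_mulmx; congr trmx.
have MAu : M *m cols k J A \in unitmx by rewrite unitmx_mul Mu.
by rewrite -[RHS](mulKmx MAu) -mulmxA (mulKVmx Au).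
Qed.

Lemma chart_coord_mul (A : 'M[C]_(k, n)) : minor J A != 0 ->
  cols k J A *m (chart_coord J A)^T = cols m (~: J) A.
Proof. by rewrite minor_unit => Mu; rewrite /chart_coord trmxK mulKVmx. Qed.

End Chart.

(** * Changes of charts *)

Section Transition.
Variables (J J' : {set 'I_n}) (cJ : #|J| = k) (cJ' : #|J'| = k).
Local Notation P := (selJ cJ).
Local Notation Q := (selJC cJ).
Local Notation P' := (selJ cJ').
Local Notation Q' := (selJC cJ').

(** The determinant of a permutation matrix, hence a sign; what matters is its independence of
    [B]. *)
Definition trans_const : C := \det (col_mx P Q *m (col_mx P' Q')^T).

(** The Schur complement of the block [cols k J' A], where [A = chart J B], in the matrix with rows
    [A] and [Q] and the columns of [J'] placed first. It is also the right factor in the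
    differential of the change of charts. *)
Definition trans_row (B : 'M[C]_(m, k)) : 'M[C]_m :=
  Q *m Q'^T - Q *m P'^T *m (chart_coord J' (chart J B))^T.

(** The matrix with rows [A] and [Q] is a unipotent matrix times a permutation; on the other hand
    its determinant is that of a block times that of the Schur complement. *)
Lemma det_trans_row B : minor J' (chart J B) != 0 ->
  minor J' (chart J B) * \det (trans_row B) = trans_const.
Proof.
move=> mB; set A := chart J B; set M := cols k J' A; set Ct := (chart_coord J' A)^T.
have MC : M *m Ct = A *m Q'^T by rewrite chart_coord_mul // cols_selC.
have E1 : col_mx A Q = block_mx 1%:M B^T 0 1%:M *m col_mx P Q.
  by rewrite mul_block_col !mul1mx mul0mx add0r /A chart_sel.
have E2 : col_mx A Q *m (col_mx P' Q')^T =
   block_mx M 0 (Q *m P'^T) 1%:M *m block_mx 1%:M Ct 0 (trans_row B).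
  rewrite tr_col_mx mul_col_row mulmx_block !mulmx1 !mul1mx !mul0mx !addr0.
  by rewrite MC /trans_row -/A -/Ct addrC subrK /M (cols_sel cJ').
have := congr1 determinant E2; rewrite E1 -mulmxA !det_mulmx det_ublock !det1 !mul1r.
by rewrite /trans_const => ->; rewrite det_lblock det_ublock !det1 mulr1 mul1r.
Qed.

(** An exact identity without remainder: the new coordinates solve a linear system whose
    coefficients are affine in [B]. Letting [h] tend to 0 then gives the differential without
    differentiating an inverse matrix. *)
Lemma trans_diff (B E : 'M[C]_(m, k)) (h : C) :
  minor J' (chart J B) != 0 -> minor J' (chart J (B + h *: E)) != 0 ->
  cols k J' (chart J (B + h *: E)) *m
    (chart_coord J' (chart J (B + h *: E)) - chart_coord J' (chart J B))^T
  = h *: (E^T *m trans_row B).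
Proof.
move=> m0 m1.
have trB (X Y : 'M[C]_(m, k)) : (X - Y)^T = X^T - Y^T.
  by apply/matrixP => i j; rewrite !mxE.
rewrite trB mulmxBr.
rewrite [X in X - _](chart_coord_mul m1).
rewrite (cols_selC cJ').
set Ct := (chart_coord J' (chart J B))^T.
have AE : chart J (B + h *: E) = chart J B + h *: (E^T *m Q).
  by rewrite !chart_sel raddfD /= linearZ /= mulmxDl addrA scalemxAl.
rewrite AE (cols_sel cJ') !mulmxDl -(cols_sel cJ') (chart_coord_mul m0) (cols_selC cJ').
rewrite opprD addrACA subrr add0r -!scalemxAl -scalerBr; congr (_ *: _).
by rewrite /trans_row mulmxBr !mulmxA.
Qed.

End Transition.

End Charts.

(** * Jacobians of the transition maps *)

Section Differentiability.
Variables (K : numFieldType) (V : normedModType K).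

Lemma near_eq_differentiable (W : normedModType K) (f g : V -> W) (x : V) :
  (\forall y \near x, f y = g y) -> differentiable f x -> differentiable g x.
Proof.
move=> fg df; have fgx : f x = g x by apply: nbhs_singleton fg.
have Hg : g \o shift x = cst (g x) + 'd f x +o_ 0 id.
  have /eqaddoP H := diff_locally df; apply/eqaddoP => eps e0.
  have := H eps e0; move: fg; rewrite (near_shift 0) subr0 => fg.
  apply: filterS2 fg => h /= E; rewrite -[(_ - _) h]/(f (h + x) - (f x + 'd f x h)).
  by rewrite -[(g \o _ - _) h]/(g (h + x) - (g x + 'd f x h)) -fgx E.
have dg := diff_unique (diff_continuous df) Hg.
by apply/diff_locallyP; rewrite dg; split=> //; exact: diff_continuous.
Qed.

Lemma differentiable_bigsum (I : Type) (r : seq I) (P : pred I) (F : I -> V -> K) x :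
  (forall i, differentiable (F i) x) ->
  differentiable (fun v => \sum_(i <- r | P i) F i v) x.
Proof.
move=> dF; elim: r => [|i r IH].
  under eq_fun do rewrite big_nil.
  exact: (@differentiable_cst _ V K 0).
under eq_fun do rewrite big_cons.
by case: (P i) => //; apply: differentiableD.
Qed.

Lemma differentiable_bigprod (I : Type) (r : seq I) (P : pred I) (F : I -> V -> K) x :
  (forall i, differentiable (F i) x) ->
  differentiable (fun v => \prod_(i <- r | P i) F i v) x.
Proof.
move=> dF; elim: r => [|i r IH].
  under eq_fun do rewrite big_nil.
  exact: (@differentiable_cst _ V K 1).
under eq_fun do rewrite big_cons.
by case: (P i) => //; apply: differentiableM.
Qed.

Lemma differentiable_mx p q (F : V -> 'M[K]_(p, q)) x :
  (forall i j, differentiable (fun v => F v i j) x) -> differentiable F x.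
Proof.
move=> dF.
rewrite (_ : F = \sum_(i < p) \sum_(j < q) (fun v => F v i j *: delta_mx i j)).
  apply: differentiable_sum => i; apply: differentiable_sum => j.
  exact: differentiableZl.
apply/funext => v; rewrite fct_sumE [LHS]matrix_sum_delta; apply: eq_bigr => i _.
by rewrite fct_sumE.
Qed.

Lemma differentiable_entry p q (F : V -> 'M[K]_(p, q)) x i j :
  differentiable F x -> differentiable (fun v => F v i j) x.
Proof.
move=> dF; apply: (@differentiable_comp _ _ _ _ F (fun A : 'M[K]_(p, q) => A i j)) => //.
exact: differentiable_coord.
Qed.

Lemma differentiable_det p (F : V -> 'M[K]_p) x :
  (forall i j, differentiable (fun v => F v i j) x) ->
  differentiable (fun v => \det (F v)) x.
Proof.
move=> dF; apply: differentiable_bigsum => s.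
apply: differentiableM; first exact: differentiable_cst.
exact: differentiable_bigprod.
Qed.

Lemma near_neq0 (f : V -> K) x : {for x, continuous f} -> f x != 0 ->
  \forall y \near x, f y != 0.
Proof. by move=> cf fx; exact: cvgr_neq0 cf fx. Qed.

Lemma cvg_diff_quotient (W : normedModType K) (f : V -> W) (x v : V) :
  differentiable f x ->
  h^-1 *: (f (x + h *: v) - f x) @[h --> 0^'] --> 'd f x v.
Proof.
move=> df; have : derivable f x v by apply: diff_derivable.
rewrite -deriveE // /derivable /derive.
rewrite (_ : (fun h => h^-1 *: (f (x + h *: v) - f x)) =
  (fun h => h^-1 *: ((f \o shift x) (h *: v) - f x))) //.
by apply/funext => h; rewrite /= (addrC x).
Qed.

(* Differentiation of a relation [N h * f (x + h v) = ...] known only through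
   its exact difference quotient. *)
Lemma diff_quotient_mulmx p q r (f : V -> 'M[K]_(q, p)) (x v : V)
    (N : K -> 'M[K]_(r, p)) (T : 'M[K]_(r, q)) :
  differentiable f x ->
  (forall i l, {for 0, continuous (fun h => N h i l)}) ->
  (\forall h \near 0, N h *m (f (x + h *: v) - f x)^T = h *: T) ->
  N 0 *m ('d f x v)^T = T.
Proof.
move=> df cN NT; have cvD := cvg_diff_quotient (v := v) df.
apply/matrixP => i j.
have H1 : (\sum_l N h i l * (h^-1 *: (f (x + h *: v) - f x)) j l)
   @[h --> 0^'] --> (N 0 *m ('d f x v)^T) i j.
  rewrite mxE; under [X in _ --> X]eq_bigr do rewrite mxE.
  apply: cvg_big => [|l _]; first exact: add_continuous.
  apply: cvgM.
    by apply: cvg_trans (cN i l); apply: cvg_app; exact: cvg_within.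
  exact: (cvg_comp _ _ cvD (@coord_continuous K q p j l _)).
have H2 : \forall h \near 0^', T i j =
   \sum_l N h i l * (h^-1 *: (f (x + h *: v) - f x)) j l.
  near=> h.
  have h0 : h != 0 by near: h; exact: nbhs_dnbhs_neq.
  have : N h *m (f (x + h *: v) - f x)^T = h *: T by near: h; apply: cvg_within NT.
  move=> /(congr1 (fun X : 'M[K]_(r, q) => h^-1 *: X)).
  rewrite scalerA mulVf // scale1r => <-.
  by rewrite scalemxAr !mxE; apply: eq_bigr => l _; rewrite !mxE.
have H3 : (\sum_l N h i l * (h^-1 *: (f (x + h *: v) - f x)) j l) @[h --> 0^'] --> T i j.
  apply: (@cvg_trans _ (T i j @[h --> (0 : K)^'])); last exact: cvg_cst.
  by apply: near_eq_cvg; apply: filterS H2.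
exact: (cvg_unique (@norm_hausdorff K K) H1 H3).
Unshelve. all: by end_near. Qed.

End Differentiability.

Lemma det_diff_comp (K : numFieldType) m n (f g : 'M[K]_(m, n) -> 'M[K]_(m, n)) z :
  differentiable f z -> differentiable g (f z) ->
  \det (lin_mx ('d (g \o f) z)) = \det (lin_mx ('d g (f z))) * \det (lin_mx ('d f z)).
Proof.
move=> df dg; have E := diff_comp df dg.
apply: (@det_lin_mx_comp K m n ('d f z) ('d g (f z)) ('d (g \o f) z)) => X.
exact: (congr1 (fun h => h X) E).
Qed.

Section ChartDerivative.
Variables (R : realType) (n k : nat).
Local Notation C := (Cx R).
Local Notation m := (n - k)%N.

Lemma differentiable_cols (V : normedModType C) (F : V -> 'M[C]_(k, n)) x p (J : {set 'I_n}) i j :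
  differentiable F x -> differentiable (fun v => cols p J (F v) i j) x.
Proof.
move=> dF; under eq_fun do rewrite mxE.
have [jJ|Jj] := ltnP j (size (enum J)).
  have c0 : 'I_n by move: jJ; rewrite -cardE => jJ; exact: (enum_val (Ordinal jJ)).
  under eq_fun do rewrite (nth_map c0) //.
  exact: differentiable_entry.
rewrite (_ : (fun v => _) = cst 0); first exact: differentiable_cst.
by apply/funext => v; rewrite nth_default ?size_map.
Qed.

Lemma differentiable_minor (V : normedModType C) (F : V -> 'M[C]_(k, n)) x (J : {set 'I_n}) :
  differentiable F x -> differentiable (fun v => minor J (F v)) x.
Proof.
by move=> dF; apply: differentiable_det => i j; exact: differentiable_cols.
Qed.

Lemma differentiable_chart_coord (V : normedModType C) (F : V -> 'M[C]_(k, n)) x (J : {set 'I_n}) :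
  differentiable F x -> minor J (F x) != 0 ->
  differentiable (fun v => chart_coord J (F v)) x.
Proof.
move=> dF mx.
(* Near [x] the inverse is the adjugate over the determinant, so the entries are rational in those
   of [F v]. *)
pose G v : 'M[C]_(m, k) := \matrix_(r, i) \sum_l
  ((minor J (F v))^-1 * \adj (cols k J (F v)) i l) * cols m (~: J) (F v) l r.
apply: (@near_eq_differentiable _ _ _ G).
  have := differentiable_continuous (differentiable_minor J dF).
  move=> /near_neq0 /(_ mx); apply: filterS => v mv.
  rewrite /chart_coord /invmx -minor_unit mv.
  apply/matrixP => r i; rewrite [LHS]mxE [RHS]mxE [RHS]mxE.
  apply: eq_bigr => l _.
  by congr (_ * _); rewrite [RHS]mxE.
apply: differentiable_mx => r i; rewrite /G; under eq_fun do rewrite mxE.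
apply: differentiable_bigsum => l.
apply: differentiableM; last exact: differentiable_cols.
apply: differentiableM; first by apply: differentiableV => //; exact: differentiable_minor.
under eq_fun do rewrite mxE /cofactor.
apply: differentiableM; first exact: differentiable_cst.
apply: differentiable_det => a b; under eq_fun do rewrite 2!mxE.
exact: differentiable_cols.
Qed.

Lemma differentiable_chart (J : {set 'I_n}) (cJ : #|J| = k) (B : 'M[C]_(m, k)) :
  differentiable (chart J) B.
Proof.
rewrite (_ : chart J = fun B => selJ R cJ + B^T *m selJC R cJ); last first.
  by apply/funext => X; rewrite (chart_sel cJ).
apply: differentiable_mx => i c; under eq_fun do rewrite mxE [X in _ + X]mxE.
apply: differentiableD; first exact: differentiable_cst.
apply: differentiable_bigsum => l; under eq_fun do rewrite mxE.
apply: differentiableM; [exact: differentiable_coord | exact: differentiable_cst].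
Qed.

Section Transition.
Variables (J J' : {set 'I_n}) (cJ : #|J| = k) (cJ' : #|J'| = k).
Local Notation tau := (fun B : 'M[C]_(m, k) => chart_coord J' (chart J B)).

Lemma differentiable_transition B : minor J' (chart J B) != 0 -> differentiable tau B.
Proof.
by move=> mB; apply: differentiable_chart_coord => //; exact: differentiable_chart.
Qed.

Lemma diff_transition (B E : 'M[C]_(m, k)) : minor J' (chart J B) != 0 ->
  cols k J' (chart J B) *m ('d tau B E)^T = E^T *m trans_row cJ cJ' B.
Proof.
move=> mB; have dt := differentiable_transition mB.
pose line (h : C) := B + h *: E.
have dline : differentiable line 0.
  apply: differentiableD; first exact: differentiable_cst.
  by apply: differentiableZl; exact: ex_diff.
have lineE0 : line 0 = B by rewrite /line scale0r addr0.
have dA : differentiable (fun h => chart J (line h)) 0.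
  exact: (differentiable_comp dline (differentiable_chart cJ (line 0))).
pose N (h : C) := cols k J' (chart J (line h)).
have <- : N 0 = cols k J' (chart J B) by rewrite /N lineE0.
apply: (diff_quotient_mulmx (N := N) dt) => [i l|].
  by apply: differentiable_continuous; exact: differentiable_cols.
have nz : \forall h \near (0 : C), minor J' (chart J (line h)) != 0.
  apply: near_neq0; last by rewrite lineE0.
  by apply: differentiable_continuous; exact: differentiable_minor.
by apply: filterS nz => h mh; exact: (trans_diff cJ cJ' mB mh).
Qed.

(** The differential is [E |-> S^T E (M^-1)^T], of determinant [det S ^ k] times [det M ^ -(n - k)].
    As [det S] is a constant over [det M], the total exponent of [det M] is [-n]. *)
Lemma jac_transition (B : 'M[C]_(m, k)) : (k <= n)%N -> minor J' (chart J B) != 0 ->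
  jac tau B * minor J' (chart J B) ^+ n = trans_const R cJ cJ' ^+ k.
Proof.
move=> kn mB; set M := cols k J' (chart J B); set S := trans_row cJ cJ' B.
have Mu : M \in unitmx by rewrite -minor_unit.
have dE : 'd tau B = (fun E => S^T *m E *m (invmx M)^T) :> (_ -> _).
  apply/funext => E; apply: trmx_inj; rewrite !trmx_mul !trmxK.
  by rewrite -diff_transition // mulKmx.
have -> : jac tau B = \det (lin_mx (fun E : 'M[C]_(m, k) => S^T *m E *m (invmx M)^T)).
  by rewrite /jac dE.
rewrite (det_lin_mx_mul (K := R[i]) S^T (invmx M)^T) !det_tr det_inv.
rewrite -(det_trans_row cJ cJ' mB) -/S.
have alg (F : fieldType) (a b : F) p :
    a != 0 -> b ^+ k * a^-1 ^+ p * a ^+ (p + k) = (a * b) ^+ k.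
  move=> a0; rewrite exprD exprMn exprVn.
  by rewrite -mulrA mulKf ?expf_neq0 // mulrC.
by have := alg _ _ (\det S) m mB; rewrite subnK // => <-.
Qed.
End Transition.
End ChartDerivative.

(** * Uniqueness of the volume form *)

Section ComplexPoly.
Variable R : realType.
Local Notation C := (Cx R).

Lemma poly_neq0_large (p : {poly C}) : p != 0 ->
  exists M : R, forall s : C, M <= cmod s -> p.[s] != 0.
Proof.
move=> p0; have [r pE] := closed_field_poly_normal (p : {poly R[i]}).
exists (1 + \sum_(z <- r) cmod z) => s hs; apply: contraTneq hs => ps0.
have : root (p : {poly R[i]}) s by apply/eqP.
rewrite pE rootZ ?lead_coef_eq0 // root_prod_XsubC => sr.
rewrite -ltNge (big_rem s) //= addrCA ltrDl ltr_pwDl //.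
by apply: sumr_ge0 => i _; exact: cmod_ge0.
Qed.

Lemma poly_neq0_small (p : {poly C}) (d : R) : p != 0 -> 0 < d ->
  exists2 t : C, cmod t < d & p.[t] != 0.
Proof.
move=> p0 d0; apply: contrapT => H.
pose pt (j : nat) : C := (d / (j%:R + 2))%:C%C.
have ptE j : cmod (pt j) = d / (j%:R + 2).
  have h0 : 0 <= d / (j%:R + 2) by rewrite divr_ge0 ?(ltW d0) // addr_ge0.
  by rewrite cmodE /cRe /cIm /= expr0n addr0 sqrtr_sqr ger0_norm.
have rp : all (root p) [seq pt j | j <- iota 0 (size p)].
  apply/allP => _ /mapP[j _ ->]; apply/negP => /negP np; apply: H; exists (pt j) => //.
  rewrite ptE ltr_pdivrMr; last by rewrite ltr_wpDl.
  rewrite ltr_pMr //; apply: (@lt_le_trans _ _ 2); [by rewrite ltr1n | by rewrite lerDr].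
have up : uniq [seq pt j | j <- iota 0 (size p)].
  rewrite map_inj_uniq ?iota_uniq // => i j /(congr1 (@cmod R)).
  rewrite !ptE => /(mulfI (lt0r_neq0 d0)) /invr_inj /addIr /eqP.
  by rewrite eqr_nat => /eqP.
by have := max_poly_roots p0 rp up; rewrite size_map size_iota ltnn.
Qed.
End ComplexPoly.

Section VolumeForm.
Variables (R : realType) (n k : nat).
Hypothesis kn : (k <= n)%N.
Local Notation C := (Cx R).
Local Notation m := (n - k)%N.

Definition muprod (A : 'M[C]_(k, n)) : C := \prod_(1 <= i < n.+1) minor (mu n k i) A.

Lemma rank_minor (J : {set 'I_n}) (A : 'M[C]_(k, n)) : #|J| = k -> minor J A != 0 ->
  \rank A = k.
Proof.
move=> cJ; rewrite minor_unit -row_full_unit => /eqP rM.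
apply/eqP; rewrite eqn_leq rank_leq_row -[in leqLHS]rM (cols_sel cJ).
exact: mxrankM_maxl.
Qed.

Lemma muprod_neq0 (A : 'M[C]_(k, n)) :
  muprod A != 0 <-> forall i, (1 <= i <= n)%N -> minor (mu n k i) A != 0.
Proof.
rewrite /muprod prodf_seq_neq0; split=> [/allP h i hi|h].
  by have := h i; rewrite mem_index_iota ltnS; apply.
by apply/allP => i; rewrite mem_index_iota ltnS => /h.
Qed.

Lemma mirror_chart (J : {set 'I_n}) (B : 'M[C]_(m, k)) : #|J| = k ->
  mirror (chart J B) <-> muprod (chart J B) != 0.
Proof.
move=> cJ; split; first by move=> [_ /muprod_neq0].
move=> /muprod_neq0 h; split => //.
by apply: (rank_minor cJ); rewrite minor_chart // oner_neq0.
Qed.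

Lemma muprod_mulmx (M : 'M[C]_k) (A : 'M[C]_(k, n)) :
  muprod (M *m A) = \det M ^+ n * muprod A.
Proof.
rewrite /muprod; under eq_bigr do rewrite minor_mulmx.
by rewrite big_split /= prodr_const_nat subn1.
Qed.

Lemma chart_line (J : {set 'I_n}) (B E : 'M[C]_(m, k)) : #|J| = k ->
  exists A1 : 'M[C]_(k, n), forall s : C, chart J (B + s *: E) = chart J B + s *: A1.
Proof.
move=> cJ; exists (E^T *m selJC R cJ) => t.
by rewrite !(chart_sel cJ) raddfD /= linearZ /= mulmxDl addrA scalemxAl.
Qed.

(** Purpose: a line that meets the mirror leaves it at finitely many parameters only, so it has
    mirror points arbitrarily far out and arbitrarily close to any of its points. *)
Lemma muprod_line (J : {set 'I_n}) (B E : 'M[C]_(m, k)) : #|J| = k ->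
  exists p : {poly C}, forall s, p.[s] = muprod (chart J (B + s *: E)).
Proof.
move=> cJ; have [A1 hA] := chart_line B E cJ.
pose PA : 'M[{poly C}]_(k, n) := \matrix_(i, c) ((chart J B i c)%:P + A1 i c *: 'X).
have minorE (I : {set 'I_n}) : exists q : {poly C}, forall s,
    q.[s] = minor I (chart J (B + s *: E)).
  exists (\det (\matrix_(i < k, j < k) nth 0 [seq PA i c | c <- enum I] j)) => s.
  rewrite -[LHS]/(horner_eval s _) -det_map_mx; congr (\det _).
  apply/matrixP => i j; rewrite !mxE hA -[LHS]/(horner_eval s _).
  have [jJ|Jj] := ltnP j (size (enum I)); last first.
    by rewrite !nth_default ?size_map // rmorph0.
  have c0 : 'I_n by move: jJ; rewrite -cardE => jJ; exact: (enum_val (Ordinal jJ)).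
  by rewrite !(nth_map c0) // !mxE /horner_eval !hornerE mulrC.
have [q qE] := choice (fun i : nat => minorE (mu n k i)).
exists (\prod_(1 <= i < n.+1) q i) => s.
by rewrite horner_prod; apply: eq_bigr => i _; rewrite qE.
Qed.

Variable omega : top_form R n k.
Hypothesis omega_nv : nonvanishing_holomorphic_form omega.

Section TwoCharts.
Variables (J J' : {set 'I_n}) (cJ : #|J| = k) (cJ' : #|J'| = k).
Variables (g g' : 'M[C]_(m, k) -> C).
Hypothesis gE : forall B, mirror (chart J B) -> g B = omega J B * muprod (chart J B).
Hypothesis gE' : forall B, mirror (chart J' B) -> g' B = omega J' B * muprod (chart J' B).
Local Notation tau := (fun B : 'M[C]_(m, k) => chart_coord J' (chart J B)).

(** The [n]-th power of the minor gained by [muprod] cancels the one in [jac_transition]. *)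
Lemma coefficient_transition (B : 'M[C]_(m, k)) :
  mirror (chart J B) -> minor J' (chart J B) != 0 ->
  g B = trans_const R cJ cJ' ^+ k * g' (tau B).
Proof.
move=> mB m'B; have [_ _ tr] := omega_nv.
have AE := chart_coordK cJ' m'B.
have pE : muprod (chart J B) = minor J' (chart J B) ^+ n * muprod (chart J' (tau B)).
  by rewrite {1}AE muprod_mulmx.
have mB' : mirror (chart J' (tau B)).
  apply/(mirror_chart _ cJ'); have /(mirror_chart _ cJ) := mB.
  by rewrite pE mulf_eq0 negb_or => /andP[].
rewrite gE // gE' // pE (tr J J' B cJ cJ' mB m'B) /=.
rewrite -(jac_transition cJ cJ' kn m'B) /=.
by rewrite [X in X * _ = _]mulrC mulrACA.
Qed.

End TwoCharts.

(** * A coordinate line of a chart, seen from a neighbouring chart *)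

Section Pivot.
Variables (J : {set 'I_n}) (cJ : #|J| = k) (B : 'M[C]_(m, k)) (r : 'I_m) (i : 'I_k).
Local Notation a := (eset cJ i).
Local Notation b := (eset (card_compl cJ) r).

(** As [s] grows, the row spans along [B + s e_ri] converge to a point outside the chart [J];
    exchanging the column [a] for [b] gives a chart that contains it. *)
Definition pivot_set : {set 'I_n} := b |: (J :\ a)%SET.

Lemma card_pivot_set : #|pivot_set| = k.
Proof.
have bJ := eset_compl_notin cJ r.
rewrite cardsU1 !inE bJ andbF /=.
by have := cardsD1 a J; rewrite eset_in cJ => <-.
Qed.

(* The chart line [s |-> B + s e_ri] with its pivot row divided by [s = 1/u]. *)
Definition pivot_mx (u : C) : 'M[C]_(k, n) := \matrix_(i', c)
  if i' == i then u * chart J B i' c + (c == b)%:R else chart J B i' c.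

Lemma chart_pivot_line (s : C) i' c :
  chart J (B + s *: delta_mx r i) i' c = chart J B i' c + s * ((i' == i) && (c == b))%:R.
Proof.
case: (eset_case cJ c) => [j|r'].
  by rewrite !chartE_in eset_compl_neq andbF mulr0 addr0.
rewrite !chartE_out (inj_eq (@eset_inj _ _ _ (card_compl cJ))) 3!mxE.
by rewrite andbC.
Qed.

Lemma pivot_mxE (s : C) : s != 0 -> exists2 M : 'M[C]_k, M \in unitmx &
  pivot_mx s^-1 = M *m chart J (B + s *: delta_mx r i).
Proof.
move=> s0; exists (diag_mx (\row_j if j == i then s^-1 else 1)).
  rewrite unitmxE det_diag unitfE; apply/prodf_neq0 => j _; rewrite mxE.
  by case: ifP => _; rewrite ?invr_neq0 // oner_neq0.
apply/matrixP => i' c; rewrite mul_diag_mx [LHS]mxE [RHS]mxE [X in _ = X * _]mxE.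
rewrite chart_pivot_line; case: eqVneq => [_|_] /=; last by rewrite mul1r mulr0 addr0.
by rewrite mulrDr mulKf.
Qed.

(** Row [i] of [pivot_mx 0] is the basis vector of column [b], and the other rows are unit vectors
    on the remaining columns of [pivot_set]. So a vector in the left kernel vanishes off [i] first
    and then at [i]. *)
Lemma pivot_mx0_minor : minor pivot_set (pivot_mx 0) != 0.
Proof.
rewrite minor_unit -row_free_unit; apply/inj_row_free => v v0.
have vc c : c \in pivot_set -> \sum_l v 0 l * pivot_mx 0 l c = 0.
  move=> cin; have [j ->] := esetP card_pivot_set cin.
  have /rowP/(_ j) := v0; rewrite (colsE card_pivot_set) !mxE => E.
  by rewrite -[RHS]E; apply: eq_bigr => l _; rewrite [in RHS]mxE.
have vj j : j != i -> v 0 j = 0.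
  move=> ji; have := vc (eset cJ j).
  rewrite !inE eset_in (inj_eq (@eset_inj _ _ _ cJ)) ji orbT => /(_ isT).
  rewrite (bigD1 j) //= big1 => [|l lj]; rewrite mxE ?(negPf ji) chartE_in.
    by rewrite eqxx mulr1 addr0.
  by rewrite eset_compl_neq (negPf lj) mul0r addr0 if_same mulr0.
apply/rowP => j; rewrite [RHS]mxE; have [->|/vj//] := eqVneq j i.
have := vc b; rewrite !inE eqxx => /(_ isT).
rewrite (bigD1 i) //= big1 => [|l li]; last by rewrite (vj l) // mul0r.
by rewrite mxE !eqxx mul0r add0r mulr1 addr0.
Qed.

Lemma differentiable_pivot_mx (u : C) : differentiable pivot_mx u.
Proof.
apply: differentiable_mx => i' c; under eq_fun do rewrite mxE.
case: (i' == i); last exact: differentiable_cst.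
apply: differentiableD; last exact: differentiable_cst.
by apply: differentiableM; [exact: ex_diff | exact: differentiable_cst].
Qed.

Variables (g g' : 'M[C]_(m, k) -> C).
Hypothesis gE : forall B, mirror (chart J B) -> g B = omega J B * muprod (chart J B).
Hypothesis gE' : forall B, mirror (chart pivot_set B) ->
  g' B = omega pivot_set B * muprod (chart pivot_set B).
Hypothesis gd : forall B, differentiable g B.
Hypothesis gd' : forall B, differentiable g' B.

(* The function [s |-> g (B + s e_ri)] is entire, and it has a limit at infinity
   because [g'] is continuous at the point [pivot_mx 0] of another chart. *)
Lemma coefficient_pivot_line (s : C) : mirror (chart J B) ->
  g (B + s *: delta_mx r i) = g B.
Proof.
move=> mB; pose E : 'M[C]_(m, k) := delta_mx r i.
pose f (s : C) := g (B + s *: E).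
pose kap := trans_const R cJ card_pivot_set ^+ k.
(* This is [f] in the parameter [u = 1/s], computed in the chart of [pivot_set], where [u = 0] is an
   ordinary point. *)
pose psi (u : C) := kap * g' (chart_coord pivot_set (pivot_mx u)).
have df s0 : differentiable f s0.
  have dl : differentiable (fun s : C => B + s *: E) s0.
    apply: differentiableD; first exact: differentiable_cst.
    by apply: differentiableZl; exact: ex_diff.
  exact: (differentiable_comp dl (gd _)).
have dpsi : differentiable psi 0.
  apply: differentiableM; first exact: differentiable_cst.
  have dc : differentiable (fun u => chart_coord pivot_set (pivot_mx u)) 0.
    apply: differentiable_chart_coord; first exact: differentiable_pivot_mx.
    exact: pivot_mx0_minor.
  exact: (differentiable_comp dc (gd' _)).
have [p pE] := muprod_line B E cJ.
have p0 : p != 0.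
  apply/eqP => p0; have /(mirror_chart _ cJ) := mB.
  by have := pE 0; rewrite p0 horner0 scale0r addr0 => <-; rewrite eqxx.
have [M1 hM1] := poly_neq0_large p0.
have lim (e : R) : 0 < e -> exists M : R, forall s, M <= cmod s -> cmod (f s - psi 0) < e.
  move=> e0.
  have n1 : \forall u \near (0 : C), minor pivot_set (pivot_mx u) != 0.
    have := differentiable_continuous
      (differentiable_minor pivot_set (differentiable_pivot_mx 0)).
    by move=> /near_neq0; apply; exact: pivot_mx0_minor.
  have n2 : \forall u \near (0 : C), cmod (psi u - psi 0) < e.
    have := differentiable_continuous dpsi => /cvgrPdist_lt /(_ (e%:C%C)).
    rewrite ltcR => /(_ e0); apply: filterS => u.
    by rewrite distrC normE ltcR.
  have [d d0 hd] : exists2 d : R, 0 < d & forall u : C, cmod u < d ->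
      minor pivot_set (pivot_mx u) != 0 /\ cmod (psi u - psi 0) < e.
    have [dl /= dl0 H] := (nbhs_ballP _ _).1 (filterI n1 n2).
    have dE : dl = (complex.Re dl)%:C%C by rewrite RRe_real // gtr0_real.
    exists (complex.Re dl); first by rewrite -ltcR -dE.
    move=> u hu; apply: H; rewrite -ball_normE /= sub0r normrN normE.
    by rewrite dE ltcR.
  (* [M1] keeps the point in the mirror, and [2 / d] makes the modulus of [1/t] strictly less than
     [d]. *)
  exists (Num.max M1 (2 / d)) => t; rewrite ge_max => /andP[t1 t2].
  have d2 : 0 < 2 / d by rewrite divr_gt0.
  have t0 : t != 0 by rewrite -cmod_gt0; apply: lt_le_trans t2.
  have [|mt et] := hd t^-1.
    rewrite cmodV invf_plt ?posrE ?cmod_gt0 //; apply: lt_le_trans t2.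
    by rewrite -[ltLHS]mul1r ltr_pM2r ?invr_gt0 // ltr1n.
  have mir : mirror (chart J (B + t *: E)).
    by apply/(mirror_chart _ cJ); rewrite -pE; exact: hM1.
  have [M Mu ME] := pivot_mxE t0.
  have mt' : minor pivot_set (chart J (B + t *: E)) != 0.
    by move: mt; rewrite ME minor_mulmx mulf_eq0 negb_or => /andP[].
  suff -> : f t = psi t^-1 by [].
  rewrite /f (coefficient_transition cJ card_pivot_set gE gE' mir mt') /psi ME.
  by rewrite (chart_coord_mulmx Mu mt').
have const := liouville_at_infinity df lim.
have := const s; rewrite -(const 0) /f scale0r addr0; exact.
Qed.

End Pivot.

(** The base point of [coefficient_pivot_line] must lie in the mirror. Any other [X] is approached
    along the line to [B0], which lies in the mirror for all but finitely many parameters. After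
    that, [B] is reached from 0 one entry at a time. *)
Lemma coefficient_constant (J : {set 'I_n}) (B0 B : 'M[C]_(m, k))
    (g : 'M[C]_(m, k) -> C) :
  #|J| = k -> simple_poles omega -> (forall B, differentiable g B) ->
  (forall B, mirror (chart J B) -> g B = omega J B * muprod (chart J B)) ->
  mirror (chart J B0) -> g B = g 0.
Proof.
move=> cJ sp gd gE mB0.
have line (X : 'M[C]_(m, k)) r i s : g (X + s *: delta_mx r i) = g X.
  have [g' [gd' gE' _]] := sp _ (card_pivot_set cJ r i).
  pose E : 'M[C]_(m, k) := delta_mx r i.
  have [p pE] := muprod_line X (B0 - X) cJ.
  have p0 : p != 0.
    apply/eqP => p0; have /(mirror_chart _ cJ) := mB0.
    by have := pE 1; rewrite p0 horner0 scale1r addrC subrK => <-; rewrite eqxx.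
  (* The increment along the entry vanishes whenever the base point is in the mirror; being
     continuous at [t = 0], it vanishes at [X] as well. *)
  pose phi (t : C) := g (X + t *: (B0 - X) + s *: E) - g (X + t *: (B0 - X)).
  have phi0 t : p.[t] != 0 -> phi t = 0.
    rewrite pE => /(mirror_chart _ cJ) mt; apply/eqP; rewrite subr_eq0; apply/eqP.
    exact: (coefficient_pivot_line gE gE' gd gd').
  have dphi : differentiable phi 0.
    have dl : differentiable (fun t : C => X + t *: (B0 - X)) 0.
      apply: differentiableD; first exact: differentiable_cst.
      by apply: differentiableZl; exact: ex_diff.
    have dl' : differentiable (fun t : C => X + t *: (B0 - X) + s *: E) 0.
      by apply: differentiableD => //; exact: differentiable_cst.
    apply: differentiableB; first exact: (differentiable_comp dl' (gd _)).
    exact: (differentiable_comp dl (gd _)).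
  apply/eqP; apply: contraT => ne.
  have ne0 : phi 0 != 0 by rewrite /phi scale0r addr0 subr_eq0.
  have nz := near_neq0 (differentiable_continuous dphi) ne0.
  have [dl /= dl0 H] := (nbhs_ballP _ _).1 nz.
  have dE : dl = (complex.Re dl)%:C%C by rewrite RRe_real // gtr0_real.
  have dR : 0 < complex.Re dl by rewrite -ltcR -dE.
  have [t td pt] := poly_neq0_small p0 dR.
  have : phi t != 0.
    by apply: H; rewrite -ball_normE /= sub0r normrN normE dE ltcR.
  by rewrite (phi0 _ pt) eqxx.
have sum (s : seq ('I_m * 'I_k)) (X : 'M[C]_(m, k)) :
    g (X + \sum_(p <- s) B p.1 p.2 *: delta_mx p.1 p.2) = g X.
  elim: s X => [|p s IH] X; first by rewrite big_nil addr0.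
  by rewrite big_cons addrA IH line.
rewrite [B in LHS]matrix_sum_delta pair_bigA /= -(add0r (\sum_(p | _) _)).
exact: sum.
Qed.

Theorem volume_coefficient (J : {set 'I_n}) (B0 : 'M[C]_(m, k)) :
  #|J| = k -> simple_poles omega -> mirror (chart J B0) ->
  exists2 c0 : C, c0 != 0 &
    forall B, mirror (chart J B) -> omega J B * muprod (chart J B) = c0.
Proof.
move=> cJ sp mB0; have [g [gd gE _]] := sp J cJ.
have gc B := coefficient_constant B cJ sp gd gE mB0.
exists (g 0) => [|B mB]; last by rewrite -gE.
have [_ nz _] := omega_nv.
rewrite -(gc B0) gE // mulf_neq0 ?nz //.
by have /(mirror_chart _ cJ) := mB0.
Qed.

End VolumeForm.

(** * The matrices parametrised by the torus *)

Section NatDet.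
Variable F : fieldType.

(** With entries indexed by [nat], a choice of columns is a plain function, and minors of different
    sizes can be compared without casts. *)
Definition ndet n (G : nat -> nat -> F) : F := \det (\matrix_(i < n, j < n) G i j).

Lemma eq_ndet n (G H : nat -> nat -> F) :
  (forall i j, (i < n)%N -> (j < n)%N -> G i j = H i j) -> ndet n G = ndet n H.
Proof. by move=> GH; congr (\det _); apply/matrixP => i j; rewrite !mxE GH. Qed.

Lemma ndet_upper n (G : nat -> nat -> F) :
  (forall i j, (j < i < n)%N -> G i j = 0) -> ndet n G = \prod_(i < n) G i i.
Proof.
move=> G0; rewrite /ndet -det_tr det_trig.
  by apply: eq_bigr => i _; rewrite !mxE.
by apply/is_trig_mxP => i j ij; rewrite !mxE G0 // ij /=.
Qed.

(** All columns change at once, each by a multiple of the old preceding one: this is multiplication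
    by a unipotent bidiagonal matrix. The condition on [c 0] is there because [0.-1] is [0]. *)
Lemma ndet_addcol n (G : nat -> nat -> F) (c : nat -> F) : c 0%N = 0 ->
  ndet n (fun i j => G i j + c j * G i j.-1) = ndet n G.
Proof.
move=> c0; pose T i j : F := (i == j)%:R + (j == i.+1)%:R * c j.
transitivity (ndet n G * ndet n T).
  rewrite /ndet -det_mulmx; congr (\det _); apply/matrixP => i j; rewrite !mxE.
  under eq_bigr do rewrite !mxE mulrDr.
  rewrite big_split /=; congr (_ + _).
    rewrite (bigD1 j) //= eqxx mulr1 big1 ?addr0 // => l lj.
    by rewrite -val_eqE in lj; rewrite (negPf lj) mulr0.
  case: j => [[|j] jn] /=.
    by rewrite c0 mul0r big1 // => l _; rewrite mul0r mulr0.
  have jn' : (j < n)%N by exact: ltnW.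
  rewrite (bigD1 (Ordinal jn')) //= eqxx mul1r mulrC big1 ?addr0 // => l.
  by rewrite -val_eqE /= eqSS eq_sym => /negPf ->; rewrite mul0r mulr0.
rewrite (@ndet_upper n T) => [|i j /andP[ji _]].
  by rewrite big1 ?mulr1 // => i _; rewrite /T eqxx -[X in (X == _)]addn0 -addn1 eqn_add2l mul0r addr0.
by rewrite /T gtn_eqF // ltn_eqF ?mul0r ?addr0 // ltnS ltnW.
Qed.

(* The signs that expansion along the last row creates are absorbed by the
   signs of the columns to the right of the pivot. *)
Lemma ndet_pivot n (G N : nat -> nat -> F) (p : nat) (x : F) : (p <= n)%N ->
  (forall j, (j <= n)%N -> G n j = if j == p then x else 0) ->
  (forall i j, (i < n)%N -> (j < p)%N -> G i j = N i j) ->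
  (forall i j, (i < n)%N -> (p <= j < n)%N -> G i j.+1 = - N i j) ->
  ndet n.+1 G = x * ndet n N.
Proof.
move=> pn Gn Glt Gge; pose p' := Ordinal (pn : (p < n.+1)%N).
rewrite /ndet (expand_det_row _ ord_max) (bigD1 p') //= big1 ?addr0; last first.
  move=> j jp; rewrite mxE Gn ?leq_ord // ifN ?mul0r //.
rewrite mxE Gn //= eqxx; congr (_ * _); rewrite /cofactor /=.
rewrite (_ : row' ord_max (col' p' (\matrix_(i < n.+1, j < n.+1) G i j)) = (\matrix_(i < n, j < n) N i j) *m
   diag_mx (\row_(j < n) (if (j < p)%N then 1 else -1)) :> 'M[F]_n); last first.
  apply/matrixP => i j; rewrite mul_mx_diag !mxE /= /bump leqNgt ltn_ord add0n.
  have [jp|pj] := ltnP j p; first by rewrite add0n mulr1 Glt.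
  by rewrite add1n mulrN1 Gge // pj ltn_ord.
rewrite det_mulmx det_diag.
have -> : \prod_i (\row_(j < n) (if (j < p)%N then 1 else -1)) 0 i = (-1) ^+ (n - p) :> F.
  under eq_bigr do rewrite mxE.
  rewrite -(big_mkord xpredT (fun j => if (j < p)%N then 1 else -1)) (@big_cat_nat _ _ _ p) //=.
  rewrite big_nat big1 ?mul1r => [|j /andP[_ ->] //].
  rewrite big_nat (eq_bigr (fun=> -1)) => [|j /andP[pj _]]; last by rewrite ltnNge pj.
  by rewrite -big_nat prodr_const_nat.
rewrite mulrCA -exprD -signr_odd.
have -> : odd (n + p + (n - p)) = false by lia.
by rewrite expr0 mulr1.
Qed.

Lemma ndet_addr n (G H : nat -> nat -> F) (b : F) :
  ndet n.+1 (fun i j => if j == n then b * G i j + H i j else G i j) =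
  b * ndet n.+1 G + ndet n.+1 (fun i j => if j == n then H i j else G i j).
Proof.
rewrite /ndet -[LHS]det_tr -(det_tr (\matrix_(i, j) G i j)).
rewrite -[X in _ = _ + X]det_tr -[X in _ = _ + X]mul1r.
apply: (@determinant_multilinear _ _ _ _ _ ord_max b 1).
- by apply/rowP => j; rewrite !mxE eqxx mul1r.
- apply/matrixP => i j; rewrite !mxE ifN //.
  by rewrite /= /bump leqNgt ltn_ord add0n ltn_eqF.
- apply/matrixP => i j; rewrite !mxE.
  by rewrite /= /bump leqNgt ltn_ord add0n ltn_eqF.
Qed.

End NatDet.

Section Network.
Variable F : fieldType.
Implicit Types (z : nat -> nat -> F) (f : nat -> nat).

(* [z] is indexed from 0 and [zz] has its rows indexed from 1, with the
   convention [z_0j = 1]. *)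
Definition zz z i j : F := if i is i'.+1 then z i' j else 1.

Definition zshift z i j : F := z i j.+1.

(* Entry of the k x n matrix of [z] in row [r] and column [c], both indexed
   from 0. For [k = K'.+1], with [b] the columns for [K'] rows and the torus
   coordinates [z_ij], [j >= 2], the columns are [b_0, ..., b_(K'-1)], then the
   last basis vector, then [a_c = (z_i1 / z_(i-1)1) a_(c-1) - b_(c-1)] for
   [c = K' + i]. With these signs, the minor of an i x j rectangle is the
   product of the [z_(i-l)(j-l)]. *)
Fixpoint acol K z (r c : nat) : F :=
  if K is K'.+1 then
    let b := acol K' (zshift z) r in
    if (c < K')%N then b c else
    (fix tail i := if i is i'.+1
       then zz z i 0 / zz z i' 0 * tail i' - b (K' + i')%N
       else (r == K')%:R) (c - K')%N
  else 0.

Lemma acol_lt K z r c : (c < K)%N -> acol K.+1 z r c = acol K (zshift z) r c.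
Proof. by move=> /= ->. Qed.

Lemma acol_eq K z r : acol K.+1 z r K = (r == K)%:R.
Proof. by rewrite /= ltnn subnn. Qed.

Lemma acol_step K z r i : acol K.+1 z r (K + i.+1) =
  zz z i.+1 0 / zz z i 0 * acol K.+1 z r (K + i) - acol K (zshift z) r (K + i).
Proof. by rewrite /= !ltnNge !leq_addr /= !addKn. Qed.

Arguments acol : simpl never.

Lemma acol_step' K z r c : (K <= c)%N -> acol K.+1 z r c.+1 =
  zz z (c.+1 - K) 0 / zz z (c - K) 0 * acol K.+1 z r c - acol K (zshift z) r c.
Proof. by move=> Kc; have := acol_step K z r (c - K); rewrite addnS subnKC // subSn. Qed.

Lemma acol_high K z r c : (K <= r)%N -> acol K z r c = 0.
Proof.
elim: K z r c => [//|K IH] z r c Kr.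
have [cK|Kc] := ltnP c K; first by rewrite acol_lt // IH // ltnW.
rewrite -(subnKC Kc); elim: (c - K)%N => [|i IHi].
  by rewrite addn0 acol_eq gtn_eqF.
by rewrite acol_step IHi mulr0 IH ?subrr // ltnW.
Qed.

Lemma acol_id K z r c : (c < K)%N -> acol K z r c = (r == c)%:R.
Proof.
elim: K z r c => [//|K IH] z r c; rewrite ltnS leq_eqVlt => /predU1P[->|cK].
  exact: acol_eq.
by rewrite acol_lt // IH.
Qed.

Definition nonvan z := forall i j, z i j != 0.

Lemma nonvan_shift z : nonvan z -> nonvan (zshift z).
Proof. by move=> h i j; exact: h. Qed.

Lemma zz_neq0 z i j : nonvan z -> zz z i j != 0.
Proof. by move=> h; case: i => [|i]; rewrite /= ?oner_neq0. Qed.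

(** The smaller matrix has no entries in this row, so the ratios of the recursion telescope. *)
Lemma acol_last K z i : nonvan z -> acol K.+1 z K (K + i) = zz z i 0.
Proof.
move=> h; elim: i => [|i IH]; first by rewrite addn0 acol_eq eqxx.
by rewrite acol_step IH acol_high // subr0 divfK // zz_neq0.
Qed.

(** Divided by [zz z i 0], the recursion only adds one summand per step. This is where the column
    sums of the Laurent polynomial come from. *)
Lemma acol_penult K z i : nonvan z ->
  acol K.+2 z K (K.+1 + i) = - zz z i 0 * \sum_(l < i) zz z l.+1 1 / zz z l.+1 0.
Proof.
move=> h; elim: i => [|i IH].
  by rewrite addn0 acol_eq ltn_eqF // big_ord0 mulr0.
rewrite acol_step IH addSnnS (acol_last K i.+1 (nonvan_shift h)) big_ord_recr /=.
rewrite -[z i 1]/(zz z i.+1 1) -[z i 0]/(zz z i.+1 0) /zshift.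
have := zz_neq0 i 0 h; have := zz_neq0 i.+1 0 h => a0 b0.
by rewrite -[zz _ i.+1 0 in RHS]/(zz z i.+1 0) /=; field; rewrite a0 b0.
Qed.

Definition pluck K z f : F := ndet K (fun i j => acol K z i (f j)).

(** Moving the last column one step to the right turns [mu i] into [muhat i] for [i < n - k]. *)
Definition lasthat K f (j : nat) : nat := if j.+1 == K then (f j).+1 else f j.

(** Some columns below [K], followed by an interval of consecutive columns from [f p] on: the shape
    in which the recursion can reduce every later column by its predecessor. *)
Definition window K f p : Prop :=
  [/\ (p <= K)%N, forall j, (j < p)%N -> (f j < K)%N, (K <= f p)%N
    & forall j, (p <= j < K)%N -> f j.+1 = (f j).+1].

Lemma window_ge K f p j : window K f p -> (p <= j <= K)%N -> (K <= f j)%N.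
Proof.
move=> [pK _ fp fS]; elim: j => [|j IH]; first by rewrite leqn0 => /andP[/eqP <-].
move=> /andP[pj jK]; move: pj; rewrite leq_eqVlt => /predU1P[<-//|].
by rewrite ltnS => pj; rewrite fS ?pj //; apply: leqW; apply: IH; rewrite pj ltnW.
Qed.

(* The columns in J_lambda, from 0, for the rectangle lambda with [i] rows and [j]
   columns. *)
Definition rectf K i j s : nat := if (s < K - j)%N then s else (s + i)%N.

Lemma window_rect K i j : (j <= K)%N ->
  window K (rectf K.+1 i j.+1) (maxn (K - j) (K - i)).
Proof. by move=> jK; split=> [|s|| s]; rewrite /rectf; do ?case: ifP; lia. Qed.

(** Truncated subtraction is intended: for [i <= j] the window starts at [K], where row 0 of [zz]
    contributes the factor 1. *)
Lemma window_rectE K i j : (j <= K)%N ->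
  (rectf K.+1 i j.+1 (maxn (K - j) (K - i)) - K)%N = (i - j)%N.
Proof. by move=> jK; rewrite /rectf; case: ifP; lia. Qed.

(* Subtracting from each column of the window a multiple of its predecessor
   turns it into minus a column of the smaller matrix. *)
Lemma ndet_window (G b : nat -> nat -> F) (t : nat -> F) (x : F) K f p :
  window K f p ->
  (forall r c, (c < K)%N -> G r c = b r c) ->
  (forall r c, (K <= c)%N -> G r c.+1 = t c * G r c - b r c) ->
  (forall j, (j < K)%N -> b K (f j) = 0) -> G K (f p) = x ->
  ndet K.+1 (fun i j => G i (f j)) = x * ndet K (fun i j => b i (f j)).
Proof.
move=> w Glt GS b0 Gx; have [pK flt fp fS] := w.
pose c j : F := if (p < j)%N then - t (f j.-1) else 0.
have c0 : c 0%N = 0 by [].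
have cle j : (j <= p)%N -> c j = 0 by rewrite /c ltnNge => ->.
rewrite -(@ndet_addcol _ _ _ _ c0).
have red i j : (p <= j < K)%N -> G i (f j.+1) + c j.+1 * G i (f j) = - b i (f j).
  move=> /andP[pj jK]; rewrite /c ltnS pj /= fS ?pj //.
  rewrite GS; last by apply: (window_ge w); rewrite pj ltnW.
  by rewrite mulNr addrAC subrr add0r.
apply: (@ndet_pivot _ _ _ _ p) => //.
- move=> j jK; have [jp|pj|->] := ltngtP j p.
  + by rewrite cle ?(ltnW jp) // mul0r addr0 Glt ?flt // b0 // (leq_trans jp).
  + by case: j pj jK => // j pj jK; rewrite [LHS]red ?b0 ?oppr0 // -ltnS pj.
  + by rewrite cle // mul0r addr0.
- by move=> i j iK jp; rewrite cle ?(ltnW jp) // mul0r addr0 Glt ?flt.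
- by move=> i j iK pj; exact: red.
Qed.

Lemma pluck_window K z f p : nonvan z -> window K f p ->
  pluck K.+1 z f = zz z (f p - K) 0 * pluck K (zshift z) f.
Proof.
move=> h w; have [pK flt fp fS] := w.
apply: (ndet_window (b := acol K (zshift z)) (t := fun c => zz z (c.+1 - K) 0 / zz z (c - K) 0) w).
- by move=> r c cK; rewrite acol_lt.
- by move=> r c Kc; rewrite acol_step'.
- by move=> j jK; rewrite acol_high.
- by rewrite -{1}(subnKC fp) acol_last.
Qed.

Lemma eq_pluck K z f g : (forall j, (j < K)%N -> f j = g j) -> pluck K z f = pluck K z g.
Proof. by move=> fg; apply: eq_ndet => i j _ jK; rewrite fg. Qed.

(* Together with [pluck_window], a three-term Pluecker relation for the ratio of
   the hatted to the plain minor. *)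
Lemma pluck_window_hat K z f p : nonvan z -> window K f p -> (p < K)%N ->
  pluck K.+1 z (lasthat K.+1 f) = zz z (f p - K) 0 *
    (zz z ((f K).+1 - K) 0 / zz z (f K - K) 0 * pluck K (zshift z) f
     + pluck K (zshift z) (lasthat K f)).
Proof.
case: K => [|K]; first by rewrite ltn0.
move=> h w pK; have [_ flt fp fS] := w.
pose t j := zz z (j.+1 - K.+1) 0 / zz z (j - K.+1) 0.
(* The moved last column lies two steps beyond its predecessor in the window, so the recursion is
   applied twice there and leaves a product of two ratios. *)
pose c j : F := if j == K.+1 then - (t (f j) * t (f j.-1))
  else if (p < j)%N then - t (f j.-1) else 0.
have c0 : c 0%N = 0 by [].
have fK1 : f K.+1 = (f K).+1 by rewrite fS // -ltnS pK ltnSn.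
have fKge : (K.+1 <= f K)%N by apply: (window_ge w); rewrite -ltnS pK leqnSn.
rewrite /pluck -(@ndet_addcol _ _ _ _ c0).
have red i j : (p <= j < K)%N ->
    acol K.+2 z i (f j.+1) + c j.+1 * acol K.+2 z i (f j) = - acol K.+1 (zshift z) i (f j).
  move=> /andP[pj jK]; have jK1 : (j < K.+1)%N by exact: leqW.
  have jK2 : (p <= j <= K.+1)%N by rewrite pj ltnW.
  rewrite /c eqSS (ltn_eqF jK) ltnS pj /= fS ?pj ?jK1 //.
  rewrite acol_step'; last exact: (window_ge w jK2).
  by rewrite mulNr addrAC subrr add0r.
have redK i : acol K.+2 z i (f K.+1).+1 + c K.+1 * acol K.+2 z i (f K) =
   - (t (f K.+1) * acol K.+1 (zshift z) i (f K) + acol K.+1 (zshift z) i (f K).+1).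
  rewrite /c eqxx /= acol_step' ?fK1; last exact: leqW.
  rewrite (acol_step' z i fKge) -/(t (f K)) -/(t (f K).+1).
  by ring.
pose G i j := acol K.+1 (zshift z) i (f j).
pose H i j := acol K.+1 (zshift z) i (f j).+1.
transitivity (zz z (f p - K.+1) 0 *
  ndet K.+1 (fun i j => if j == K then t (f K.+1) * G i j + H i j else G i j)); last first.
  rewrite ndet_addr; congr (_ * (_ + _)); apply: eq_ndet => i j _ _.
  by rewrite /lasthat eqSS; case: eqP => [->|].
have hatK j : (j < K.+1)%N -> lasthat K.+2 f j = f j.
  by move=> jK; rewrite /lasthat eqSS ltn_eqF.
have hatL : lasthat K.+2 f K.+1 = (f K.+1).+1 by rewrite /lasthat eqxx.
have cle j : (j <= p)%N -> c j = 0.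
  by move=> jp; rewrite /c ltnNge jp /= ltn_eqF // (leq_ltn_trans jp).
apply: (@ndet_pivot _ _ _ _ p); first exact: ltnW.
- move=> j jK; have [->|jK1] := eqVneq j K.+1.
    by rewrite gtn_eqF // hatL hatK // redK !acol_high // mulr0 addr0 oppr0.
  have {jK1}jK : (j < K.+1)%N by rewrite ltn_neqAle jK1.
  rewrite !hatK //; last by apply: leq_ltn_trans jK; exact: leq_pred.
  have [jp|pj|->] := ltngtP j p.
  + by rewrite cle ?(ltnW jp) // mul0r addr0 acol_lt ?flt // acol_high.
  + by case: j pj jK => // j pj jK; rewrite [LHS]red ?acol_high ?oppr0 // -ltnS pj.
  + by rewrite cle // mul0r addr0 -{1}(subnKC fp) acol_last.
- move=> i j iK jp; have jK : (j < K.+1)%N by exact: ltn_trans jp pK.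
  by rewrite cle ?(ltnW jp) // mul0r addr0 hatK // acol_lt ?flt // /G ltn_eqF // (leq_trans jp).
- move=> i j iK /andP[pj]; rewrite ltnS leq_eqVlt => /predU1P[->|jK].
    by rewrite hatL hatK // redK eqxx.
  by rewrite !hatK //= ?ltnS ?(ltnW jK) // red ?pj // (ltn_eqF jK).
Qed.

(** This locality makes the parametrisation triangular, and it keeps values of [z] outside the index
    range from influencing the matrix. *)
Lemma acol_dep K z z2 r i :
  (forall i' j', (i' < i)%N -> (j' + r <= K)%N -> z i' j' = z2 i' j') ->
  acol K.+1 z r (K + i) = acol K.+1 z2 r (K + i).
Proof.
have [rK|Kr] := leqP r K; last by rewrite !acol_high.
elim: K z z2 i rK => [|K IHK] z z2 i rK; elim: i => [|i IHi] zE;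
    rewrite ?addn0 ?acol_eq // !acol_step.
  rewrite IHi => [|i' j' ii]; last by apply: zE; exact: ltnW.
  rewrite -[zz z i.+1 0]/(z i 0%N) -[zz z2 i.+1 0]/(z2 i 0%N) zE //.
  by case: i zE {IHi} => // i zE; rewrite -[zz z i.+1 0]/(z i 0%N) -[zz z2 i.+1 0]/(z2 i 0%N) zE.
rewrite IHi => [|i' j' ii]; last by apply: zE; exact: ltnW.
rewrite -[zz z i.+1 0]/(z i 0%N) -[zz z2 i.+1 0]/(z2 i 0%N) zE //.
congr (_ * _ - _).
  by case: i zE {IHi} => // i zE; rewrite -[zz z i.+1 0]/(z i 0%N) -[zz z2 i.+1 0]/(z2 i 0%N) zE // ltnW.
have [rK'|Kr] := leqP r K; last by rewrite !acol_high.
by rewrite addSnnS; apply: IHK => // i' j' ii jr; apply: zE => //; rewrite addSn ltnS.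
Qed.

(** The recursion is run backwards: the last row gives the first column of [z], and solving for [b]
    leaves a matrix with one row less. Its rectangular minors are again nonzero, since by
    [ndet_window] they divide those of [G]. *)
Lemma acol_surj K m (G : nat -> nat -> F) :
  (forall r c, (r < K)%N -> (c < K)%N -> G r c = (r == c)%:R) ->
  (forall i j, (i <= m)%N -> (j <= K)%N ->
     ndet K (fun r s => G r (rectf K i j s)) != 0) ->
  exists2 z, nonvan z & forall r c, (r < K)%N -> (c < K + m)%N -> G r c = acol K z r c.
Proof.
elim: K G => [|K IH] G Gid Gnz; first by exists (fun _ _ => 1) => // i j; exact: oner_neq0.
(* Up to [m] these entries are nonzero: the minor of a one-column rectangle is triangular with
   [G K (K + i)] as last diagonal entry. The default 1 keeps all later coordinates nonzero. *)
pose e i := if (i <= m)%N then G K (K + i)%N else 1.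
have e0 i : e i != 0.
  rewrite /e; case: ifP => [im|_]; last exact: oner_neq0.
  have := Gnz i 1%N im isT; apply: contra => /eqP GK0.
  rewrite ndet_upper => [|r s /andP[sr rK]].
    by rewrite big_ord_recr /= /rectf subn1 ltnn GK0 mulr0.
  rewrite /rectf subn1 /=; case: ltnP => sK; last by lia.
  by rewrite Gid // ?gtn_eqF // ltnW.
have e1 : e 0%N = 1 by rewrite /e leq0n addn0 Gid ?eqxx.
pose t c := e (c.+1 - K)%N / e (c - K)%N.
pose b r c := if (c < K)%N then G r c else t c * G r c - G r c.+1.
have bK c : (c < K + m)%N -> b K c = 0.
  move=> cm; rewrite /b; case: ltnP => cK; first by rewrite Gid ?gtn_eqF // ltnW.
  rewrite /t /e !ifT; [|lia|lia].
  rewrite !subnKC; [|lia|lia].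
  rewrite divfK ?subrr //; have := e0 (c - K)%N; rewrite /e ifT; last by lia.
  by rewrite subnKC.
have bid r c : (r < K)%N -> (c < K)%N -> b r c = (r == c)%:R.
  by move=> rK cK; rewrite /b cK Gid // ltnW.
have bnz i j : (i <= m)%N -> (j <= K)%N -> ndet K (fun r s => b r (rectf K i j s)) != 0.
  move=> im jK; have := Gnz i j.+1 im jK.
  have w : window K (rectf K.+1 i j.+1) (maxn (K - j) (K - i)) by exact: window_rect.
  rewrite (@ndet_window G b t (e (i - j)%N) _ _ _ w).
  - by rewrite mulf_eq0 negb_or => /andP[].
  - by move=> r c cK; rewrite /b cK.
  - by move=> r c Kc; rewrite /b ltnNge Kc /= subKr.
  - by move=> s sK; apply: bK; rewrite /rectf; case: ifP; lia.
  - rewrite -(window_rectE i jK) /e ifT ?subnKC //; first by case: w.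
    by rewrite window_rectE //; lia.
have [z' nz' zE] := IH b bid bnz.
pose z i j := if j is j'.+1 then z' i j' else e i.+1.
exists z => [i [|j]|r c rK]; [exact: e0 | exact: nz' |].
have zzE i : zz z i 0 = e i by case: i => [|i]; rewrite ?e1.
have [cK _|Kc] := ltnP c K.
  by rewrite acol_id ?Gid // ltnW.
rewrite -(subnKC Kc); elim: (c - K)%N => [|i IHi] ic.
  by rewrite addn0 acol_eq Gid.
have im : (K + i < K + m)%N by lia.
rewrite acol_step -IHi; last by lia.
rewrite !zzE addnS.
have -> : acol K (zshift z) r (K + i) = b r (K + i)%N.
  move: rK; rewrite ltnS leq_eqVlt => /predU1P[->|rK]; first by rewrite acol_high // bK.
  by rewrite zE.
by rewrite /b ltnNge leq_addr /= /t addKn -addnS addKn subKr.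
Qed.

End Network.

Arguments acol : simpl never.

(** * Minors of rectangles and the hatted minors next to them *)

Section Rectangles.
Variable F : fieldType.
Implicit Types (z : nat -> nat -> F).

(** The product along the diagonal that ends at the corner of the rectangle; beyond the top edge,
    truncated subtraction yields row 0 and the factor 1. *)
Definition rectprod z i j : F := \prod_(l < j) zz z (i - (j - l.+1)) l.

Lemma rectprodS z i j : rectprod z i j.+1 = zz z (i - j) 0 * rectprod (zshift z) i j.
Proof.
by rewrite /rectprod big_ord_recl subSS subn0.
Qed.

Lemma rectprod_neq0 z i j : nonvan z -> rectprod z i j != 0.
Proof. by move=> h; apply/prodf_neq0 => l _; exact: zz_neq0. Qed.

Lemma pluck_id K z : pluck K z id = 1.
Proof.
rewrite /pluck ndet_upper => [|i j /andP[ji iK]].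
  by rewrite big1 // => i _; rewrite acol_id // eqxx.
by rewrite acol_id ?(ltn_trans ji) // gtn_eqF.
Qed.

Lemma pluck_rect K z i j : nonvan z -> (j <= K)%N ->
  pluck K z (rectf K i j) = rectprod z i j.
Proof.
elim: j K z => [|j IH] K z h jK.
  rewrite /rectprod big_ord0 -[RHS](pluck_id K z); apply: eq_pluck => s sK.
  by rewrite /rectf subn0 sK.
case: K jK => // K jK.
rewrite (pluck_window h (window_rect i (jK : (j <= K)%N))) window_rectE // rectprodS.
by rewrite -(IH K) //; exact: nonvan_shift.
Qed.

Lemma pluck1 z f : nonvan z -> pluck 1 z f = zz z (f 0%N) 0.
Proof. by move=> h; rewrite /pluck /ndet det_mx11 mxE (acol_last 0 _ h). Qed.

(** Dividing [pluck_window_hat] by [pluck_window] shows that each further column of coordinates adds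
    one summand to the ratio. *)
Lemma pluck_row_hat K z i : nonvan z -> (0 < i)%N ->
  pluck K.+1 z (lasthat K.+1 (addn^~ i)) =
  pluck K.+1 z (addn^~ i) * \sum_(j < K.+1) zz z i.+1 j / zz z i j.
Proof.
elim: K z => [|K IH] z h i0.
  rewrite !pluck1 // /lasthat /= big_ord_recl big_ord0 addr0 add0n mulrC divfK //.
  exact: zz_neq0.
have w : window K.+1 (addn^~ i) (K.+1 - i) by split=> //; lia.
have pK : (K.+1 - i < K.+1)%N by lia.
rewrite (pluck_window_hat h w pK) (pluck_window h w) (IH _ (nonvan_shift h) i0).
have -> : ((K.+1 + i).+1 - K.+1 = i.+1)%N by lia.
rewrite addKn [in RHS]big_ord_recl -[RHS]mulrA; congr (_ * _).
by rewrite mulrDr [X in X + _]mulrC; congr (_ * _ + _ * _).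
Qed.

Lemma pluck_box K z : nonvan z -> pluck K.+1 z (lasthat K.+1 id) = zz z 1 0.
Proof.
move=> h; have w : window K (lasthat K.+1 id) K.
  by split=> // [j jK||j]; rewrite /lasthat ?eqxx //; [rewrite eqSS ltn_eqF | lia].
rewrite (pluck_window h w) {1}/lasthat eqxx subSnn.
rewrite (@eq_pluck _ _ _ _ id) ?pluck_id ?mulr1 // => j jK.
by rewrite /lasthat eqSS ltn_eqF.
Qed.

(* The columns of [muhat n K (n - j)], where [i = n - K]. *)
Definition hatc K i j s : nat :=
  if (s < K - j.+1)%N then s else if s == (K - j.+1)%N then (K - j)%N else (s + i)%N.

(** One chosen column is the last basis vector. Clearing the last row of the final column with it
    and expanding leaves a triangular determinant whose only nontrivial entry is that of
    [acol_penult]. *)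
Lemma pluck_col_hat1 K z i : nonvan z ->
  pluck K.+2 z (hatc K.+2 i 1) =
  zz z i 0 * \sum_(l < i) zz z l.+1 1 / zz z l.+1 0.
Proof.
move=> h.
have f1 s : (s < K)%N -> hatc K.+2 i 1 s = s by rewrite /hatc !subSS subn0 => ->.
have f2 : hatc K.+2 i 1 K = K.+1 by rewrite /hatc !subSS subn0 ltnn eqxx subn0.
have f3 : hatc K.+2 i 1 K.+1 = (K.+1 + i)%N.
  by rewrite /hatc !subSS subn0 ltnNge leqnSn gtn_eqF.
have lt2 s : (s < K)%N -> (s < K.+2)%N by lia.
have ne1 s : (s < K)%N -> (s == K.+1) = false by lia.
pose c j : F := if j == K.+1 then - zz z i 0 else 0.
have c0 : c 0%N = 0 by [].
rewrite /pluck -(@ndet_addcol _ _ _ _ c0).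
pose N (r s : nat) : F := if (s < K)%N then acol K.+2 z r s else - acol K.+2 z r (K.+1 + i).
rewrite (@ndet_pivot _ K.+1 _ N K 1) ?leqnSn //.
- rewrite mul1r ndet_upper => [|r s /andP[sr rK]].
    rewrite big_ord_recr /= big1 => [|r _]; last first.
      by rewrite /N ltn_ord acol_id ?eqxx // lt2.
    by rewrite mul1r /N ltnn acol_penult // mulNr opprK.
  have sK : (s < K)%N by apply: leq_trans sr _; rewrite -ltnS.
  by rewrite /N sK acol_id ?gtn_eqF // lt2.
- move=> s; rewrite leq_eqVlt => /predU1P[->|].
    by rewrite f3 gtn_eqF // /c eqxx /= f2 (acol_eq K.+1) eqxx acol_last // mulr1 subrr.
  rewrite ltnS leq_eqVlt => /predU1P[->|sK].
    by rewrite f2 (acol_eq K.+1) eqxx /c ltn_eqF // mul0r addr0 eqxx.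
  rewrite f1 // acol_id ?lt2 // /c ne1 // mul0r addr0 (ltn_eqF sK).
  by rewrite gtn_eqF // ltnW.
- move=> r s rK sK; rewrite f1 // /c ne1 //.
  by rewrite mul0r addr0 /N sK.
- move=> r s rK /andP[Ks sK]; have -> : s = K by lia.
  by rewrite f3 /c eqxx /= f2 (acol_eq K.+1) ltn_eqF // mulr0 addr0 /N ltnn opprK.
Qed.

(** [pluck_window] extracts the same factor from both minors, so their ratio is that of the shifted
    coordinates with [j] lowered by one, down to [j = 1]. *)
Lemma pluck_col_hat K z i j : nonvan z -> (0 < i)%N -> (0 < j < K)%N ->
  pluck K z (hatc K i j) =
  pluck K z (rectf K i j) * \sum_(l < i) zz z l.+1 j / zz z l.+1 j.-1.
Proof.
elim: j K z => [//|j IH] K z h i0 /andP[_ jK].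
case: j IH jK => [|j] IH jK.
  case: K jK => [//|[//|K]] _; rewrite pluck_col_hat1 // pluck_rect //.
  by rewrite /rectprod big_ord_recl big_ord0 mulr1 subnn subn0.
case: K jK => // K jK.
have w : window K (hatc K.+1 i j.+2) (maxn (K - j.+1) (K - i)).
  by split=> [|s|| s]; rewrite /hatc; do ?case: ifP; lia.
have jK' : (j.+1 <= K)%N by lia.
rewrite (pluck_window h w) (pluck_window h (window_rect i jK')) window_rectE //.
have -> : (hatc K.+1 i j.+2 (maxn (K - j.+1) (K - i)) - K = i - j.+1)%N.
  by rewrite /hatc; do ?case: ifP; lia.
rewrite -!mulrA; congr (_ * _).
by rewrite [LHS](IH K) //; last exact: nonvan_shift.
Qed.

End Rectangles.

(** * The superpotential on the torus *)

Section SortedSets.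
Variable n : nat.

Definition setof k (f : nat -> nat) : {set 'I_n} :=
  [set c : 'I_n | [exists s : 'I_k, c == f s :> nat]]%SET.

Definition increasing k (f : nat -> nat) : Prop :=
  (forall s t, (s < t < k)%N -> (f s < f t)%N) /\ (forall s, (s < k)%N -> (f s < n)%N).

Lemma setofP k f (c : 'I_n) :
  reflect (exists2 s, (s < k)%N & c = f s :> nat) (c \in setof k f).
Proof.
rewrite inE; apply: (iffP existsP) => [[s /eqP E]|[s sk E]]; first by exists s.
by exists (Ordinal sk); rewrite E.
Qed.

Lemma enum_setof k f : increasing k f ->
  [seq val c | c <- enum (setof k f)] = [seq f s | s <- iota 0 k].
Proof.
move=> [finc fn]; apply: (irr_sorted_eq ltn_trans ltnn).
- apply: (subseq_sorted ltn_trans _ (iota_ltn_sorted 0 n)).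
  rewrite -val_enum_ord; apply: map_subseq.
  by rewrite {1}/enum_mem -enumT; exact: filter_subseq.
- apply/(sortedP 0%N) => i; rewrite size_map size_iota => ik.
  by rewrite !(nth_map 0%N) ?size_iota ?nth_iota ?(ltnW ik) // !add0n finc // ltnSn.
- move=> x; apply/mapP/mapP => [[c]|[s]].
    rewrite mem_enum => /setofP[s sk E] ->; exists s => //.
    by rewrite mem_iota.
  rewrite mem_iota /= add0n => sk ->; exists (Ordinal (fn s sk)) => //.
  by rewrite mem_enum; apply/setofP; exists s.
Qed.

Lemma card_setof k f : increasing k f -> #|setof k f| = k.
Proof.
by move=> fi; rewrite cardE -(size_map val) enum_setof // size_map size_iota.
Qed.

End SortedSets.

Section Minors.
Variables (R : realType) (n k : nat).
Local Notation C := (Cx R).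

Lemma minor_setof (G : nat -> nat -> C) f : increasing n k f ->
  minor (setof n k f) (\matrix_(r < k, c < n) G r c) = ndet k (fun i j => G i (f j)).
Proof.
move=> fi; congr (\det _); apply/matrixP => i j; rewrite !mxE.
have -> : [seq (\matrix_(r < k, c < n) G r c) i c | c <- enum (setof n k f)] =
          [seq G i c | c <- [seq val c | c <- enum (setof n k f)]].
  by rewrite -map_comp; apply: eq_map => c /=; rewrite mxE.
rewrite enum_setof // -map_comp (nth_map 0%N) ?size_iota //.
by rewrite /= nth_iota.
Qed.

End Minors.

(** * The cyclic column sets as increasing sequences *)

Section MuSets.
Variables n k : nat.
Hypothesis hk : (1 <= k <= n - 1)%N.
Local Notation m := (n - k)%N.

(** Positions run from 1 to [n] and cyclic indices up to [2n], so a congruence splits into two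
    linear cases. *)
Lemma eqn_mod_range a b : (0 < a <= n)%N -> (0 < b <= n + n)%N ->
  (a == b %[mod n]) = (a == b) || (a + n == b)%N.
Proof.
move=> /andP[a0 an] /andP[b0 bn].
case: a a0 an => // a _ an; case: b b0 bn => // b _ bn.
rewrite -(addn1 a) -(addn1 b) eqn_modDr (modn_small an).
have [bn'|nb] := ltnP b n; first by rewrite modn_small //; lia.
by rewrite -{1}(subnK nb) modnDr modn_small; lia.
Qed.

Lemma eqn_modP a b : (0 < a <= n)%N -> (0 < b <= n + n)%N ->
  reflect (a = b \/ a + n = b)%N (a == b %[mod n]).
Proof.
move=> ha hb; rewrite eqn_mod_range //.
by apply: (iffP orP) => -[/eqP|/eqP]; auto.
Qed.

Lemma increasing_rect i j : (i <= m)%N -> (j <= k)%N -> increasing n k (rectf k i j).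
Proof. by move=> im jk; split=> [s t|s] h; rewrite /rectf; do ?case: ifP; lia. Qed.

(** Up to [i = n - k] the interval does not wrap around and the diagram has full width; from then on
    it has full height and loses one column per step. *)
Lemma mu_rect i : (1 <= i <= n)%N ->
  mu n k i = setof n k (rectf k (minn i m) (minn k (n - i))).
Proof.
move=> hi; apply/setP => c; have cn := ltn_ord c.
apply/idP/setofP; rewrite inE.
  move=> /existsP[t]; have tk := ltn_ord t.
  case/eqn_modP; [lia | lia | move=> E | move=> E].
    case: (leqP i m) => im.
      by exists t => //; rewrite /rectf; case: ifP; lia.
    by exists (t + i - m)%N; [lia | rewrite /rectf; case: ifP; lia].
  by exists (t + i - n)%N; [lia | rewrite /rectf; case: ifP; lia].
move=> [s sk E]; apply/existsP; move: E; rewrite /rectf; case: ifP => h E.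
  have tk : (s + n - i < k)%N by lia.
  by exists (Ordinal tk); apply/eqn_modP; rewrite /=; [lia | lia | right; lia].
have tk : (s + minn i m - i < k)%N by lia.
by exists (Ordinal tk); apply/eqn_modP; rewrite /=; [lia | lia | left; lia].
Qed.

Lemma Jempty_rect : Jempty n k = setof n k (rectf k 0 0).
Proof.
apply/setP => c; apply/idP/setofP; rewrite inE; last first.
  by move=> [s sk]; rewrite /rectf; case: ifP; lia.
by move=> ck; exists c => //; rewrite /rectf; case: ifP; lia.
Qed.

Lemma mem_muhat i (c : 'I_n) : (c \in muhat n k i) =
  [exists t : 'I_k.-1, (c.+1 == i + t.+1 %[mod n])%N] || (c.+1 == i + k.+1 %[mod n])%N.
Proof. by rewrite inE. Qed.

Lemma muhat_of i f : (1 <= i <= n)%N ->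
  (forall s, (s < k)%N -> (exists2 t, (t < k.-1)%N & (f s).+1 = i + t.+1 \/ (f s).+1 + n = i + t.+1)%N
      \/ ((f s).+1 = i + k.+1 \/ (f s).+1 + n = i + k.+1)%N) ->
  (forall t, (t < k.-1)%N -> exists2 s, (s < k)%N & ((f s).+1 = i + t.+1 \/ (f s).+1 + n = i + t.+1)%N) ->
  (exists2 s, (s < k)%N & ((f s).+1 = i + k.+1 \/ (f s).+1 + n = i + k.+1)%N) ->
  (forall s, (s < k)%N -> (f s < n)%N) ->
  muhat n k i = setof n k f.
Proof.
move=> hi H1 H2 H3 H4; apply/setP => c; have cn := ltn_ord c.
rewrite mem_muhat; apply/idP/setofP.
  move=> /orP[/existsP[t]|].
    have [s sk E] := H2 t (ltn_ord t); have := H4 s sk; have := ltn_ord t => tk fn.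
    by case/eqn_modP => [||E'|E']; try (exists s => //); lia.
  have [s sk E] := H3; have := H4 s sk => fn.
  by case/eqn_modP => [||E'|E']; try (exists s => //); lia.
move=> [s sk E]; have [[t tk h]|h] := H1 s sk.
  apply/orP; left; apply/existsP; exists (Ordinal tk).
  by apply/eqn_modP; rewrite /=; lia.
by apply/orP; right; apply/eqn_modP; lia.
Qed.

Lemma muhat_row i : (1 <= i < m)%N -> muhat n k i = setof n k (lasthat k (addn^~ i)).
Proof.
move=> hi; apply: muhat_of; first lia.
- move=> s sk; rewrite /lasthat; case: eqP => E; first by right; lia.
  by left; exists s; lia.
- by move=> t tk; exists t; [lia | rewrite /lasthat; case: eqP; lia].
- by exists k.-1; [lia | rewrite /lasthat; case: eqP; lia].
- by move=> s sk; rewrite /lasthat; case: eqP; lia.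
Qed.

(** The extra index wraps around to the first position, which removes a row and a column from the
    full rectangle. This is the term that carries [q]. *)
Lemma muhat_rect : muhat n k m = setof n k (rectf k m.-1 k.-1).
Proof.
apply: muhat_of; first lia.
- move=> s sk; rewrite /rectf; case: ifP => E; first by right; lia.
  by left; exists s.-1; lia.
- by move=> t tk; exists t.+1; [lia | rewrite /rectf; case: ifP; lia].
- by exists 0%N; [lia | rewrite /rectf; case: ifP; lia].
- by move=> s sk; rewrite /rectf; case: ifP; lia.
Qed.

Lemma muhat_col j : (1 <= j < k)%N -> muhat n k (n - j) = setof n k (hatc k m j).
Proof.
move=> hj; apply: muhat_of; first lia.
- move=> s sk; rewrite /hatc; case: ifP => E; first by left; exists (s + j)%N; lia.
  by case: ifP => E'; [right; lia | left; exists (s + j - k)%N; lia].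
- move=> t tk; case: (ltnP t j) => tj.
    by exists (t + k - j)%N; [lia | rewrite /hatc; do ?case: ifP; lia].
  by exists (t - j)%N; [lia | rewrite /hatc; do ?case: ifP; lia].
- by exists (k - j.+1)%N; [lia | rewrite /hatc; do ?case: ifP; lia].
- by move=> s sk; rewrite /hatc; do ?case: ifP; lia.
Qed.

Lemma muhat_box : muhat n k n = setof n k (lasthat k id).
Proof.
apply: muhat_of; first lia.
- move=> s sk; rewrite /lasthat; case: eqP => E; first by right; lia.
  by left; exists s; lia.
- by move=> t tk; exists t; [lia | rewrite /lasthat; case: eqP; lia].
- by exists k.-1; [lia | rewrite /lasthat; case: eqP; lia].
- by move=> s sk; rewrite /lasthat; case: eqP; lia.
Qed.

End MuSets.

Section Embedding.
Variables (R : realType) (n k : nat).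
Hypothesis hk : (1 <= k <= n - 1)%N.
Local Notation C := (Cx R).
Local Notation m := (n - k)%N.

(* The value 1 outside the range keeps all coordinates nonzero. *)
Definition znat (z : 'M[C]_(m, k)) (i j : nat) : C :=
  if insub i is Some a then if insub j is Some b then z a b else 1 else 1.

Lemma znatE z (i : 'I_m) (j : 'I_k) : znat z i j = z i j.
Proof. by rewrite /znat !valK. Qed.

Lemma nonvan_znat z : torus z -> nonvan (znat z).
Proof.
move=> tz i j; rewrite /znat; case: (insub i) => [a|]; last exact: oner_neq0.
by case: (insub j) => [b|]; [exact: tz | exact: oner_neq0].
Qed.

Definition embed (z : 'M[C]_(m, k)) : 'M[C]_(k, n) :=
  \matrix_(r < k, c < n) acol k (znat z) r c.

Lemma minor_embed z f : increasing n k f ->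
  minor (setof n k f) (embed z) = pluck k (znat z) f.
Proof. by move=> fi; rewrite (minor_setof _ fi). Qed.

Lemma minor_mu_embed z i : torus z -> (1 <= i <= n)%N ->
  minor (mu n k i) (embed z) = rectprod (znat z) (minn i m) (minn k (n - i)).
Proof.
move=> tz hi; rewrite (mu_rect hk hi) minor_embed.
  by rewrite pluck_rect ?geq_minl //; exact: nonvan_znat.
by apply: increasing_rect; rewrite ?geq_minl ?geq_minr.
Qed.

Lemma minor_empty_embed z : minor (Jempty n k) (embed z) = 1.
Proof.
rewrite (Jempty_rect hk) minor_embed; last exact: increasing_rect.
by rewrite -(pluck_id k (znat z)); apply: eq_pluck => s sk; rewrite /rectf subn0 sk.
Qed.

Lemma mirror_embed z : torus z -> mirror (embed z).
Proof.
move=> tz; split=> [|i hi].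
  apply: (@rank_minor _ _ _ (Jempty n k)); last by rewrite minor_empty_embed oner_neq0.
  by rewrite (Jempty_rect hk) card_setof //; exact: increasing_rect.
by rewrite minor_mu_embed // rectprod_neq0 //; exact: nonvan_znat.
Qed.

Section Superpotential.
Variables (q : C) (z : 'M[C]_(m, k)).
Hypothesis tz : torus z.
Local Notation Z := (zz (znat z)).
Let nv := nonvan_znat tz.

Let term i := minor (muhat n k i) (embed z) / minor (mu n k i) (embed z).

Lemma term_row i : (1 <= i < m)%N -> term i = \sum_(j < k) Z i.+1 j / Z i j.
Proof.
move=> hi; have [k' kE] : exists k', k = k'.+1 by exists k.-1; lia.
have E1 : minor (mu n k i) (embed z) = pluck k (znat z) (addn^~ i).
  rewrite mu_rect //; last by lia.
  rewrite minor_embed; last by apply: increasing_rect; lia.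
  by apply: eq_pluck => s sk; rewrite /rectf; case: ifP; lia.
have inz : pluck k (znat z) (addn^~ i) != 0.
  by rewrite -E1 minor_mu_embed ?rectprod_neq0 //; lia.
rewrite /term E1 muhat_row // minor_embed; last first.
  by split=> [s t|s] h; rewrite /lasthat; do ?case: eqP; lia.
by rewrite [in LHS]kE pluck_row_hat -?kE //; [rewrite mulrC mulKf | lia].
Qed.

Lemma term_rect : term m = (Z m k.-1)^-1.
Proof.
have E1 : minor (mu n k m) (embed z) = rectprod (znat z) m k.
  by rewrite minor_mu_embed //; [congr rectprod; lia | lia].
have [k' kE] : exists k', k = k'.+1 by exists k.-1; lia.
rewrite /term E1 muhat_rect // minor_embed; last by apply: increasing_rect; lia.
rewrite pluck_rect //; last by lia.
have -> : rectprod (znat z) m k = rectprod (znat z) m.-1 k.-1 * Z m k.-1.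
  rewrite /rectprod [in LHS]kE big_ord_recr /= kE /= subnn subn0; congr (_ * _).
  by apply: eq_bigr => l _; congr (Z _ _); have := ltn_ord l; lia.
by rewrite invfM mulrA divff ?mul1r // rectprod_neq0.
Qed.

Lemma term_col j : (1 <= j < k)%N ->
  term (n - j) = \sum_(l < m) Z l.+1 j / Z l.+1 j.-1.
Proof.
move=> hj; rewrite /term muhat_col // minor_embed; last first.
  by split=> [s t|s] h; rewrite /hatc; do ?case: ifP; lia.
rewrite mu_rect //; last by lia.
have -> : minn (n - j) m = m by lia.
have -> : minn k (n - (n - j)) = j by lia.
rewrite minor_embed; last by apply: increasing_rect; lia.
rewrite pluck_col_hat //; last by lia.
by rewrite mulrC mulKf // pluck_rect ?rectprod_neq0 //; lia.
Qed.

Lemma term_box : term n = Z 1 0.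
Proof.
have [k' kE] : exists k', k = k'.+1 by exists k.-1; lia.
rewrite /term muhat_box // minor_embed; last first.
  by split=> [s t|s] h; rewrite /lasthat; do ?case: eqP; lia.
rewrite minor_mu_embed //; last by lia.
rewrite subnn minn0 /rectprod big_ord0 divr1.
by rewrite [in LHS]kE pluck_box.
Qed.

Lemma superpotential_embed : superpotential q (embed z) =
  \sum_(1 <= i < m) \sum_(j < k) Z i.+1 j / Z i j + q / Z m k.-1 +
  \sum_(1 <= j < k) \sum_(l < m) Z l.+1 j / Z l.+1 j.-1 + Z 1 0.
Proof.
rewrite /superpotential (@big_cat_nat _ _ _ m) /=; [|lia|lia].
rewrite -addrA -!addrA; congr (_ + _).
  rewrite !big_nat; apply: eq_bigr => i hi.
  by rewrite ltn_eqF ?mulr1; [exact: term_row | lia].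
rewrite big_ltn; last by lia.
rewrite eqxx expr1 -/(term m) term_rect mulrC; congr (_ + _).
rewrite big_nat_recr; last by lia.
rewrite /= gtn_eqF ?mulr1; last by lia.
rewrite -/(term n) term_box; congr (_ + _).
(* The terms strictly between [n - k] and [n] are listed by [j = n - i], hence the reversal of the
   sum. *)
rewrite -[m.+1]add1n big_addn (_ : n - m = k)%N; last by lia.
rewrite big_nat_rev /= !big_nat; apply: eq_bigr => j hj.
have -> : (1 + k - j.+1 + m = n - j)%N by lia.
by rewrite gtn_eqF ?mulr1; [exact: term_col | lia].
Qed.

Lemma sum_pick2 (F : nat -> nat -> C) (i0 j0 a b : nat) :
  \sum_(p : 'I_a * 'I_b) (if (p.1 == i0 :> nat) && (p.2 == j0 :> nat) then F p.1 p.2 else 0)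
  = if (i0 < a)%N && (j0 < b)%N then F i0 j0 else 0.
Proof.
case: ifP => [/andP[ia jb]|h].
  rewrite (bigD1 (Ordinal ia, Ordinal jb)) //= !eqxx big1 ?addr0 // => -[i j] /= ne.
  by case: ifP => // /andP[/eqP ei /eqP ej]; case/eqP: ne; congr pair; exact: val_inj.
rewrite big1 // => -[i j] _ /=; case: ifP => // /andP[/eqP ei /eqP ej].
by rewrite -ei -ej !ltn_ord in h.
Qed.

Lemma sum_shift (H : nat -> C) (a : nat) : (0 < a)%N ->
  \sum_(i < a) (if (i.+1 < a)%N then H i.+1 else 0) = \sum_(1 <= i < a) H i.
Proof.
case: a => // a _; rewrite big_ord_recr /= ltnn addr0 big_add1 big_mkord.
by apply: eq_bigr => i _; rewrite ltnS ltn_ord.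
Qed.

(** Arrows are sorted by tail: the vertex (0,1) gives [Z 1 0], the vertex carrying [q] has no
    outgoing arrow, and any other vertex has at most a right neighbour, a lower neighbour and the
    vertex carrying [q]. *)
Lemma laurent_embed : laurent q z =
  \sum_(1 <= i < m) \sum_(j < k) Z i.+1 j / Z i j + q / Z m k.-1 +
  \sum_(1 <= j < k) \sum_(l < m) Z l.+1 j / Z l.+1 j.-1 + Z 1 0.
Proof.
have m0 : (0 < m)%N by lia.
have k0 : (0 < k)%N by lia.
pose G (v w : vertex n k) : C := if arrow v w then zval q z w / zval q z v else 0.
have -> : laurent q z = \sum_v \sum_w G v w.
  by rewrite /laurent big_mkcond /= pair_bigA.
have arrowE (v w : vertex n k) : arrow v w =
  ((vpos w).1 == (vpos v).1) && ((vpos w).2 == (vpos v).2.+1) ||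
  ((vpos w).1 == (vpos v).1.+1) && ((vpos w).2 == (vpos v).2) by [].
have zE (p : 'I_m * 'I_k) : z p.1 p.2 = Z p.1.+1 p.2 by rewrite /= znatE.
rewrite big_sumType /= !big_bool /=.
have -> : \sum_w G (inr true) w = 0.
  apply: big1 => w _; rewrite /G arrowE; case: ifP => // h; move: h.
  by case: w => [[i j]|[|]] /=; try (have := ltn_ord i; have := ltn_ord j); lia.
have -> : \sum_w G (inr false) w = Z 1 0.
  have G0 b : G (inr false) (inr b) = 0.
    by rewrite /G arrowE; case: ifP => // h; move: h; case: b => /=; lia.
  rewrite big_sumType /= !big_bool /= !G0 !addr0.
  rewrite -[RHS](_ : (if (0 < m)%N && (0 < k)%N then Z 0.+1 0%N else 0) = _); last by rewrite m0 k0.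
  rewrite -(sum_pick2 (fun i j => Z i.+1 j)); apply: eq_bigr => p _.
  rewrite /G arrowE /=; case: p => i j /=; rewrite divr1 znatE.
  by congr (if _ then _ else _); lia.
rewrite add0r; congr (_ + _).
have inlE (i : 'I_m) (j : 'I_k) : \sum_w G (inl (i, j)) w =
   (if (i < m)%N && (j.+1 < k)%N then Z i.+1 j.+1 / Z i.+1 j else 0) +
   (if (i.+1 < m)%N && (j < k)%N then Z i.+2 j / Z i.+1 j else 0) +
   (if (i.+1 == m) && (j.+1 == k) then q / Z m k.-1 else 0).
  rewrite big_sumType /= big_bool /=; congr (_ + _).
    rewrite -(sum_pick2 (fun i' j' => Z i'.+1 j' / Z i.+1 j)).
    rewrite -(sum_pick2 (fun i' j' => Z i'.+1 j' / Z i.+1 j)) -big_split /=.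
    apply: eq_bigr => -[i' j'] _; rewrite /G arrowE /= !znatE.
    do ![case: ifP]; rewrite ?addr0 ?add0r //; lia.
  have -> : G (inl (i, j)) (inr false) = 0.
    by rewrite /G (_ : arrow _ _ = false) // arrowE /=; lia.
  have := ltn_ord i; have := ltn_ord j => ji ii.
  rewrite addr0 /G (_ : arrow _ _ = (i.+1 == m) && (j.+1 == k)); last by rewrite arrowE /=; lia.
  case: ifP => // /andP[/eqP im /eqP jk].
  have -> : Z m k.-1 = Z i.+1 j by congr (Z _ _); lia.
  by rewrite /= znatE.
transitivity (\sum_(i < m) \sum_(j < k)
   ((if (j.+1 < k)%N then Z i.+1 j.+1 / Z i.+1 j else 0) +
    (if (i.+1 < m)%N then Z i.+2 j / Z i.+1 j else 0) +
    (if (i.+1 == m) && (j.+1 == k) then q / Z m k.-1 else 0))).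
  rewrite [RHS]pair_bigA; apply: eq_bigr => -[i j] _; rewrite inlE /=.
  by rewrite !ltn_ord andbT.
have split3 (X Y W : 'I_m -> 'I_k -> C) :
    \sum_i \sum_j (X i j + Y i j + W i j) =
    \sum_i \sum_j X i j + \sum_i \sum_j Y i j + \sum_i \sum_j W i j.
  by rewrite -!big_split; apply: eq_bigr => i _; rewrite -!big_split.
rewrite split3 [X in _ + X](_ : _ = q / Z m k.-1); last first.
  have := sum_pick2 (fun _ _ => q / Z m k.-1) m.-1 k.-1 m k.
  rewrite !ltn_predL m0 k0 /= => E; rewrite -[RHS]E pair_bigA; apply: eq_bigr => -[i j] _ /=.
  by congr (if _ then _ else _); lia.
rewrite -[LHS]addrA [LHS]addrC; congr (_ + _ + _).
  rewrite -(sum_shift (fun i => \sum_(j < k) Z i.+1 j / Z i j) m0).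
  by apply: eq_bigr => i _; case: ifP => // _; rewrite big1.
rewrite [LHS]exchange_big /=.
rewrite -(sum_shift (fun j => \sum_(l < m) Z l.+1 j / Z l.+1 j.-1) k0).
by apply: eq_bigr => j _; case: ifP => // _; rewrite big1.
Qed.

Lemma superpotential_laurent : superpotential q (embed z) = laurent q z.
Proof. by rewrite superpotential_embed laurent_embed. Qed.

End Superpotential.
End Embedding.

(** * The open embedding *)

Section Regular.
Variables (K : fieldType) (X : Type) (m : nat) (x : X -> 'I_m -> K) (U : set X).
Local Notation reg := (regular_fun x U).

Lemma regular_ext f g : (forall a, U a -> f a = g a) -> reg f -> reg g.
Proof.
move=> fg rf a Ua; have [P [Q [Q0 h]]] := rf a Ua.
by exists P, Q; split=> // b Ub Qb; rewrite -fg ?h.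
Qed.

Lemma regular_const c : reg (fun=> c).
Proof.
move=> a Ua; exists (mpoly.mpolyC m c), (mpoly.mpolyC m 1); rewrite mpoly.mevalC oner_neq0.
by split=> // b Ub _; rewrite !mpoly.mevalC divr1.
Qed.

Lemma regular_coord l : reg (fun a => x a l).
Proof.
move=> a Ua; exists (mpoly.mpolyX K (mpoly.mnm1 l)), (mpoly.mpolyC m 1); rewrite mpoly.mevalC oner_neq0.
by split=> // b Ub _; rewrite mpoly.mevalC mpoly.mevalXU divr1.
Qed.

Lemma regularM f g : reg f -> reg g -> reg (fun a => f a * g a).
Proof.
move=> rf rg a Ua; have [P [Q [Q0 h]]] := rf a Ua; have [P' [Q' [Q0' h']]] := rg a Ua.
exists (P * P'), (Q * Q'); rewrite rmorphM mulf_neq0 //; split=> // b Ub.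
rewrite rmorphM mulf_eq0 negb_or => /andP[q q'].
by rewrite h // h' // rmorphM invfM mulrACA.
Qed.

Lemma regularD f g : reg f -> reg g -> reg (fun a => f a + g a).
Proof.
move=> rf rg a Ua; have [P [Q [Q0 h]]] := rf a Ua; have [P' [Q' [Q0' h']]] := rg a Ua.
exists (P * Q' + P' * Q), (Q * Q'); rewrite rmorphM mulf_neq0 //; split=> // b Ub.
rewrite rmorphM mulf_eq0 negb_or => /andP[q q'].
by rewrite h // h' // rmorphD !rmorphM /= addf_div.
Qed.

Lemma regularN f : reg f -> reg (fun a => - f a).
Proof.
move=> rf; apply: (@regular_ext (fun a => -1 * f a)); first by move=> a _; rewrite mulN1r.
by apply: regularM => //; exact: regular_const.
Qed.

Lemma regularV f : (forall a, U a -> f a != 0) -> reg f -> reg (fun a => (f a)^-1).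
Proof.
move=> f0 rf a Ua; have [P [Q [Q0 h]]] := rf a Ua.
have P0 : mpoly.meval (x a) P != 0.
  by apply: contraNneq (f0 a Ua) => P0; rewrite h // P0 mul0r.
(* The fraction is not reduced: the formula for [f] holds only where [Q] is nonzero, so [Q] must
   stay in the denominator. *)
exists (Q * Q), (P * Q); rewrite rmorphM mulf_neq0 //; split=> // b Ub.
rewrite rmorphM mulf_eq0 negb_or => /andP[p q].
by rewrite h // rmorphM /= invf_div -mulf_div divff // mulr1.
Qed.

Lemma regular_sum I (r : seq I) (P : pred I) (f : I -> X -> K) :
  (forall i, reg (f i)) -> reg (fun a => \sum_(i <- r | P i) f i a).
Proof.
move=> rf; elim: r => [|i r IH].
  by apply: (@regular_ext (fun=> 0)) => [a _|]; [rewrite big_nil | exact: regular_const].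
apply: (@regular_ext (fun a => (if P i then f i a else 0) + \sum_(i <- r | P i) f i a)).
  by move=> a _; rewrite big_cons; case: (P i); rewrite ?add0r.
by apply: regularD => //; case: (P i) => //; exact: regular_const.
Qed.

Lemma regular_prod I (r : seq I) (P : pred I) (f : I -> X -> K) :
  (forall i, reg (f i)) -> reg (fun a => \prod_(i <- r | P i) f i a).
Proof.
move=> rf; elim: r => [|i r IH].
  by apply: (@regular_ext (fun=> 1)) => [a _|]; [rewrite big_nil | exact: regular_const].
apply: (@regular_ext (fun a => (if P i then f i a else 1) * \prod_(i <- r | P i) f i a)).
  by move=> a _; rewrite big_cons; case: (P i); rewrite ?mul1r.
by apply: regularM => //; case: (P i) => //; exact: regular_const.
Qed.

Lemma regular_det p (f : 'I_p -> 'I_p -> X -> K) :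
  (forall i j, reg (f i j)) -> reg (fun a => \det (\matrix_(i, j) f i j a)).
Proof.
move=> rf; apply: (@regular_ext
  (fun a => \sum_(s : {perm 'I_p}) (-1) ^+ s * \prod_i f i (s i) a)).
  by move=> a _; apply: eq_bigr => s _; congr (_ * _); apply: eq_bigr => i _; rewrite mxE.
apply: regular_sum => s; apply: regularM; first exact: regular_const.
exact: regular_prod.
Qed.

Lemma regular_acol (z : X -> nat -> nat -> K) k r c :
  (forall i j, reg (fun a => z a i j)) -> (forall a i j, U a -> z a i j != 0) ->
  reg (fun a => acol k (z a) r c).
Proof.
elim: k z c => [|k IH] z c rz nz; first exact: regular_const.
have rb c' : reg (fun a => acol k (zshift (z a)) r c').
  by apply: (IH (fun a => zshift (z a))) => [i j|a i j]; [exact: rz | exact: nz].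
have rzz i : reg (fun a => zz (z a) i 0).
  by case: i => [|i]; [exact: regular_const | exact: rz].
have [ck|kc] := ltnP c k.
  by apply: (@regular_ext (fun a => acol k (zshift (z a)) r c)) => // a _; rewrite acol_lt.
rewrite -(subnKC kc); elim: (c - k)%N => [|i IHi].
  apply: (@regular_ext (fun=> (r == k)%:R)); last exact: regular_const.
  by move=> a _; rewrite addn0 acol_eq.
apply: (@regular_ext (fun a => zz (z a) i.+1 0 / zz (z a) i 0 * acol k.+1 (z a) r (k + i)
   + - acol k (zshift (z a)) r (k + i))).
  by move=> a _; rewrite acol_step.
apply: regularD; last exact: regularN.
apply: regularM => //; apply: regularM => //; apply: regularV => // a Ua.
by case: i {IHi} => [|i]; [exact: oner_neq0 | exact: nz].
Qed.

End Regular.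

Lemma rectprodSS (F : fieldType) (z : nat -> nat -> F) i j :
  rectprod z i.+1 j.+1 = rectprod z i j * zz z i.+1 j.
Proof.
rewrite /rectprod big_ord_recr /= subnn subn0; congr (_ * _).
by apply: eq_bigr => l _; congr (zz z _ _); have := ltn_ord l; lia.
Qed.

Lemma acol_depP (F : fieldType) K (z z2 : nat -> nat -> F) r c :
  (K <= c)%N ->
  (forall i' j', (i' <= c - K)%N -> (j' + r < K)%N -> z i' j' = z2 i' j') ->
  acol K z r c = acol K z2 r c.
Proof.
case: K => // K Kc zE; have -> : (c = K + (c - K))%N by lia.
by apply: acol_dep => i' j' h1 h2; apply: zE; lia.
Qed.

Lemma eset_setof n k f (J : {set 'I_n}) (cJ : #|J| = k) (l : 'I_k) :
  increasing n k f -> J = setof n k f -> eset cJ l = f l :> nat.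
Proof.
move=> fi E; subst J; rewrite -(nth_enum_eset cJ (eset cJ l)).
rewrite -(nth_map _ 0%N) -?cardE ?cJ // enum_setof //.
by rewrite (nth_map 0%N) ?size_iota // nth_iota.
Qed.

Section OpenEmbedding.
Variables (R : realType) (n k : nat).
Hypothesis hk : (1 <= k <= n - 1)%N.
Local Notation C := (Cx R).
Local Notation m := (n - k)%N.
Local Notation iota := (@embed R n k).
Local Notation nk := #|[set J : {set 'I_n} | #|J| == k]%SET|.
Local Notation rset i j := (setof n k (rectf k i j)).

Lemma card_rset i j : (i <= m)%N -> (j <= k)%N -> #|rset i j| = k.
Proof. by move=> im jk; apply: card_setof; exact: increasing_rect. Qed.

Lemma card_Jempty : #|Jempty n k| = k.
Proof. by rewrite (Jempty_rect hk) card_rset. Qed.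

Lemma plcoord_index (J : {set 'I_n}) : #|J| = k ->
  exists l : 'I_nk, forall A : 'M[C]_(k, n), plcoord A l = minor J A / minor (Jempty n k) A.
Proof.
move=> cJ; have Jin : J \in [set J : {set 'I_n} | #|J| == k]%SET by rewrite inE cJ.
by exists (enum_rank_in Jin J) => A; rewrite /plcoord enum_rankK_in.
Qed.

Lemma minor_embed_rect z i j : torus z -> (i <= m)%N -> (j <= k)%N ->
  minor (rset i j) (iota z) = rectprod (znat z) i j.
Proof.
move=> tz im jk; rewrite minor_embed; last exact: increasing_rect.
by rewrite pluck_rect //; exact: nonvan_znat.
Qed.

Lemma embed_minors z (A : 'M[C]_(k, n)) : (A == iota z)%MS ->
  exists2 d : C, d != 0 & forall J, minor J A = d * minor J (iota z).
Proof.
move=> /eqmxMunitP [M Mu ->]; exists (\det M); first by rewrite -unitfE -unitmxE.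
by move=> J; rewrite minor_mulmx.
Qed.

(** The empty diagram is [mu_n]. *)
Lemma minor_empty_neq0 (A : 'M[C]_(k, n)) : mirror A -> minor (Jempty n k) A != 0.
Proof.
move=> [_ /(_ n)]; have E : mu n k n = Jempty n k.
  rewrite (mu_rect hk) ?(Jempty_rect hk); last by lia.
  apply/setP => c; apply/setofP/setofP => -[s sk E]; exists s => //; move: E;
  by rewrite /rectf; do ?case: ifP; lia.
by rewrite E; apply; lia.
Qed.

(** The representative is normalised to have the identity in its first [k] columns, as [acol_surj]
    requires. *)
Lemma embed_surj (A : 'M[C]_(k, n)) : mirror A ->
  (forall i j, (i <= m)%N -> (j <= k)%N -> minor (rset i j) A != 0) ->
  exists2 z, torus z & (A == iota z)%MS.
Proof.
move=> mA nz; have A0 := minor_empty_neq0 mA.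
have AE := chart_coordK card_Jempty A0.
set M := cols _ _ _ in AE; set B := chart_coord _ A in AE.
have Mu : M \in unitmx by rewrite -minor_unit.
pose A1 := chart (Jempty n k) B.
pose G r c : C := if insub r is Some a then if insub c is Some b then A1 a b else 0 else 0.
have GE (a : 'I_k) (b : 'I_n) : G a b = A1 a b by rewrite /G !valK.
have A1E : A1 = \matrix_(r < k, c < n) G r c by apply/matrixP => r c; rewrite mxE GE.
have [z nvz zE] : exists2 z, nonvan z &
    forall r c, (r < k)%N -> (c < k + m)%N -> G r c = acol k z r c.
  apply: acol_surj => [r c rk ck|i j im jk].
    have cn : (c < n)%N by lia.
    rewrite -[r]/(val (Ordinal rk)) -[c in G _ c]/(val (Ordinal cn)) GE /A1.
    have cin : Ordinal cn \in Jempty n k by rewrite inE.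
    have [l lE] := esetP card_Jempty cin.
    have cE : c = eset card_Jempty l :> nat := congr1 val lE.
    rewrite lE chartE_in; congr (_%:R).
    have idx : eset card_Jempty l = l :> nat.
      rewrite (eset_setof card_Jempty _ _ (Jempty_rect hk)); last exact: increasing_rect.
      by rewrite /rectf subn0 ltn_ord.
    by rewrite -val_eqE /= cE idx.
  have := nz i j im jk; rewrite AE minor_mulmx mulf_eq0 negb_or => /andP[_].
  by rewrite -/A1 A1E minor_setof //; exact: increasing_rect.
pose zm : 'M[C]_(m, k) := \matrix_(i, j) z i j.
have tz : torus zm by move=> i j; rewrite mxE.
exists zm => //; apply/eqmxMunitP; exists M => //; rewrite [LHS]AE; congr (_ *m _).
rewrite -/A1 A1E; apply/matrixP => r c; rewrite !mxE zE //; last by have := ltn_ord c; lia.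
(* The array from [acol_surj] is cut down to its range; by [acol_depP] the columns below [n] do not
   see the rest. *)
have dep i j : (i < m)%N -> (j < k)%N -> z i j = znat zm i j.
  by move=> im jk; rewrite (znatE zm (Ordinal im) (Ordinal jk)) mxE.
have [ck|kc] := ltnP c k; first by rewrite !acol_id.
by have cn := ltn_ord c; apply: acol_depP => // i j h1 h2; apply: dep; lia.
Qed.

Definition embed_inv (A : 'M[C]_(k, n)) : 'M[C]_(m, k) :=
  \matrix_(i, j) (minor (rset i.+1 j.+1) A / minor (rset i j) A).

Lemma embed_invK A z : torus z -> (A == iota z)%MS -> embed_inv A = z.
Proof.
move=> tz /embed_minors [d d0 dE]; apply/matrixP => i j; rewrite mxE !dE.
have im := ltn_ord i; have jk := ltn_ord j.
rewrite !minor_embed_rect ?(ltnW im) ?(ltnW jk) // rectprodSS.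
have r0 := rectprod_neq0 i j (nonvan_znat tz).
by rewrite mulrA mulrAC divff ?mul1r ?mulf_neq0 // -znatE.
Qed.

Lemma minor_rset_image A i j : (i <= m)%N -> (j <= k)%N ->
  image_pts iota A -> minor (rset i j) A != 0.
Proof.
move=> im jk [_ [z tz /embed_minors [d d0 ->]]].
by rewrite mulf_neq0 // minor_embed_rect // rectprod_neq0 //; exact: nonvan_znat.
Qed.

Theorem embed_open : open_embedding iota.
Proof.
split.
- by move=> z tz; exact: mirror_embed.
- move=> l.
  apply: (@regular_ext _ _ _ _ _ (fun z => minor (enum_val l) (iota z))).
    by move=> z tz; rewrite /plcoord minor_empty_embed // divr1.
  apply: (@regular_det _ _ _ _ _ k (fun i j z => nth 0 [seq iota z i c | c <- enum (enum_val l)] j)).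
  move=> i j.
  have [jJ|Jj] := ltnP j (size (enum (enum_val l))); last first.
    apply: (@regular_ext _ _ _ _ _ (fun=> 0)); last exact: regular_const.
    by move=> z _; rewrite nth_default ?size_map.
  have c0 : 'I_n by move: jJ; rewrite -cardE => jJ; exact: (enum_val (Ordinal jJ)).
  set c := nth c0 (enum (enum_val l)) j.
  apply: (@regular_ext _ _ _ _ _ (fun z => acol k (znat z) i c)).
    by move=> z _; rewrite (nth_map c0) // mxE.
  apply: regular_acol; last by move=> z a b tz; exact: nonvan_znat.
  move=> a b; rewrite /znat; case: (insub a) => [a'|]; last exact: regular_const.
  case: (insub b) => [b'|]; last exact: regular_const.
  apply: (@regular_ext _ _ _ _ _ (fun z => torus_coord z (mxvec_index a' b'))).
    by move=> z _; rewrite /torus_coord mxvecE.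
  exact: regular_coord.
- have ex (p : 'I_m * 'I_k) : exists l : 'I_nk, forall A : 'M[C]_(k, n),
      plcoord A l = minor (rset p.1.+1 p.2.+1) A / minor (Jempty n k) A.
    by apply: plcoord_index; apply: card_rset.
  have [li liE] := choice ex.
  (* One polynomial cuts out the complement of the image: the product of the coordinates of all
     nonempty rectangles. *)
  pose P := \prod_(p : 'I_m * 'I_k) (mpoly.mpolyX C (mpoly.mnm1 (li p))).
  have PE A : mpoly.meval (plcoord A) P =
      \prod_(p : 'I_m * 'I_k) (minor (rset p.1.+1 p.2.+1) A / minor (Jempty n k) A).
    by rewrite rmorph_prod; apply: eq_bigr => p _; rewrite -liE; exact: mpoly.mevalXU.
  exists [set P]%classic; apply/seteqP; split=> A /=.
    move=> Ai; have [mA _] := Ai; split=> //; exists P => //; rewrite PE.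
    apply/prodf_neq0 => p _; rewrite mulf_neq0 ?invr_neq0 ?minor_empty_neq0 //.
    exact: minor_rset_image.
  move=> [mA [_ -> ]]; rewrite PE => /prodf_neq0 h; split=> //.
  (* A rectangle with a side of length 0 is the empty diagram. *)
  apply: embed_surj => // -[|i] [|j] im jk; try
    (rewrite (_ : rset _ _ = Jempty n k) ?minor_empty_neq0 // (Jempty_rect hk);
     apply/setP => c; apply/setofP/setofP => -[s sk E]; exists s => //; move: E;
     by rewrite /rectf; do ?case: ifP; lia).
  by have := h (Ordinal im, Ordinal jk) isT; rewrite /= mulf_eq0 negb_or => /andP[].
- exists embed_inv; split=> [A z|l]; first exact: embed_invK.
  case/mxvec_indexP: l => i j.
  have [l1 l1E] := plcoord_index (card_rset (ltn_ord i) (ltn_ord j)).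
  have [l2 l2E] := plcoord_index (card_rset (ltnW (ltn_ord i)) (ltnW (ltn_ord j))).
  apply: (@regular_ext _ _ _ _ _ (fun A => plcoord A l1 * (plcoord A l2)^-1)).
    move=> A Ai; have [mA _] := Ai.
    rewrite /torus_coord mxvecE mxE l1E l2E invf_div mulrA divfK ?minor_empty_neq0 //.
  apply: regularM; first exact: regular_coord.
  apply: regularV; last exact: regular_coord.
  move=> A Ai; have [mA _] := Ai; rewrite l2E mulf_neq0 ?invr_neq0 ?minor_empty_neq0 //.
  by apply: minor_rset_image => //; exact: ltnW.
Qed.

End OpenEmbedding.

(** * The volume form on the torus *)

Section MoreNetwork.
Variable F : fieldType.

(** The pivotal coordinate first appears in the last row of one of the smaller matrices, where by
    [acol_last] it is the entry itself. Each step from there up to the full matrix contributes one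
    factor -1. *)
Lemma acol_affine K (z z2 : nat -> nat -> F) r i (h : F) : nonvan z -> (r <= K)%N ->
  (forall i' j', (i' <= i)%N -> (j' + r <= K)%N -> (i', j') != (i, K - r)%N ->
     z2 i' j' = z i' j') ->
  z2 i (K - r)%N = z i (K - r)%N + h ->
  acol K.+1 z2 r (K + i.+1) = acol K.+1 z r (K + i.+1) + (-1) ^+ (K - r) * h.
Proof.
have dep K' (y y2 : nat -> nat -> F) : (r <= K')%N ->
    (forall i' j', (i' <= i)%N -> (j' + r <= K')%N -> (i', j') != (i, K' - r)%N ->
       y2 i' j' = y i' j') ->
    acol K'.+1 y2 r (K' + i) = acol K'.+1 y r (K' + i) /\ zz y2 i 0 = zz y i 0.
  move=> rK' yE; split.
    by apply: acol_dep => i' j' ii jr; apply: yE => //; [exact: ltnW | rewrite xpair_eqE ltn_eqF].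
  by case: i yE => // i0 yE; apply: yE => //; rewrite xpair_eqE ltn_eqF.
elim: K z z2 => [|K IH] z z2 nz rK zE zh; rewrite !acol_step.
  have r0 : r = 0%N by lia.
  have [-> ->] := dep _ _ _ rK zE.
  have := zh; rewrite r0 subnn -[z2 i 0%N]/(zz z2 i.+1 0) -[z i 0%N]/(zz z i.+1 0) => ->.
  have -> := acol_last 0 i nz.
  by rewrite /= expr0 mul1r !subr0 !divfK ?zz_neq0.
have [-> ->] := dep _ _ _ rK zE.
have [rK'|Kr] := leqP r K; last first.
  have rE : r = K.+1 by lia.
  have := zh; rewrite rE subnn -[z2 i 0%N]/(zz z2 i.+1 0) -[z i 0%N]/(zz z i.+1 0) => ->.
  by rewrite acol_last // !acol_high // expr0 mul1r !subr0 !divfK ?zz_neq0.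
have -> : zz z2 i.+1 0 = zz z i.+1 0.
  by apply: zE => //; rewrite xpair_eqE; lia.
rewrite !addSnnS (IH (zshift z) (zshift z2) (nonvan_shift nz) rK') //.
- by rewrite subSn // exprS mulN1r mulNr opprD addrA.
- by move=> i' j' ii jr ne; apply: zE => //; move: ne; rewrite !xpair_eqE; lia.
- by rewrite /zshift -subSn.
Qed.

Lemma acol_affineP K (z z2 : nat -> nat -> F) r i (h : F) : nonvan z -> (r < K)%N ->
  (forall i' j', (i' <= i)%N -> (j' + r < K)%N -> (i', j') != (i, K - r.+1)%N ->
     z2 i' j' = z i' j') ->
  z2 i (K - r.+1)%N = z i (K - r.+1)%N + h ->
  acol K z2 r (K + i) = acol K z r (K + i) + (-1) ^+ (K - r.+1) * h.
Proof. by case: K => // K nz rK zE zh; rewrite addSnnS; exact: acol_affine. Qed.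

(** The corners of these rectangles are the boxes of the right and the bottom border, and the
    diagonals ending there partition all boxes. *)
Lemma rectprod_border (z : nat -> nat -> F) m k :
  \prod_(1 <= i < m.+1) rectprod z i k * \prod_(1 <= j < k) rectprod z m j =
  \prod_(i < m) \prod_(j < k) z i j.
Proof.
elim: k => [|k IH].
  rewrite [X in _ * X]big_geq // mulr1 !big1 // => i _; first by rewrite big_ord0.
  by rewrite /rectprod big_ord0.
have rp0 j : rectprod z 0 j = 1 by rewrite /rectprod big1.
have rpi i : rectprod z i 0 = 1 by rewrite /rectprod big_ord0.
have -> : \prod_(1 <= i < m.+1) rectprod z i k.+1 =
    \prod_(0 <= i < m) rectprod z i k * \prod_(i < m) z i k.
  rewrite big_add1 /= !big_mkord -big_split /=.
  by apply: eq_bigr => i _; rewrite rectprodSS.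
under [RHS]eq_bigr do rewrite big_ord_recr.
rewrite big_split /= -IH.
have -> : \prod_(1 <= j < k.+1) rectprod z m j = \prod_(1 <= j < k) rectprod z m j * rectprod z m k.
  by case: k {IH} => [|k]; [rewrite !big_geq // rpi mulr1 | rewrite big_nat_recr].
have -> : \prod_(1 <= i < m.+1) rectprod z i k = \prod_(0 <= i < m) rectprod z i k * rectprod z m k.
  transitivity (\prod_(0 <= i < m.+1) rectprod z i k); last by rewrite big_nat_recr.
  by rewrite [RHS]big_ltn // rp0 mul1r.
by rewrite -!mulrA; congr (_ * _); rewrite mulrC -mulrA mulrCA.
Qed.

End MoreNetwork.

Section AcolDifferentiable.
Variables (K : numFieldType) (V : normedModType K).

Lemma differentiable_acol (z : V -> nat -> nat -> K) (x : V) k r c :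
  (forall i j, differentiable (fun v => z v i j) x) -> (forall i j, z x i j != 0) ->
  differentiable (fun v => acol k (z v) r c) x.
Proof.
elim: k z c => [|k IH] z c dz nz; first exact: differentiable_cst.
have db c' : differentiable (fun v => acol k (zshift (z v)) r c') x.
  by apply: (IH (fun v => zshift (z v))) => [i j|i j]; [exact: dz | exact: nz].
have dzz i : differentiable (fun v => zz (z v) i 0) x.
  by case: i => [|i]; [exact: differentiable_cst | exact: dz].
have [ck|kc] := ltnP c k.
  by rewrite (_ : (fun v => _) = (fun v => acol k (zshift (z v)) r c)) //;
    apply/funext => v; rewrite acol_lt.
rewrite -(subnKC kc); elim: (c - k)%N => [|i IHi].
  rewrite (_ : (fun v => _) = cst (r == k)%:R); first exact: differentiable_cst.
  by apply/funext => v; rewrite addn0 acol_eq.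
rewrite (_ : (fun v => _) = (fun v => zz (z v) i.+1 0 * (zz (z v) i 0)^-1 * acol k.+1 (z v) r (k + i)
   - acol k (zshift (z v)) r (k + i))); last by apply/funext => v; rewrite acol_step.
apply: differentiableB => //; apply: differentiableM => //; apply: differentiableM => //.
apply: differentiableV => //.
by case: i {IHi} => [|i]; [exact: oner_neq0 | exact: nz].
Qed.

Lemma diff_entry_affine p q (f : V -> 'M[K]_(p, q)) (x v : V) i j (a : K) :
  differentiable f x -> (forall h, f (x + h *: v) i j = f x i j + h * a) ->
  'd f x v i j = a.
Proof.
move=> df fE; have cvD := cvg_diff_quotient (v := v) df.
have H1 := cvg_comp _ _ cvD (@coord_continuous K p q i j _).
have H2 : ((fun M : 'M[K]_(p, q) => M i j) \o
     (fun h => h^-1 *: (f (x + h *: v) - f x))) h @[h --> 0^'] --> a.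
  apply: (@cvg_trans _ (a @[h --> (0 : K)^'])); last exact: cvg_cst.
  apply: near_eq_cvg; near=> h; rewrite /= !mxE fE addrAC subrr add0r mulKf //.
  by near: h; exact: nbhs_dnbhs_neq.
exact: (cvg_unique (@norm_hausdorff K K) H1 H2).
Unshelve. all: by end_near. Qed.

End AcolDifferentiable.

Section VolumeForm.
Variables (R : realType) (n k : nat).
Hypothesis hk : (1 <= k <= n - 1)%N.
Local Notation C := (Cx R).
Local Notation m := (n - k)%N.
Local Notation iota := (@embed R n k).
Local Notation J0 := (Jempty n k).
Local Notation phi := (fun z : 'M[C]_(m, k) => chart_coord J0 (iota z)).

Lemma eset_Jempty (j : 'I_k) : eset (card_Jempty hk) j = j :> nat.
Proof.
rewrite (eset_setof (card_Jempty hk) _ _ (Jempty_rect hk)); last exact: increasing_rect.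
by rewrite /rectf subn0 ltn_ord.
Qed.

Lemma eset_compl_Jempty (i : 'I_m) : eset (card_compl (card_Jempty hk)) i = (k + i)%N :> nat.
Proof.
rewrite (@eset_setof _ _ (addn k)) //.
  by split=> [s t|s]; lia.
apply/setP => c; rewrite !inE -leqNgt; apply/idP/existsP => [kc|[s /eqP ->]].
  have cm : (c - k < m)%N by have := ltn_ord c; lia.
  by exists (Ordinal cm); rewrite /= subnKC.
exact: leq_addr.
Qed.

Lemma embed_chart z : iota z = chart J0 (phi z).
Proof.
have E : cols k J0 (iota z) = 1%:M.
  apply/matrixP => i j; rewrite (colsE (card_Jempty hk)) !mxE eset_Jempty.
  by rewrite acol_id.
have := chart_coordK (card_Jempty hk) (A := iota z).
rewrite minor_empty_embed // oner_neq0 => /(_ isT) {1}->.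
by rewrite E mul1mx.
Qed.

Lemma phiE z i r : phi z i r = acol k (znat z) r (k + i).
Proof.
rewrite -(chartE_out (card_Jempty hk)) -embed_chart mxE.
by rewrite eset_compl_Jempty.
Qed.

Lemma differentiable_embed z : torus z -> differentiable iota z.
Proof.
move=> tz; apply: differentiable_mx => r c; under eq_fun do rewrite mxE.
apply: differentiable_acol; last exact: nonvan_znat.
move=> i j; rewrite /znat; case: (insub i) => [a|]; last exact: differentiable_cst.
by case: (insub j) => [b|]; [exact: differentiable_coord | exact: differentiable_cst].
Qed.

Lemma differentiable_phi z : torus z -> differentiable phi z.
Proof.
move=> tz; apply: differentiable_chart_coord; first exact: differentiable_embed.
by rewrite minor_empty_embed // oner_neq0.
Qed.

Lemma znat_delta (z : 'M[C]_(m, k)) (h : C) (a : 'I_m) (b : 'I_k) i j :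
  znat (z + h *: delta_mx a b) i j = znat z i j + h * ((i == a) && (j == b))%:R.
Proof.
rewrite /znat; case: insubP => [a' _ <-|ia]; last first.
  rewrite (_ : (i == a) = false) ?mulr0 ?addr0 //.
  by apply: contraNF ia => /eqP ->; exact: ltn_ord.
case: insubP => [b' _ <-|jb]; first by rewrite !mxE !val_eqE.
rewrite (_ : (j == b) = false) ?andbF ?mulr0 ?addr0 //.
by apply: contraNF jb => /eqP ->; exact: ltn_ord.
Qed.

(* Up to a reversal of the columns, the entry (i, r) of [phi z] is [z i r] up to
   sign plus a function of the coordinates with smaller indices. *)
Lemma jac_phi : exists2 c : C, c != 0 & forall z, torus z -> jac phi z = c.
Proof.
pose s (p : 'I_m * 'I_k) := (p.1, rev_ord p.2).
have s_inj : injective s.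
  move=> [i j] [i' j'] e; have /= -> := congr1 fst e.
  by have /= /rev_ord_inj -> := congr1 snd e.
have [eps H] := det_lin_mx_triangular C (perm s_inj).
exists ((-1) ^+ eps * \prod_(q : 'I_m * 'I_k) (-1) ^+ (k - q.2.+1)).
  rewrite mulf_neq0 ?signr_eq0 //; apply/prodf_neq0 => q _.
  by rewrite signr_eq0.
move=> z tz; have dphi := differentiable_phi tz.
have nz := nonvan_znat tz.
rewrite /jac (H _ (fun p => p.1 + p.2)%N).
  congr (_ * _); apply: eq_bigr => -[i r] _; rewrite permE /=.
  apply: diff_entry_affine => // h.
  rewrite !phiE [h * _]mulrC; apply: acol_affineP => // [i' j' ii jr|].
    rewrite xpair_eqE negb_and znat_delta => ne.
    by rewrite (_ : (_ && _) = false) ?mulr0 ?addr0 //=; lia.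
  by rewrite znat_delta !eqxx mulr1.
move=> [i' j'] [i r] /=; rewrite permE /= => nd.
(* Outside this range the entry is constant along the line. Inside it, the index is either the pivot
   or of strictly smaller rank. *)
have [le|nle] := boolP ((i' <= i) && (j' + r < k))%N; last first.
  case/eqP: nd; apply: diff_entry_affine => // h; rewrite mulr0 addr0 !phiE.
  apply: acol_depP => [|a b ha hb]; first exact: leq_addr.
  rewrite znat_delta (_ : (_ && _) = false) ?mulr0 ?addr0 //.
  by move: ha; rewrite addKn => ha; lia.
have [->|ne] := eqVneq (i', j') (s (i, r)); first by left.
right; move: ne; rewrite xpair_eqE /= -!val_eqE /=; lia.
Qed.

Lemma muprod_embed z : torus z -> muprod (iota z) = \prod_i \prod_j z i j.
Proof.
move=> tz; rewrite /muprod.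
transitivity (\prod_(1 <= i < m.+1) rectprod (znat z) i k *
              \prod_(1 <= j < k) rectprod (znat z) m j); last first.
  rewrite rectprod_border; apply: eq_bigr => i _; apply: eq_bigr => j _.
  exact: znatE.
rewrite (@big_cat_nat _ _ _ m.+1) /=; [|lia|lia]; congr (_ * _).
  rewrite !big_nat; apply: eq_bigr => i hi; rewrite minor_mu_embed //; last by lia.
  by congr rectprod; lia.
rewrite big_nat_recr /=; last by lia.
rewrite minor_mu_embed //; last by lia.
rewrite subnn minn0 [rectprod _ _ 0]/rectprod big_ord0 mulr1.
rewrite -[m.+1]add1n big_addn (_ : n - m = k)%N; last by lia.
rewrite big_nat_rev /= !big_nat; apply: eq_bigr => j hj.
by rewrite minor_mu_embed //; [congr rectprod; lia | lia].
Qed.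

Lemma jac_comp (f g : 'M[C]_(m, k) -> 'M[C]_(m, k)) z :
  differentiable f z -> differentiable g (f z) ->
  jac (g \o f) z = jac g (f z) * jac f z.
Proof.
exact: det_diff_comp.
Qed.

(** The transformation law of [omega] and the chain rule reduce every chart to that of the empty
    diagram. *)
Lemma pullback_embed (omega : top_form R n k) (J : {set 'I_n}) z :
  nonvanishing_holomorphic_form omega -> #|J| = k -> torus z -> minor J (iota z) != 0 ->
  pullback iota omega J z = omega J0 (phi z) * jac phi z.
Proof.
move=> [_ _ tr] cJ tz mJ; rewrite /pullback.
have mir : mirror (chart J0 (phi z)) by rewrite -embed_chart; exact: mirror_embed.
have mJ' : minor J (chart J0 (phi z)) != 0 by rewrite -embed_chart.
rewrite (tr J0 J (phi z) (card_Jempty hk) cJ mir mJ') /=.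
pose tau (B : 'M[C]_(m, k)) := chart_coord J (chart J0 B).
have E : (fun z => chart_coord J (iota z)) = tau \o phi.
  by apply/funext => y; rewrite /tau /= -embed_chart.
have dtau : differentiable tau (phi z).
  exact: (differentiable_transition (card_Jempty hk) mJ').
rewrite E (jac_comp (differentiable_phi tz) dtau).
by rewrite /tau -embed_chart mulrA.
Qed.

Lemma pullback_volume_form (omega : top_form R n k) :
  nonvanishing_holomorphic_form omega -> simple_poles omega ->
  exists2 c : C, c != 0 & forall (J : {set 'I_n}) z,
    #|J| = k -> torus z -> minor J (iota z) != 0 ->
    pullback iota (scale_form c omega) J z = torus_form z.
Proof.
move=> onv sp; have [c1 c10 c1E] := jac_phi.
have kn : (k <= n)%N by lia.
have mir z : torus z -> mirror (chart J0 (phi z)).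
  by move=> tz; rewrite -embed_chart; exact: mirror_embed.
(* The point with all coordinates 1 shows that the chart meets the mirror. *)
have t1 : torus (const_mx 1 : 'M[C]_(m, k)) by move=> i j; rewrite mxE oner_neq0.
have [c0 c00 c0E] := volume_coefficient kn onv (card_Jempty hk) sp (mir _ t1).
(* [c0] is the constant value of [omega] times [muprod], and [c1] is the constant Jacobian of the
   parametrisation. *)
exists (c0 * c1)^-1 => [|J z cJ tz mJ]; first by rewrite invr_eq0 mulf_neq0.
rewrite -[LHS]/((c0 * c1)^-1 * omega J _ * _) -mulrA.
rewrite -[X in _ * X]/(pullback iota omega J z) pullback_embed // c1E //.
have := c0E _ (mir z tz); rewrite -embed_chart muprod_embed // => wE.
have -> : torus_form z = (\prod_i \prod_j z i j)^-1.
  rewrite /torus_form -prodfV; apply: eq_bigr => i _; rewrite -prodfV.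
  by apply: eq_bigr.
have p0 : \prod_i \prod_j z i j != 0.
  by apply/prodf_neq0 => i _; apply/prodf_neq0 => j _; exact: tz.
rewrite -wE; move: c00; rewrite -wE mulf_eq0 negb_or => /andP[w0 _].
by field; rewrite w0 p0 c10.
Qed.

End VolumeForm.

Theorem theorem4p7 (R : realType) (n k : nat) (hk : (1 <= k <= n - 1)%N) :
  exists iota : 'M[Cx R]_(n - k, k) -> 'M[Cx R]_(k, n),
    [/\ open_embedding iota,
        forall (q : Cx R) (z : 'M[Cx R]_(n - k, k)),
          q != 0 -> torus z -> superpotential q (iota z) = laurent q z
      & forall omega : top_form R n k,
          nonvanishing_holomorphic_form omega -> simple_poles omega ->
          exists2 c : Cx R, c != 0 &
            forall (J : {set 'I_n}) (z : 'M[Cx R]_(n - k, k)),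
              #|J| = k -> torus z -> minor J (iota z) != 0 ->
              pullback iota (scale_form c omega) J z = torus_form z ].
Proof.
exists (@embed R n k); split.
- exact: embed_open.
- by move=> q z _ tz; exact: superpotential_laurent.
- by move=> omega; exact: pullback_volume_form.
Qed.
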